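(* Let $A(u)$ be a pairwise commuting family of real positive definite $n\times n$ matrices (defined $\mu$-a.e. on the support of $\Phi$), and suppose $(\det A(u))^{-1/2}\Phi(u)\in L^1(\Omega)$. Then the Hausdorff operator $\mathcal{H}_{\Phi,A}$ in $L^2(\mathbb{R}^n)$ with symbol $\varphi$ is normal and unitarily equivalent to the operator $M_\varphi$ of coordinate-wise multiplication by $\varphi$ in the space $L^2(\mathbb{R}^n,\mathbb{C}^{2^n})$ of $\mathbb{C}^{2^n}$-valued functions. More precisely, $\mathcal{H}_{\Phi,A}=\mathcal{V}^{-1}M_\varphi\mathcal{V}$, where $\mathcal{V}$ is a unitary operator from $L^2(\mathbb{R}^n)$ to $L^2(\mathbb{R}^n,\mathbb{C}^{2^n})$ which does not depend on $\Phi$ (i.e., for a fixed family $A$, with the symbols formed using a fixed diagonalizing orthogonal matrix $C$, the same $\mathcal{V}$ works for all kernels $\Phi$ satisfying the hypotheses).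
   Context: Setting: $(\Omega,\mu)$ is a $\sigma$-compact locally compact topological space endowed with a positive regular Borel measure $\mu$; $\Phi$ is a (complex-valued) locally integrable function on $\Omega$; $(A(u))_{u\in\Omega}$ is a $\mu$-measurable family of real $n\times n$ matrices defined almost everywhere in the support of $\Phi$ and satisfying $\det A(u)\neq 0$. The Hausdorff operator with kernel $\Phi$ is $$(\mathcal{H}_{\Phi,A}f)(x)=\int_\Omega \Phi(u)f(A(u)x)\,d\mu(u),$$ where $x\in\mathbb{R}^n$ is a column vector. ''Positive definite'' means real symmetric positive definite. Symbol: for a pairwise commuting family of positive definite matrices there is an orthogonal matrix $C$ such that $C^{-1}A(u)C=\mathrm{diag}[a_1(u),\dots,a_n(u)]$ for almost all $u$, with $a_j(u)>0$ the eigenvalues of $A(u)$ counted with multiplicity; such a $C$ is fixed, and it determines the order of the eigenvalues. Put $a(u)=(a_1(u),\dots,a_n(u))$ and $a(u)^{z}=\prod_{j=1}^n\exp(z_j\log a_j(u))$ for $z\in\mathbb{C}^n$, with real logarithms. The symbol of $\mathcal{H}_{\Phi,A}$ in $L^2(\mathbb{R}^n)$ is the function $$\varphi(s)=\int_\Omega \Phi(u)(\det A(u))^{-1/2}a(u)^{-is}\,d\mu(u),\qquad s\in\mathbb{R}^n .$$ *)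

(* Defs.v *)
From HB Require Import structures.
From mathcomp Require Import all_boot all_order all_algebra.
From mathcomp Require Import all_classical all_reals all_analysis.
From mathcomp Require Import complex.

Set Implicit Arguments.
Unset Strict Implicit.
Unset Printing Implicit Defensive.

Import Order.TTheory GRing.Theory Num.Theory.
Import numFieldNormedType.Exports.

Local Open Scope classical_set_scope.
Local Open Scope ring_scope.

(** The product sigma-algebra on matrices, generated by the entries, as the
    library does for tuples; for [T = R] or [T = R[i]] it is the Borel
    sigma-algebra of the finite-dimensional space. *)
Definition matrix_display : measure_display -> measure_display.
Proof. exact. Qed.

Section matrix_measurable.
Context {d} {T : measurableType d} (m n : nat).

Definition matrix_cylinder : set (set 'M[T]_(m, n)) :=
  [set X | exists i j, exists2 B : set T, measurable B &
           X = [set M : 'M[T]_(m, n) | B (M i j)]].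

HB.instance Definition _ := @isMeasurable.Build (matrix_display d)
  'M[T]_(m, n) <<s matrix_cylinder >>
  (@sigma_algebra0 _ setT matrix_cylinder) (@sigma_algebraC _ matrix_cylinder)
  (@sigma_algebra_bigcup _ setT matrix_cylinder).

Lemma measurable_entry (i : 'I_m) (j : 'I_n) :
  measurable_fun setT (fun M : 'M[T]_(m, n) => M i j).
Proof.
by move=> _ B mB; rewrite setTI; apply: sub_sigma_algebra; exists i, j, B.
Qed.

Lemma measurable_matrixP {d'} {S : measurableType d'} (D : set S)
    (f : S -> 'M[T]_(m, n)) :
  (forall i j, measurable_fun D (fun s => f s i j)) -> measurable_fun D f.
Proof.
move=> mf mD; suff : measurable_fun D f by exact.
apply: (measurability matrix_cylinder) => //.
by move=> _ [_ [i [j [B mB ->]]] <-]; exact: (mf i j mD B mB).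
Qed.

End matrix_measurable.

HB.instance Definition _ (R : realType) := isPointed.Build R[i] 0.

Definition complex_display : measure_display.
Proof. exact: default_measure_display. Qed.

(** The Borel sigma-algebra of the complex plane, generated by the real and
    imaginary parts. *)
Section complex_measurable.
Context {R : realType}.

Definition complex_cylinder : set (set R[i]) :=
  [set X | exists2 B : set R, measurable B &
           X = [set z | B (complex.Re z)] \/ X = [set z | B (complex.Im z)]].

HB.instance Definition _ := @isMeasurable.Build complex_display
  R[i] <<s complex_cylinder >>
  (@sigma_algebra0 _ setT complex_cylinder) (@sigma_algebraC _ complex_cylinder)
  (@sigma_algebra_bigcup _ setT complex_cylinder).

End complex_measurable.

(** Lebesgue measure on column vectors: the iterated product of the
    one-dimensional Lebesgue measure, transported along
    [(t, x) |-> col_mx t x]. *)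
Section lebesgue_cV.
Context {R : realType}.

Definition cons_cV n (p : R * 'cV[R]_n) : 'cV[R]_n.+1 :=
  col_mx (p.1%:M : 'cV[R]_1) p.2.

Lemma measurable_cons_cV n : measurable_fun setT (@cons_cV n).
Proof.
apply: measurable_matrixP => i j; rewrite ord1.
case: (@split_ordP 1 n i) => k ->.
- rewrite (_ : (fun _ => _) = fst); first exact: measurable_fst.
  by apply/funext => p; rewrite /cons_cV (@col_mxEu _ 1) mxE ord1 mulr1n.
- rewrite (_ : (fun _ => _) = (fun x : 'cV[R]_n => x k 0) \o snd).
    by apply: measurableT_comp; [exact: measurable_entry|exact: measurable_snd].
  by apply/funext => p; rewrite /cons_cV (@col_mxEd _ 1).
Qed.

Section step.
Variables (n : nat) (m : {sigma_finite_measure set 'cV[R]_n -> \bar R}).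

Definition lebesgue_cons : set 'cV[R]_n.+1 -> \bar R :=
  pushforward (@lebesgue_measure R \x m)%E (@cons_cV n).

Let m0 : lebesgue_cons set0 = 0%E.
Proof. by rewrite /lebesgue_cons /pushforward preimage_set0 measure0. Qed.

Let m_ge0 A : (0 <= lebesgue_cons A)%E.
Proof. exact: (measure_ge0 (@lebesgue_measure R \x m)%E). Qed.

Let m_sigma_additive : semi_sigma_additive lebesgue_cons.
Proof.
move=> F mF tF mUF; rewrite /lebesgue_cons /pushforward preimage_bigcup.
have mpre (X : set 'cV[R]_n.+1) : measurable X ->
    measurable (@cons_cV n @^-1` X).
  by move=> mX; rewrite -[X in measurable X]setTI; exact: measurable_cons_cV.
apply: measure_semi_sigma_additive.
- by move=> k; exact: mpre.
- apply/trivIsetP => /= i j _ _ ij; rewrite -preimage_setI.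
  by move/trivIsetP : tF => /(_ _ _ _ _ ij) ->//; rewrite preimage_set0.
- by rewrite -preimage_bigcup; exact: mpre.
Qed.

HB.instance Definition _ :=
  isMeasure.Build _ _ _ lebesgue_cons m0 m_ge0 m_sigma_additive.

Definition uncons_cV (x : 'cV[R]_n.+1) : R * 'cV[R]_n :=
  (x ord0 0, dsubmx (x : 'cV[R]_(1 + n))).

Lemma cons_cVK : cancel (@cons_cV n) uncons_cV.
Proof.
case=> t x; rewrite /uncons_cV /cons_cV /=; congr pair; last exact: col_mxKd.
rewrite (_ : ord0 = lshift n (0 : 'I_1)); last exact/val_inj.
by rewrite (@col_mxEu _ 1) mxE eqxx mulr1n.
Qed.

Lemma uncons_cVK : cancel uncons_cV (@cons_cV n).
Proof.
move=> x; rewrite /uncons_cV /cons_cV /=.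
rewrite -[RHS](@vsubmxK _ 1 n); congr (@col_mx _ 1 n _ _ _).
apply/matrixP => i j; rewrite !ord1 !mxE eqxx mulr1n.
by congr (x _ _); exact/val_inj.
Qed.

Lemma measurable_uncons_cV : measurable_fun setT uncons_cV.
Proof.
apply/measurable_fun_pairP; split; first exact: measurable_entry.
apply: measurable_matrixP => i j.
rewrite (_ : (fun _ => _) = (fun x : 'cV[R]_n.+1 => x (rshift 1 i) j)).
  exact: measurable_entry.
by apply/funext => x; rewrite /= mxE.
Qed.

Let m_sigma_finite : sigma_finite setT lebesgue_cons.
Proof.
have mpre X : measurable X -> measurable (uncons_cV @^-1` X).
  by move=> mX; rewrite -[X in measurable X]setTI; exact: measurable_uncons_cV.
have /sigma_finiteP[F [TF ndF Foo]] := sigma_finiteT (@lebesgue_measure R).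
have /sigma_finiteP[G [TG ndG Goo]] := sigma_finiteT m.
exists (fun k => uncons_cV @^-1` (F k `*` G k)).
  apply/esym/seteqP; split => // x _.
  have : [set: R] (uncons_cV x).1 by [].
  have : [set: 'cV[R]_n] (uncons_cV x).2 by [].
  rewrite TF TG => -[j _ Gj] [i _ Fi]; exists (maxn i j) => //; split.
  - exact: (subsetPset _ _ (ndF _ _ (leq_maxl i j)) _ Fi).
  - exact: (subsetPset _ _ (ndG _ _ (leq_maxr i j)) _ Gj).
move=> k; have [mF Fk] := Foo k; have [mG Gk] := Goo k.
split; first by apply: mpre; exact: measurableX.
rewrite /lebesgue_cons /pushforward -comp_preimage.
rewrite (_ : uncons_cV \o _ = idfun); last first.
  by apply/funext => p /=; rewrite cons_cVK.
by rewrite preimage_id product_measure1E// lte_mul_pinfty// ge0_fin_numE.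
Qed.

HB.instance Definition _ :=
  Measure_isSigmaFinite.Build _ _ _ lebesgue_cons m_sigma_finite.

End step.

Fixpoint lebesgue_cV n : {sigma_finite_measure set 'cV[R]_n -> \bar R} :=
  if n is n'.+1 return {sigma_finite_measure set 'cV[R]_n -> \bar R}
  then lebesgue_cons (lebesgue_cV n')
  else \d_ (0 : 'cV[R]_0).

Lemma lebesgue_cV_box n (B : 'I_n -> set R) :
  (forall i, measurable (B i)) ->
  lebesgue_cV n [set x | forall i, B i (x i 0)]
  = (\prod_(i < n) lebesgue_measure (B i))%E.
Proof.
elim: n B => [|n IH] B mB.
  by rewrite big_ord0 /= diracE mem_set// => -[].
have {}IH := IH (fun i => B (lift ord0 i)) (fun i => mB _).
rewrite big_ord_recl -[X in (_ * X)%E]IH.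
have mBn : measurable
    [set x : 'cV[R]_n | forall i, B (lift ord0 i) (x i 0)].
  rewrite (_ : mkset _ = \bigcap_(i in [set: 'I_n])
      ((fun x : 'cV[R]_n => x i 0) @^-1` B (lift ord0 i))).
    apply: fin_bigcap_measurable => // i _.
    by rewrite -[X in measurable X]setTI; exact: measurable_entry.
  by apply/seteqP; split => x /= h i; [move=> _|]; exact: h.
rewrite -product_measure1E//=; last exact: mB.
rewrite /lebesgue_cons /pushforward.
congr product_measure1; rewrite /preimage /setX.
have e0 t (x : 'cV[R]_n) : cons_cV (t, x) ord0 0 = t.
  by have := cons_cVK (t, x) => /(congr1 fst).
have el t (x : 'cV[R]_n) i : cons_cV (t, x) (lift ord0 i) 0 = x i 0.
  have -> : lift ord0 i = rshift 1 i by exact/val_inj.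
  by rewrite /cons_cV (@col_mxEd _ 1).
apply/seteqP; split=> -[t x] /=.
  by move=> h; split=> [|i]; [have := h ord0; rewrite e0|
    have := h (lift ord0 i); rewrite el].
by move=> [Bt Bx] i; case: (unliftP ord0 i) => [j|] ->; rewrite ?el ?e0.
Qed.

End lebesgue_cV.

Definition orthogonal_mx {R : realType} {n} (C : 'M[R]_n) : Prop :=
  C^T *m C = 1%:M.

Definition posdef {R : realType} {n} (A : 'M[R]_n) : Prop :=
  A^T = A /\ forall x : 'cV[R]_n, x != 0 -> 0 < (x^T *m A *m x) 0 0.

Definition sigma_compact (T : topologicalType) : Prop :=
  exists2 K : (set T)^nat, forall k, compact (K k) & \bigcup_k K k = setT.

Definition borel (T : ptopologicalType) := g_sigma_algebraType (@open T).

(** Every compact set is Borel as soon as [T] is Hausdorff. *)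
Definition regular_borel {R : realType} {T : ptopologicalType}
    (mu : {measure set (borel T) -> \bar R}) : Prop :=
  [/\ forall K : set (borel T), @compact T K -> measurable K ->
        (mu K < +oo)%E,
      forall E : set (borel T), measurable E ->
        mu E = ereal_inf [set mu U | U in [set U : set (borel T) | @open T U /\ E `<=` U]]
    & forall U : set (borel T), @open T U ->
        mu U = ereal_sup [set mu K | K in
                 [set K : set (borel T) | [/\ @compact T K, measurable K & K `<=` U]]]].

Section complex_integration.
Context {d} {T : measurableType d} {R : realType}.
Variable mu : {measure set T -> \bar R}.

(** Measurability with respect to the completion of [mu], on [D]. *)
Definition ae_measurable {d'} {U : measurableType d'} (D : set T)
    (f : T -> U) : Prop :=
  exists2 g : T -> U, measurable_fun setT g & f = g %[ae mu in D].

Definition cintegrable (f : T -> R[i]) : Prop :=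
  ae_measurable setT f /\
  (\int[mu]_x (ComplexField.Normc.normc (f x))%:E < +oo)%E.

Definition cintegral (f : T -> R[i]) : R[i] :=
  Complex (\int[mu]_x complex.Re (f x)) (\int[mu]_x complex.Im (f x)).

End complex_integration.

Definition locally_cintegrable {R : realType} {T : ptopologicalType}
    (mu : {measure set (borel T) -> \bar R}) (f : borel T -> R[i]) : Prop :=
  ae_measurable mu setT f /\
  forall K : set (borel T), @compact T K -> measurable K ->
    (\int[mu]_(u in K) (ComplexField.Normc.normc (f u))%:E < +oo)%E.

(** [L^2(R^n, C^m)] is handled through representatives: its elements are the
    functions satisfying [L2fun], equality is equality almost everywhere, and
    a linear operator is a map on functions that is compatible with both.
    The scalar space [L^2(R^n)] is the case [m = 1]. *)
Section L2.
Context {R : realType} {n : nat}.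
Local Notation leb := (@lebesgue_cV R n).
Local Notation "f =L2 g" := (f = g %[ae leb]) (at level 70).

Definition sqnorm {m} (v : 'cV[R[i]]_m) : R :=
  \sum_(k < m) ComplexField.Normc.normc (v k 0) ^+ 2.

Definition L2sq {m} (f : 'cV[R]_n -> 'cV[R[i]]_m) : \bar R :=
  (\int[leb]_x (sqnorm (f x))%:E)%E.

Definition L2fun {m} (f : 'cV[R]_n -> 'cV[R[i]]_m) : Prop :=
  measurable_fun setT f /\ (L2sq f < +oo)%E.

Definition L2dot {m} (f g : 'cV[R]_n -> 'cV[R[i]]_m) : R[i] :=
  cintegral leb (fun x => \sum_(k < m) f x k 0 * (g x k 0)^*).

Definition bounded_operator {m1 m2}
    (T : ('cV[R]_n -> 'cV[R[i]]_m1) -> ('cV[R]_n -> 'cV[R[i]]_m2)) : Prop :=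
  [/\ forall f, L2fun f -> L2fun (T f),
      forall f g, L2fun f -> L2fun g -> f =L2 g -> T f =L2 T g,
      forall (c : R[i]) f g, L2fun f -> L2fun g ->
        T (fun x => c *: f x + g x) =L2 (fun x => c *: T f x + T g x)
    & exists M : R, forall f, L2fun f -> (L2sq (T f) <= M%:E * L2sq f)%E].

(** [U] is unitary and [V] is its inverse. *)
Definition unitary_operator {m1 m2}
    (U : ('cV[R]_n -> 'cV[R[i]]_m1) -> ('cV[R]_n -> 'cV[R[i]]_m2))
    (V : ('cV[R]_n -> 'cV[R[i]]_m2) -> ('cV[R]_n -> 'cV[R[i]]_m1)) : Prop :=
  [/\ bounded_operator U, bounded_operator V,
      forall f g, L2fun f -> L2fun g -> L2dot (U f) (U g) = L2dot f g,
      forall f, L2fun f -> V (U f) =L2 f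
    & forall g, L2fun g -> U (V g) =L2 g].

Definition adjoint_operator {m}
    (T S : ('cV[R]_n -> 'cV[R[i]]_m) -> ('cV[R]_n -> 'cV[R[i]]_m)) : Prop :=
  bounded_operator S /\
  forall f g, L2fun f -> L2fun g -> L2dot (T f) g = L2dot f (S g).

Definition normal_operator {m}
    (T : ('cV[R]_n -> 'cV[R[i]]_m) -> ('cV[R]_n -> 'cV[R[i]]_m)) : Prop :=
  bounded_operator T /\
  exists2 S, adjoint_operator T S &
    forall f, L2fun f -> T (S f) =L2 S (T f).

Definition mul_operator {m} (phi : 'cV[R]_n -> R[i])
    (f : 'cV[R]_n -> 'cV[R[i]]_m) : 'cV[R]_n -> 'cV[R[i]]_m :=
  fun x => phi x *: f x.

End L2.

Definition cexp {R : realType} (z : R[i]) : R[i] :=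
  (expR (complex.Re z))%:C%C *
  Complex (cos (complex.Im z)) (sin (complex.Im z)).

Definition cpow {R : realType} {n} (a : 'cV[R]_n) (z : 'cV[R[i]]_n) : R[i] :=
  \prod_(j < n) cexp (z j 0 * (ln (a j 0))%:C%C).

Section Hausdorff.
Context {R : realType} {n : nat} {d} {Omega : measurableType d}.
Variable mu : {measure set Omega -> \bar R}.

(** [D] is the set on which the family [A] is defined. *)
Definition diagonalizes (D : set Omega) (A : Omega -> 'M[R]_n)
    (C : 'M[R]_n) : Prop :=
  orthogonal_mx C /\
  \forall u \ae mu, D u -> is_diag_mx (invmx C *m A u *m C).

Definition eigenvals (C A : 'M[R]_n) : 'cV[R]_n :=
  \col_j (invmx C *m A *m C) j j.

Definition hausdorff_integrand (Phi : Omega -> R[i]) (A : Omega -> 'M[R]_n)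
    (f : 'cV[R]_n -> 'cV[R[i]]_1) (x : 'cV[R]_n) : Omega -> R[i] :=
  fun u => Phi u * f (A u *m x) 0 0.

Definition hausdorff (Phi : Omega -> R[i]) (A : Omega -> 'M[R]_n)
    (f : 'cV[R]_n -> 'cV[R[i]]_1) : 'cV[R]_n -> 'cV[R[i]]_1 :=
  fun x => const_mx (cintegral mu (hausdorff_integrand Phi A f x)).

Definition symbol (C : 'M[R]_n) (Phi : Omega -> R[i])
    (A : Omega -> 'M[R]_n) (s : 'cV[R]_n) : R[i] :=
  cintegral mu (fun u =>
    Phi u * (\det (A u) `^ (- 2^-1))%:C%C *
    cpow (eigenvals C (A u)) (\col_j (- ('i%C * (s j 0)%:C%C)))).

End Hausdorff.

(* Main.v *)
From HB Require Import structures.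
Require Import Defs.
From mathcomp Require Import all_boot all_order all_algebra.
From mathcomp Require Import all_classical all_reals all_analysis.
From mathcomp Require Import measurable_realfun spectral complex ring lra.

Set Implicit Arguments.
Unset Strict Implicit.
Unset Printing Implicit Defensive.

Import Order.TTheory GRing.Theory Num.Theory.
Import numFieldNormedType.Exports.

Local Open Scope classical_set_scope.
Local Open Scope ring_scope.

(** In each orthant write [x = C (sigma e^t)] coordinatewise, with [C] the fixed
    orthogonal matrix. There [A u] acts as the translation [t |-> t + b u] by the
    logarithms [b u] of the eigenvalues, and the isometric change of variables with
    Jacobian factor [e^(sum t / 2)] turns the Hausdorff operator into [2^n] copies
    of the average of translations [F |-> int h(u) F(. + b u)], where
    [h = (det A)^(-1/2) Phi]. The Fourier transform turns this average into the
    multiplication by [phi].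

    The Fourier transform is obtained without inversion theorem as the unitary
    extension of a map between two families of Gaussian wave packets that have the
    same Gram matrix. Both families are total: a closed subspace stable under the
    multiplication by characters is stable under the multiplication by all bounded
    measurable functions, hence is everything as soon as it contains a positive
    function. *)

Local Notation Re := complex.Re.
Local Notation Im := complex.Im.
Local Notation normc := ComplexField.Normc.normc.

(** * Square-integrable complex functions *)

(** Gaussian packets are chosen because translations, modulations and, up to phases, the Fourier
    transform all permute them. Hence the Gram matrices are explicit, stability under characters is
    checked on generators, and totality of one family gives totality of the other. Three obstacles
    shape the rest. The unitary map has to exist before [Phi], and the Fourier factor comes from an
    abstract extension with no integral formula. The multiplier identity is therefore tested weakly,
    against an arbitrary [G]: for each [u] only the isometry and its effect on translations are
    used, and the transform is never pulled through the integral over [Omega]. Next, Fubini asks for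
    a sigma-finite measure; the restriction of [mu] to the set where [h] is nonzero is one, since
    integrability of [h] makes each set [|h| > 1 / k.+1] of finite measure. Finally, the data are
    measurable only up to null sets, so they are traded for measurable [h] and [g], with a single
    null set of [u] that serves all points, functions and frequencies at once. *)

Definition nsq {R : realType} (z : R[i]) : R := Re z ^+ 2 + Im z ^+ 2.

Section nsq_theory.
Context {R : realType}.
Implicit Types z w : R[i].

Lemma nsq_ge0 z : 0 <= nsq z.
Proof. by rewrite addr_ge0// sqr_ge0. Qed.

Lemma nsqE z : nsq z = ComplexField.Normc.normc z ^+ 2.
Proof. by case: z => a b; rewrite /nsq /= sqr_sqrtr// addr_ge0// sqr_ge0. Qed.

Lemma nsqM z w : nsq (z * w) = nsq z * nsq w.
Proof. by rewrite !nsqE ComplexField.Normc.normcM exprMn. Qed.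

Lemma nsqN z : nsq (- z) = nsq z.
Proof. by case: z => a b; rewrite /nsq /= !sqrrN. Qed.

Lemma nsq_conj z : nsq (conjc z) = nsq z.
Proof. by case: z => a b; rewrite /nsq /= !sqrrN. Qed.

Lemma nsq_real (a : R) : nsq a%:C%C = a ^+ 2.
Proof. by rewrite /nsq /= expr0n addr0. Qed.

Lemma nsq0 : nsq (0 : R[i]) = 0.
Proof. by rewrite /nsq /= expr0n addr0. Qed.

Lemma nsq_eq0 z : nsq z = 0 -> z = 0.
Proof.
case: z => a b; rewrite /nsq /= => /eqP; rewrite paddr_eq0 ?sqr_ge0//.
by rewrite !sqrf_eq0 => /andP[/eqP -> /eqP ->].
Qed.

Lemma mulc_conj z : z * conjc z = (nsq z)%:C%C.
Proof. by case: z => a b; rewrite /nsq; simpc; congr Complex; ring. Qed.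

Lemma normc_sqrt z : ComplexField.Normc.normc z = Num.sqrt (nsq z).
Proof. by case: z. Qed.

Lemma normc_mul_conj_le z w :
  ComplexField.Normc.normc (z * conjc w) <= nsq z + nsq w.
Proof.
rewrite ComplexField.Normc.normcM [X in _ * X]normc_sqrt nsq_conj -normc_sqrt !nsqE.
set a := ComplexField.Normc.normc z; set b := ComplexField.Normc.normc w.
by have := sqr_ge0 (a - b); have := sqr_ge0 (a + b); nra.
Qed.

Lemma nsqD_le z w : nsq (z + w) <= 2 * nsq z + 2 * nsq w.
Proof.
case: z w => a b [c e]; rewrite /nsq /=.
by have := sqr_ge0 (a - c); have := sqr_ge0 (b - e); nra.
Qed.

(** This is [2 p q <= e p^2 + q^2 / e] for the cross terms. The factor [1 + e] can be taken close to
    1, so that exact norm inequalities survive a passage to the limit, which the factor 2 of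
    [nsqD_le] would spoil. *)
Lemma nsqD_le_eps (e : R) z w : 0 < e ->
  nsq (z + w) <= (1 + e) * nsq z + (1 + e^-1) * nsq w.
Proof.
move=> e0; case: z w => a b [c f]; rewrite /nsq /=.
have key (p q : R) : 2 * (p * q) <= e * p ^+ 2 + e^-1 * q ^+ 2.
  have e0' : e != 0 by rewrite gt_eqF.
  have := mulr_ge0 (ltW (e0 : 0 < e)) (sqr_ge0 (p - e^-1 * q)).
  have -> : e * (p - e^-1 * q) ^+ 2 = e * p ^+ 2 + e^-1 * q ^+ 2 - 2 * (p * q) by field.
  by rewrite subr_ge0.
by have := key a c; have := key b f; lra.
Qed.

Lemma normr_Re_le z : `|Re z| <= ComplexField.Normc.normc z.
Proof.
by case: z => a b /=; rewrite -sqrtr_sqr ler_wsqrtr// lerDl sqr_ge0.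
Qed.

Lemma normr_Im_le z : `|Im z| <= ComplexField.Normc.normc z.
Proof.
by case: z => a b /=; rewrite -sqrtr_sqr ler_wsqrtr// lerDr sqr_ge0.
Qed.

Lemma normc_ge0 z : 0 <= ComplexField.Normc.normc z.
Proof. by case: z => a b /=; exact: sqrtr_ge0. Qed.

Lemma normc_le_ReIm z : ComplexField.Normc.normc z <= `|Re z| + `|Im z|.
Proof.
rewrite -(@ler_pXn2r _ 2%N)// ?nnegrE ?normc_ge0 ?addr_ge0//.
rewrite -nsqE /nsq sqrrD !real_normK ?num_real//.
by rewrite addrAC lerDl mulrn_wge0// mulr_ge0.
Qed.

End nsq_theory.

(** * Measurability of complex-valued functions *)

Section complex_measurable.
Context {R : realType} {d} {T : measurableType d}.
Implicit Types (D : set T) (f g : T -> R[i]).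

Lemma measurable_Re : measurable_fun setT (@complex.Re R).
Proof.
move=> _ B mB; rewrite setTI; apply: sub_sigma_algebra.
by exists B => //; left.
Qed.

Lemma measurable_Im : measurable_fun setT (@complex.Im R).
Proof.
move=> _ B mB; rewrite setTI; apply: sub_sigma_algebra.
by exists B => //; right.
Qed.

Lemma measurable_complexP D f :
  measurable_fun D f <->
  measurable_fun D (fun x => Re (f x)) /\ measurable_fun D (fun x => Im (f x)).
Proof.
split=> [mf|[mre mim] mD].
  by split; apply: measurableT_comp => //; [exact: measurable_Re|exact: measurable_Im].
suff : measurable_fun D f by exact.
apply: (measurability (@complex_cylinder R)) => //.
by move=> _ [_ [B mB [->|->]] <-]; [exact: (mre mD B mB)|exact: (mim mD B mB)].
Qed.

Lemma measurable_funcD D f g : measurable_fun D f -> measurable_fun D g ->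
  measurable_fun D (fun x => f x + g x).
Proof.
move=> /measurable_complexP[f1 f2] /measurable_complexP[g1 g2].
by apply/measurable_complexP; split;
  under eq_fun do rewrite raddfD/=; exact: measurable_funD.
Qed.

Lemma measurable_funcM D f g : measurable_fun D f -> measurable_fun D g ->
  measurable_fun D (fun x => f x * g x).
Proof.
move=> /measurable_complexP[f1 f2] /measurable_complexP[g1 g2].
apply/measurable_complexP; split.
  rewrite (_ : (fun _ => _) = (fun x => Re (f x) * Re (g x) - Im (f x) * Im (g x))).
    by apply: measurable_funB; exact: measurable_funM.
  by apply/funext => x; case: (f x) (g x) => a b [].
rewrite (_ : (fun _ => _) = (fun x => Re (f x) * Im (g x) + Im (f x) * Re (g x))).
  by apply: measurable_funD; exact: measurable_funM.
by apply/funext => x; case: (f x) (g x) => a b [].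
Qed.

Lemma measurable_conjc D f : measurable_fun D f ->
  measurable_fun D (fun x => conjc (f x)).
Proof.
move=> /measurable_complexP[f1 f2]; apply/measurable_complexP; split.
  rewrite (_ : (fun _ => _) = (fun x => Re (f x)))//.
  by apply/funext => x; case: (f x).
rewrite (_ : (fun _ => _) = (fun x => - Im (f x))); first exact: measurable_funN.
by apply/funext => x; case: (f x).
Qed.

Lemma measurable_real_complex D (h : T -> R) : measurable_fun D h ->
  measurable_fun D (fun x => (h x)%:C%C).
Proof. by move=> mh; apply/measurable_complexP; split. Qed.

Lemma measurable_funcN D f : measurable_fun D f ->
  measurable_fun D (fun x => - f x).
Proof.
move=> mf; rewrite (_ : (fun _ => _) = (fun x => (- 1)%:C%C * f x)).
  by apply: measurable_funcM => //; exact: measurable_real_complex.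
by apply/funext => x; rewrite rmorphN1 mulN1r.
Qed.

Lemma measurable_funcB D f g : measurable_fun D f -> measurable_fun D g ->
  measurable_fun D (fun x => f x - g x).
Proof. by move=> mf mg; apply: measurable_funcD => //; exact: measurable_funcN. Qed.

Lemma measurable_nsq D f : measurable_fun D f ->
  measurable_fun D (fun x => nsq (f x)).
Proof.
move=> /measurable_complexP[f1 f2].
by apply: measurable_funD; exact: measurable_funX.
Qed.

Lemma measurable_normc D f : measurable_fun D f ->
  measurable_fun D (fun x => ComplexField.Normc.normc (f x)).
Proof.
move=> mf; rewrite (_ : (fun _ => _) = Num.sqrt \o (fun x => nsq (f x))).
  by apply: measurableT_comp => //; [exact: (continuous_measurable_fun (@sqrt_continuous R))|exact: measurable_nsq].
by apply/funext => x /=; rewrite nsqE sqrtr_sqr ger0_norm// normc_ge0.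
Qed.

End complex_measurable.

(** * Integrals of complex-valued functions *)

Section cintegral_theory.
Context {d} {T : measurableType d} {R : realType}.
Variable mu : {measure set T -> \bar R}.
Lemma integrable_ext (f g : T -> \bar R) : f =1 g ->
  mu.-integrable setT f -> mu.-integrable setT g.
Proof. by move=> /funext ->. Qed.

Implicit Types f g : T -> R[i].

(** Stricter than [cintegrable]: [f] itself is measurable, not merely equal to a measurable function
    almost everywhere, so that linearity is inherited from the real integral. *)
Definition cinteg f : Prop :=
  mu.-integrable setT (fun x => (Re (f x))%:E) /\
  mu.-integrable setT (fun x => (Im (f x))%:E).

Lemma cinteg_measurable f : cinteg f -> measurable_fun setT f.
Proof.
move=> [/integrableP[+ _] /integrableP[+ _]] => /measurable_EFinP ? /measurable_EFinP ?.
exact/measurable_complexP.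
Qed.

Lemma cinteg_le f (h : T -> R) : measurable_fun setT f ->
  measurable_fun setT h -> (\int[mu]_x (h x)%:E < +oo)%E ->
  (forall x, normc (f x) <= h x) -> cinteg f.
Proof.
move=> mf mh hoo fh; have [m1 m2] := (measurable_complexP _ _).1 mf.
split; apply/integrableP; split; try exact/measurable_EFinP.
  apply: le_lt_trans hoo; apply: ge0_le_integral => //.
  - by apply: measurableT_comp => //; exact/measurable_EFinP.
  - exact/measurable_EFinP.
  - by move=> x _; rewrite lee_fin (le_trans (normr_Re_le _)).
apply: le_lt_trans hoo; apply: ge0_le_integral => //.
- by apply: measurableT_comp => //; exact/measurable_EFinP.
- exact/measurable_EFinP.
- by move=> x _; rewrite lee_fin (le_trans (normr_Im_le _)).
Qed.

Lemma cinteg_normc f : measurable_fun setT f ->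
  (\int[mu]_x (normc (f x))%:E < +oo)%E -> cinteg f.
Proof. by move=> mf h; apply: (cinteg_le mf _ h) => //; exact: measurable_normc. Qed.

Lemma cinteg_normc_lty f : cinteg f -> (\int[mu]_x (normc (f x))%:E < +oo)%E.
Proof.
move=> If; have mf := cinteg_measurable If.
have [m1 m2] := (measurable_complexP _ _).1 mf.
case: If => /integrableP[_ I1] /integrableP[_ I2].
apply: (@le_lt_trans _ _ (\int[mu]_x (`|Re (f x)|%:E + `|Im (f x)|%:E))%E).
  apply: ge0_le_integral => //.
  - by move=> x _; rewrite lee_fin normc_ge0.
  - by apply/measurable_EFinP; exact: measurable_normc.
  - by apply: emeasurable_funD; apply/measurable_EFinP; exact: measurableT_comp.
  - by move=> x _; rewrite lee_fin normc_le_ReIm.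
rewrite ge0_integralD//; first exact: lte_add_pinfty.
- by apply/measurable_EFinP; exact: measurableT_comp.
- by apply/measurable_EFinP; exact: measurableT_comp.
Qed.

Lemma cintegD f g : cinteg f -> cinteg g -> cinteg (fun x => f x + g x).
Proof.
move=> [f1 f2] [g1 g2]; split.
  by apply: (integrable_ext _ (integrableD measurableT f1 g1)) => x /=;
    rewrite raddfD.
by apply: (integrable_ext _ (integrableD measurableT f2 g2)) => x /=;
  rewrite raddfD.
Qed.

Lemma cintegZ (c : R[i]) f : cinteg f -> cinteg (fun x => c * f x).
Proof.
move=> If; have mf := cinteg_measurable If.
apply: (@cinteg_le _ (fun x => normc c * normc (f x))).
- by apply: measurable_funcM.
- by apply: measurable_funM => //; exact: measurable_normc.
- under eq_integral do rewrite EFinM.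
  rewrite ge0_integralZl//.
  + by rewrite lte_mul_pinfty// ?lee_fin ?normc_ge0// cinteg_normc_lty.
  + by apply/measurable_EFinP; exact: measurable_normc.
  + by move=> x _; rewrite lee_fin normc_ge0.
  + by rewrite lee_fin normc_ge0.
- by move=> x; rewrite ComplexField.Normc.normcM.
Qed.

Lemma cintegralD f g : cinteg f -> cinteg g ->
  cintegral mu (fun x => f x + g x) = cintegral mu f + cintegral mu g.
Proof.
move=> [f1 f2] [g1 g2]; rewrite /cintegral.
under eq_Rintegral do rewrite raddfD/=.
rewrite RintegralD//.
under [X in Complex _ X]eq_Rintegral do rewrite raddfD/=.
by rewrite RintegralD.
Qed.

Lemma cintegralZ (c : R[i]) f : cinteg f ->
  cintegral mu (fun x => c * f x) = c * cintegral mu f.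
Proof.
move=> [f1 f2]; case: c => a b; rewrite /cintegral; simpc.
have intZ (r : R) (h : T -> R) : mu.-integrable setT (EFin \o h) ->
    mu.-integrable setT (EFin \o (fun x => r * h x)).
  by move=> Ih; apply: (integrable_ext _ (integrableZl measurableT r Ih)).
congr Complex.
  rewrite -!RintegralZl// -RintegralB//; try exact: intZ.
  by apply: eq_Rintegral => x _; case: (f x).
rewrite -!RintegralZl// -RintegralD//; try exact: intZ.
by apply: eq_Rintegral => x _; case: (f x).
Qed.

Lemma cintegralN f : cinteg f -> cintegral mu (fun x => - f x) = - cintegral mu f.
Proof.
move=> If; rewrite -mulN1r -cintegralZ//; congr cintegral.
by apply/funext => x; rewrite mulN1r.
Qed.

Lemma cintegN f : cinteg f -> cinteg (fun x => - f x).
Proof.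
move=> /(cintegZ (-1)) If.
by rewrite (_ : (fun _ => _) = (fun x => -1 * f x))//; apply/funext => x; rewrite mulN1r.
Qed.

Lemma cintegralB f g : cinteg f -> cinteg g ->
  cintegral mu (fun x => f x - g x) = cintegral mu f - cintegral mu g.
Proof.
by move=> If Ig; rewrite cintegralD// ?cintegralN//; exact: cintegN.
Qed.

Lemma cintegral_conj f : cinteg f ->
  cintegral mu (fun x => conjc (f x)) = conjc (cintegral mu f).
Proof.
move=> [f1 f2]; rewrite /cintegral /=; congr Complex.
  by apply: eq_Rintegral => x _; case: (f x).
rewrite -[RHS]mulN1r -RintegralZl//.
by apply: eq_Rintegral => x _; rewrite mulN1r; case: (f x).
Qed.

Lemma cintegral0 : cintegral mu (fun=> 0) = 0.
Proof. by rewrite /cintegral /Rintegral /= integral0. Qed.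

Lemma cinteg0 : cinteg (fun=> 0).
Proof. by split; apply: (integrable_ext _ (integrable0 mu setT)). Qed.

Lemma cintegral_real (h : T -> R) :
  cintegral mu (fun x => (h x)%:C%C) = (\int[mu]_x h x)%:C%C.
Proof. by rewrite /cintegral /Rintegral /= integral0. Qed.

Lemma ae_eq_cintegral f g : measurable_fun setT f -> measurable_fun setT g ->
  (\forall x \ae mu, f x = g x) -> cintegral mu f = cintegral mu g.
Proof.
move=> /measurable_complexP[f1 f2] /measurable_complexP[g1 g2] fg.
rewrite /cintegral /Rintegral; congr (Complex (fine _) (fine _)).
  apply: ae_eq_integral => //; try exact/measurable_EFinP.
  by apply: filterS fg => x -> _.
apply: ae_eq_integral => //; try exact/measurable_EFinP.
by apply: filterS fg => x -> _.
Qed.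

(** The factor 2 comes from bounding the real and the imaginary part separately; the estimate serves
    only for finiteness and boundedness. *)
Lemma nsq_cintegral_le f : cinteg f ->
  nsq (cintegral mu f) <= 2 * (fine (\int[mu]_x (normc (f x))%:E)) ^+ 2.
Proof.
move=> If; have mf := cinteg_measurable If; have fin := cinteg_normc_lty If.
have [m1 m2] := (measurable_complexP _ _).1 mf; case: If => f1 f2.
have n0 : (0 <= \int[mu]_x (normc (f x))%:E)%E.
  by apply: integral_ge0 => x _; rewrite lee_fin normc_ge0.
have key (h : T -> R) : mu.-integrable setT (EFin \o h) ->
    (forall x, `|h x| <= normc (f x)) ->
    (\int[mu]_x h x) ^+ 2 <= (fine (\int[mu]_x (normc (f x))%:E)) ^+ 2.
  move=> Ih hf; rewrite -[leLHS]real_normK ?num_real// lerXn2r// ?nnegrE//.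
    exact: fine_ge0.
  apply: (le_trans (le_normr_Rintegral _ Ih)) => //.
  have /integrableP[mh hoo] := Ih.
  rewrite /Rintegral fine_le//.
  - by rewrite ge0_fin_numE//; apply: integral_ge0 => x _; rewrite lee_fin.
  - by rewrite ge0_fin_numE.
  - apply: ge0_le_integral => //.
    + by apply/measurable_EFinP; apply: measurableT_comp => //; exact/measurable_EFinP.
    + by apply/measurable_EFinP; exact: measurable_normc.
    + by move=> x _; rewrite lee_fin.
rewrite /nsq /cintegral /= mulr2n mulrDl mul1r; apply: lerD.
  by apply: (key _ f1) => x; exact: normr_Re_le.
by apply: (key _ f2) => x; exact: normr_Im_le.
Qed.

End cintegral_theory.

(** * Norm and inner product of square-integrable functions *)

Section square_integrable.
Context {d} {T : measurableType d} {R : realType}.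
Variable mu : {measure set T -> \bar R}.
Implicit Types f g h : T -> R[i].

Definition sqint f : Prop :=
  measurable_fun setT f /\ (\int[mu]_x (nsq (f x))%:E < +oo)%E.

(** This is the squared norm, whence the factors 2 in its triangle inequality. As [fine] sends an
    infinite integral to 0, the value is meaningful only together with [sqint]. *)
Definition nrm2 f : R := fine (\int[mu]_x (nsq (f x))%:E).

Lemma nrm2_ge0 f : 0 <= nrm2 f.
Proof. by apply: fine_ge0; apply: integral_ge0 => x _; rewrite lee_fin nsq_ge0. Qed.

Lemma nrm2E f : sqint f -> (nrm2 f)%:E = (\int[mu]_x (nsq (f x))%:E)%E.
Proof.
move=> [_ foo]; rewrite /nrm2 fineK// ge0_fin_numE//.
by apply: integral_ge0 => x _; rewrite lee_fin nsq_ge0.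
Qed.

Lemma measurable_nsqE f : measurable_fun setT f ->
  measurable_fun setT (fun x => (nsq (f x))%:E).
Proof. by move=> mf; apply/measurable_EFinP; exact: measurable_nsq. Qed.

Lemma sqint_le f g (K : R) : measurable_fun setT f -> sqint g -> 0 <= K ->
  (forall x, nsq (f x) <= K * nsq (g x)) -> sqint f.
Proof.
move=> mf [mg goo] K0 fg; split => //.
apply: (@le_lt_trans _ _ (\int[mu]_x (K%:E * (nsq (g x))%:E))%E).
  apply: ge0_le_integral => //.
  - by move=> x _; rewrite lee_fin nsq_ge0.
  - exact: measurable_nsqE.
  - by apply: emeasurable_funM => //; exact: measurable_nsqE.
  - by move=> x _; rewrite lee_fin.
rewrite ge0_integralZl//; first by rewrite lte_mul_pinfty.
- exact: measurable_nsqE.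
- by move=> x _; rewrite lee_fin nsq_ge0.
Qed.

Lemma sqintD f g : sqint f -> sqint g -> sqint (fun x => f x + g x).
Proof.
move=> [mf foo] [mg goo]; split; first exact: measurable_funcD.
apply: (@le_lt_trans _ _ (\int[mu]_x (2%:E * (nsq (f x))%:E + 2%:E * (nsq (g x))%:E))%E).
  apply: ge0_le_integral => //.
  - by move=> x _; rewrite lee_fin nsq_ge0.
  - by apply: measurable_nsqE; exact: measurable_funcD.
  - by apply: emeasurable_funD; apply: emeasurable_funM => //; exact: measurable_nsqE.
  - by move=> x _; rewrite -!EFinM -EFinD lee_fin nsqD_le.
rewrite ge0_integralD//; last first.
- by apply: emeasurable_funM => //; exact: measurable_nsqE.
- by move=> x _; rewrite -EFinM lee_fin mulr_ge0// nsq_ge0.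
- by apply: emeasurable_funM => //; exact: measurable_nsqE.
- by move=> x _; rewrite -EFinM lee_fin mulr_ge0// nsq_ge0.
rewrite !ge0_integralZl//; try exact: measurable_nsqE;
  try by (move=> x _; rewrite lee_fin nsq_ge0).
by rewrite lte_add_pinfty// lte_mul_pinfty.
Qed.

Lemma sqintZ (c : R[i]) f : sqint f -> sqint (fun x => c * f x).
Proof.
move=> Lf; apply: (sqint_le (K := nsq c) _ Lf); rewrite ?nsq_ge0//.
  by apply: measurable_funcM => //; case: Lf.
by move=> x; rewrite nsqM.
Qed.

Lemma sqintN f : sqint f -> sqint (fun x => - f x).
Proof.
move=> Lf; apply: (sqint_le (K := 1) _ Lf) => //.
  by apply: measurable_funcN; case: Lf.
by move=> x; rewrite nsqN mul1r.
Qed.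

Lemma sqintB f g : sqint f -> sqint g -> sqint (fun x => f x - g x).
Proof. by move=> Lf Lg; apply: sqintD => //; exact: sqintN. Qed.

Lemma sqint0 : sqint (fun=> 0).
Proof.
split => //; under eq_integral do rewrite nsq0.
by rewrite integral0.
Qed.

Lemma nrm2_le f g (K : R) : measurable_fun setT f -> sqint g -> 0 <= K ->
  (forall x, nsq (f x) <= K * nsq (g x)) -> nrm2 f <= K * nrm2 g.
Proof.
move=> mf Lg K0 fg; have Lf := sqint_le mf Lg K0 fg.
rewrite -lee_fin EFinM !nrm2E// -ge0_integralZl//.
- apply: ge0_le_integral => //.
  + by move=> x _; rewrite lee_fin nsq_ge0.
  + exact: measurable_nsqE.
  + by apply: emeasurable_funM => //; apply: measurable_nsqE; case: Lg.
  + by move=> x _; rewrite lee_fin.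
- by apply: measurable_nsqE; case: Lg.
- by move=> x _; rewrite lee_fin nsq_ge0.
Qed.

Lemma nrm2D_le_eps (e : R) f g : 0 < e -> sqint f -> sqint g ->
  nrm2 (fun x => f x + g x) <= (1 + e) * nrm2 f + (1 + e^-1) * nrm2 g.
Proof.
move=> e0 Lf Lg; have [mf _] := Lf; have [mg _] := Lg.
have e1 : 0 <= 1 + e by rewrite addr_ge0// ltW.
have e2 : 0 <= 1 + e^-1 by rewrite addr_ge0// invr_ge0 ltW.
have mnf := measurable_nsqE mf; have mng := measurable_nsqE mg.
rewrite -lee_fin EFinD !EFinM !nrm2E//; last exact: sqintD.
rewrite -!ge0_integralZl//; try by move=> x _; rewrite lee_fin nsq_ge0.
rewrite -ge0_integralD//; try exact: emeasurable_funM;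
  try by move=> x _; rewrite -EFinM lee_fin mulr_ge0// nsq_ge0.
apply: ge0_le_integral => //.
- by move=> x _; rewrite lee_fin nsq_ge0.
- by apply: measurable_nsqE; exact: measurable_funcD.
- by apply: emeasurable_funD; exact: emeasurable_funM.
- by move=> x _; rewrite -!EFinM -EFinD lee_fin nsqD_le_eps.
Qed.

Lemma nrm2D_le f g : sqint f -> sqint g ->
  nrm2 (fun x => f x + g x) <= 2 * nrm2 f + 2 * nrm2 g.
Proof.
move=> Lf Lg; have := nrm2D_le_eps ltr01 Lf Lg; rewrite invr1.
by have -> : 1 + 1 = 2 :> R by [].
Qed.

Lemma nrm2Z (c : R[i]) f : sqint f -> nrm2 (fun x => c * f x) = nsq c * nrm2 f.
Proof.
move=> Lf; have [mf _] := Lf; apply: EFin_inj; rewrite EFinM !nrm2E//; last exact: sqintZ.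
rewrite -ge0_integralZl//; try exact: measurable_nsqE.
- by apply: eq_integral => x _; rewrite nsqM.
- by move=> x _; rewrite lee_fin nsq_ge0.
- by rewrite lee_fin nsq_ge0.
Qed.

Lemma nrm2_sym f g : nrm2 (fun x => f x - g x) = nrm2 (fun x => g x - f x).
Proof. by rewrite /nrm2; under eq_integral do rewrite -nsqN opprB. Qed.

Lemma nrm2_trans f g h : sqint f -> sqint g -> sqint h ->
  nrm2 (fun x => f x - h x) <=
  2 * nrm2 (fun x => f x - g x) + 2 * nrm2 (fun x => g x - h x).
Proof.
move=> Lf Lg Lh; rewrite (_ : (fun x => f x - h x) =
  (fun x => (f x - g x) + (g x - h x))); last first.
  by apply/funext => x; rewrite subrKA.
by apply: nrm2D_le; exact: sqintB.
Qed.

Lemma sqint_ae f g : measurable_fun setT g -> sqint f ->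
  (\forall x \ae mu, f x = g x) -> sqint g.
Proof.
move=> mg [mf foo] fg; split => //.
rewrite -(_ : \int[mu]_x (nsq (f x))%:E = \int[mu]_x (nsq (g x))%:E)%E//.
apply: ge0_ae_eq_integral => //; try exact: measurable_nsqE;
  try by move=> x _; rewrite lee_fin nsq_ge0.
by apply: filterS fg => x ->.
Qed.

Lemma nrm2_ae f g : measurable_fun setT f -> measurable_fun setT g ->
  (\forall x \ae mu, f x = g x) -> nrm2 f = nrm2 g.
Proof.
move=> mf mg fg; congr fine; apply: ge0_ae_eq_integral => //;
  try exact: measurable_nsqE; try by move=> x _; rewrite lee_fin nsq_ge0.
by apply: filterS fg => x ->.
Qed.

Lemma nrm2_eq0 f : sqint f -> nrm2 f = 0 -> \forall x \ae mu, f x = 0.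
Proof.
move=> Lf f0; have [mf _] := Lf.
have /(ae_eq_integral_abs mu measurableT (measurable_nsqE mf)) : 
    (\int[mu]_(x in setT) `|(nsq (f x))%:E| = 0)%E.
  under eq_integral => x _ do rewrite gee0_abs ?lee_fin ?nsq_ge0//.
  by rewrite -nrm2E// f0.
by apply: filterS => x /(_ I) h; apply: nsq_eq0; exact: EFin_inj h.
Qed.

Lemma nrm2_ae0 f : (\forall x \ae mu, f x = 0) -> measurable_fun setT f -> nrm2 f = 0.
Proof.
move=> f0 mf; rewrite (nrm2_ae mf (g := fun=> 0))//.
rewrite /nrm2; under eq_integral do rewrite nsq0.
by rewrite integral0.
Qed.

Lemma cinteg_dot f g : sqint f -> sqint g -> cinteg mu (fun x => f x * conjc (g x)).
Proof.
move=> Lf Lg; have [mf foo] := Lf; have [mg goo] := Lg.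
apply: (@cinteg_le _ _ _ _ _ (fun x => nsq (f x) + nsq (g x))).
- by apply: measurable_funcM => //; exact: measurable_conjc.
- by apply: measurable_funD; exact: measurable_nsq.
- under eq_integral do rewrite EFinD.
  rewrite ge0_integralD//; try exact: measurable_nsqE;
    try by move=> x _; rewrite lee_fin nsq_ge0.
  exact: lte_add_pinfty.
- by move=> x; exact: normc_mul_conj_le.
Qed.

Definition dot f g : R[i] := cintegral mu (fun x => f x * conjc (g x)).

Lemma dotDl f g h : sqint f -> sqint g -> sqint h ->
  dot (fun x => f x + g x) h = dot f h + dot g h.
Proof.
move=> Lf Lg Lh; rewrite /dot -cintegralD; try exact: cinteg_dot.
by congr cintegral; apply/funext => x; rewrite mulrDl.
Qed.

Lemma dotZl (c : R[i]) f g : sqint f -> sqint g ->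
  dot (fun x => c * f x) g = c * dot f g.
Proof.
move=> Lf Lg; rewrite /dot -cintegralZ; last exact: cinteg_dot.
by congr cintegral; apply/funext => x; rewrite mulrA.
Qed.

Lemma dotC f g : sqint f -> sqint g -> dot g f = conjc (dot f g).
Proof.
move=> Lf Lg; rewrite /dot -cintegral_conj; last exact: cinteg_dot.
by congr cintegral; apply/funext => x; rewrite rmorphM /= conjcK mulrC.
Qed.

Lemma dotDr f g h : sqint f -> sqint g -> sqint h ->
  dot f (fun x => g x + h x) = dot f g + dot f h.
Proof.
move=> Lf Lg Lh; rewrite /dot -cintegralD; try exact: cinteg_dot.
by congr cintegral; apply/funext => x; rewrite rmorphD mulrDr.
Qed.

Lemma dotZr (c : R[i]) f g : sqint f -> sqint g ->
  dot f (fun x => c * g x) = conjc c * dot f g.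
Proof.
move=> Lf Lg; rewrite /dot -cintegralZ; last exact: cinteg_dot.
by congr cintegral; apply/funext => x; rewrite rmorphM mulrCA.
Qed.

Lemma dotBl f g h : sqint f -> sqint g -> sqint h ->
  dot (fun x => f x - g x) h = dot f h - dot g h.
Proof.
move=> Lf Lg Lh; rewrite /dot -cintegralB; try exact: cinteg_dot.
by congr cintegral; apply/funext => x; rewrite mulrBl.
Qed.

Lemma dotff f : dot f f = (nrm2 f)%:C%C.
Proof.
rewrite /dot (_ : (fun x => _) = (fun x => (nsq (f x))%:C%C)).
  by rewrite cintegral_real.
by apply/funext => x; rewrite mulc_conj.
Qed.

Lemma dot_ae f f' g g' : measurable_fun setT f -> measurable_fun setT f' ->
  measurable_fun setT g -> measurable_fun setT g' ->
  (\forall x \ae mu, f x = f' x) -> (\forall x \ae mu, g x = g' x) ->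
  dot f g = dot f' g'.
Proof.
move=> mf mf' mg mg' ff gg; apply: ae_eq_cintegral;
  try by apply: measurable_funcM => //; exact: measurable_conjc.
by apply: filterS2 ff gg => x -> ->.
Qed.

Lemma nrm2D f g : sqint f -> sqint g ->
  nrm2 (fun x => f x + g x) = nrm2 f + nrm2 g + 2 * Re (dot f g).
Proof.
move=> Lf Lg; have Lfg := sqintD Lf Lg.
have := dotff (fun x => f x + g x).
rewrite dotDl// !dotDr// !dotff (dotC Lf Lg) => /(congr1 (@complex.Re R)).
by case: (dot f g) => a b /= <-; ring.
Qed.

End square_integrable.

Arguments sqint {d T R}.
Arguments nrm2 {d T R}.
Arguments dot {d T R}.

Section isometries.
Context {d d'} {T : measurableType d} {T' : measurableType d'} {R : realType}.
Variables (mu : {measure set T -> \bar R}) (mu' : {measure set T' -> \bar R}).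

(* Polarization: Re <f, g> is read off the norms of f, g and f + g, and
   Im <f, g> is the same for -i f. *)
Lemma dot_isometry (U : (T -> R[i]) -> T' -> R[i]) f g :
  sqint mu f -> sqint mu g ->
  (forall h, sqint mu h -> sqint mu' (U h) /\ nrm2 mu' (U h) = nrm2 mu h) ->
  (forall c h k, sqint mu h -> sqint mu k ->
    \forall x \ae mu', U (fun x => c * h x + k x) x = c * U h x + U k x) ->
  dot mu' (U f) (U g) = dot mu f g.
Proof.
move=> Lf Lg iso lin; have [LUf Uf] := iso _ Lf; have [LUg Ug] := iso _ Lg.
have key c : Re (c * dot mu' (U f) (U g)) = Re (c * dot mu f g).
  have Lc := sqintD (sqintZ c Lf) Lg; have [LUc Uc] := iso _ Lc.
  have L1 := sqintZ c LUf; have L2 := sqintD L1 LUg.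
  move: Uc; rewrite (nrm2_ae _ _ (lin c _ _ Lf Lg)); [|by case: LUc|by case: L2].
  rewrite !nrm2D//; last exact: sqintZ.
  rewrite !nrm2Z// !dotZl// Uf Ug => /addrI.
  by move/mulfI; apply; rewrite pnatr_eq0.
have := key 1; have := key (- 'i%C); rewrite !mul1r.
case: (dot mu' _ _) (dot mu _ _) => a b [a' b']; simpc => /=.
by rewrite /= => -> ->.
Qed.

End isometries.

(** * Riesz-Fischer theorem for rapidly converging sequences *)

Section completeness.
Context {R : realType}.

(** The steps of [u] are at most [c 2^-k] with [c = sqrt s]. With [b k = 2 c 2^-k], the tail of that
    geometric series, [u - b] increases and [u + b] decreases, so the limit exists and lies within
    [b k] of [u k]. *)
Lemma geometric_cauchy_lim (u : nat -> R) (s : R) : 0 <= s ->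
  (forall k, 4 ^+ k * (u k.+1 - u k) ^+ 2 <= s) ->
  cvgn u /\ forall k, (limn u - u k) ^+ 2 <= 4 * (4^-1) ^+ k * s.
Proof.
move=> s0 du; pose c := Num.sqrt s; have c0 : 0 <= c := sqrtr_ge0 s.
have c2 : c ^+ 2 = s by rewrite sqr_sqrtr.
pose b k : R := 2 * c * (2^-1) ^+ k.
have bS k : b k - b k.+1 = c * (2^-1) ^+ k by rewrite /b exprS; field.
have dE k : `|u k.+1 - u k| <= c * (2^-1) ^+ k.
  rewrite -(@ler_pXn2r _ 2%N)// ?nnegrE ?mulr_ge0// ?exprn_ge0// ?invr_ge0//.
  rewrite real_normK ?num_real// exprMn c2 -exprM mulnC exprM.
  rewrite (_ : (2^-1 : R) ^+ 2 = 4^-1); last by field.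
  rewrite exprVn ler_pdivlMr ?exprn_gt0//.
  by rewrite mulrC du.
have up : {homo (fun k => u k - b k) : n m / (n <= m)%N >-> n <= m}.
  apply/nondecreasing_seqP => k.
  by have := dE k; have := bS k; rewrite ler_norml => <- /andP[]; lra.
have dn : {homo (fun k => u k + b k) : n m / (n <= m)%N >-> n >= m}.
  apply/nonincreasing_seqP => k.
  by have := dE k; have := bS k; rewrite ler_norml => <- /andP[]; lra.
have b0 k : 0 <= b k by rewrite !mulr_ge0// exprn_ge0// invr_ge0.
have cb : b k @[k --> \oo] --> 0.
  rewrite -(mulr0 (2 * c)); apply: cvgMr.
  by apply: cvg_expr; rewrite ger0_norm ?invr_ge0// invf_lt1// ltr1n.
have cu : cvgn (fun k => u k - b k).
  apply: nondecreasing_is_cvgn => //; exists (u 0%N + b 0%N) => _ [k _ <-].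
  by apply: (le_trans _ (dn _ _ (leq0n k))); have := b0 k; lra.
have [l ul] := (cvg_ex _).1 cu.
have cul : u @ \oo --> l.
  rewrite -(addr0 l) (_ : u = (fun k => u k - b k + b k)).
    exact: cvgD.
  by apply/funext => k; rewrite subrK.
have cul' : (fun k => u k + b k) @ \oo --> l by rewrite -(addr0 l); exact: cvgD.
have -> : limn u = l by exact/cvg_lim.
split; first exact: cul.
move=> k; have h1 : u k - b k <= l.
  by rewrite -(cvg_lim _ ul)//; exact: nondecreasing_cvgn_le.
have h2 : l <= u k + b k.
  rewrite -(cvg_lim _ cul')//; apply: nonincreasing_cvgn_ge => //.
  exact: cvgP cul'.
have -> : 4 * (4^-1) ^+ k * s = b k ^+ 2.
  rewrite /b !exprMn c2 -exprM mulnC exprM.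
  by rewrite (_ : (2^-1 : R) ^+ 2 = 4^-1); [ring|field].
rewrite -[leLHS]real_normK ?num_real// lerXn2r// ?nnegrE//.
by rewrite ler_norml; apply/andP; split; lra.
Qed.

Lemma measurable_geometric_lim {d} {T : measurableType d} (S : T -> \bar R)
    (u : nat -> T -> R) :
  measurable_fun setT S -> (forall k, measurable_fun setT (u k)) ->
  (forall x, 0 <= S x)%E ->
  (forall k x, (4 ^+ k * (u k.+1 x - u k x) ^+ 2)%:E <= S x)%E ->
  exists2 v : T -> R, measurable_fun setT v &
    forall x k, (S x < +oo)%E ->
      (v x - u k x) ^+ 2 <= 4 * (4^-1) ^+ k * fine (S x).
Proof.
move=> mS mu S0 uS.
pose G := [set x | (S x < +oo)%E].
have mG : measurable G.
  by rewrite -[G]setTI; exact: emeasurable_fun_infty_o.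
(* Off [G] the sequence is replaced by 0, so that the limit exists at every point and is
   measurable. *)
pose w k := (u k) \_ G.
have cw x : cvgn (w ^~ x) /\ forall k, (S x < +oo)%E ->
    (limn (w ^~ x) - u k x) ^+ 2 <= 4 * (4^-1) ^+ k * fine (S x).
  have [Gx|Gx] := pselect (G x); last first.
    have -> : w ^~ x = cst 0.
      by apply/funext => k; rewrite /w patchE memNset.
    by split=> [|k /Gx//]; exact: is_cvg_cst.
  have -> : w ^~ x = u ^~ x.
    by apply/funext => k; rewrite /w patchE mem_set.
  have Sfin : S x \is a fin_num by rewrite ge0_fin_numE.
  have [|k|c h] := @geometric_cauchy_lim (u ^~ x) (fine (S x)).
  - by rewrite fine_ge0.
  - by rewrite -lee_fin fineK.
  - by split.
exists (fun x => limn (w ^~ x)); last by move=> x k; exact: (cw x).2.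
apply: (measurable_fun_cvg (h := w)) => [k|x _].
  by apply/(measurable_restrictT _ mG); exact: measurable_funTS.
exact: (cw x).1.
Qed.

Context {d} {T : measurableType d} (mu : {measure set T -> \bar R}).

(** The series [S] of the [4^k |F k.+1 - F k|^2] has a finite integral, because [4^k 16^-k] is
    summable. Hence [S] is finite almost everywhere and controls the convergence pointwise;
    integrating that same pointwise bound gives convergence in norm. *)
Theorem sqint_complete (F : nat -> T -> R[i]) :
  (forall k, sqint mu (F k)) ->
  (forall k, nrm2 mu (fun x => F k.+1 x - F k x) <= (16^-1) ^+ k) ->
  exists2 f, sqint mu f &
    forall e : R, 0 < e -> exists K, forall k, (K <= k)%N ->
      nrm2 mu (fun x => f x - F k x) <= e.
Proof.
move=> LF dF; pose D k x := F k.+1 x - F k x.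
have LD k : sqint mu (D k) by exact: sqintB.
pose t k x : \bar R := (4 ^+ k * nsq (D k x))%:E.
have t0 k x : (0 <= t k x)%E by rewrite lee_fin mulr_ge0 ?nsq_ge0// exprn_ge0.
have mt k : measurable_fun setT (t k).
  apply/measurable_EFinP; apply: measurable_funM => //.
  by apply: measurable_nsq; case: (LD k).
pose S x := (\sum_(k <oo) t k x)%E.
have mS : measurable_fun setT S.
  exact: ge0_emeasurable_sum.
have S0 x : (0 <= S x)%E by apply: nneseries_ge0 => k _ _; exact: t0.
have tS k x : (t k x <= S x)%E.
  apply: le_trans (nneseries_lim_ge k.+1 (fun n _ _ => t0 n x)).
  by rewrite big_nat_recr//= leeDr// sume_ge0.
have It k : (\int[mu]_y t k y <= ((4^-1) ^+ k)%:E)%E.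
  rewrite /t; under eq_integral do rewrite EFinM.
  rewrite ge0_integralZl//; last 2 first.
  - by apply: measurable_nsqE; case: (LD k).
  - by move=> x _; rewrite lee_fin nsq_ge0.
  rewrite -nrm2E// -EFinM lee_fin.
  apply: (@le_trans _ _ (4 ^+ k * (16^-1) ^+ k)).
    by apply: ler_wpM2l; [rewrite exprn_ge0|exact: dF].
  by rewrite -exprMn (_ : 4 * 16^-1 = 4^-1 :> R)//; field.
have IS : (\int[mu]_y S y < +oo)%E.
  rewrite /S integral_nneseries//.
  apply: (@le_lt_trans _ _ 2%:E); last by rewrite ltry.
  apply: lime_le.
    by apply: is_cvg_nneseries => k _ _; exact: integral_ge0.
  apply: nearW => m; rewrite big_mkord.
  apply: (@le_trans _ _ (\sum_(i < m) ((4^-1) ^+ i)%:E)%E).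
    by apply: lee_sum => i _; exact: It.
  rewrite sumEFin lee_fin.
  have -> : \sum_(i < m) (4^-1) ^+ i = 4 / 3 * (1 - (4^-1) ^+ m) :> R.
    elim: m => [|m IH]; first by rewrite big_ord0 expr0 subrr mulr0.
    by rewrite big_ord_recr /= IH exprS; field.
  have : 0 <= (4^-1 : R) ^+ m by rewrite exprn_ge0// invr_ge0.
  by lra.
have mF k := (measurable_complexP _ _).1 (LF k).1.
have DRe k x : ((4 ^+ k * (Re (F k.+1 x) - Re (F k x)) ^+ 2)%:E <= S x)%E.
  apply: le_trans (tS k x); rewrite lee_fin ler_wpM2l ?exprn_ge0//.
  by rewrite /D /nsq raddfB /= lerDl sqr_ge0.
have DIm k x : ((4 ^+ k * (Im (F k.+1 x) - Im (F k x)) ^+ 2)%:E <= S x)%E.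
  apply: le_trans (tS k x); rewrite lee_fin ler_wpM2l ?exprn_ge0//.
  by rewrite /D /nsq !raddfB /= lerDr sqr_ge0.
have [a ma Ha] := measurable_geometric_lim mS (fun k => (mF k).1) S0 DRe.
have [b mb Hb] := measurable_geometric_lim mS (fun k => (mF k).2) S0 DIm.
pose f x := Complex (a x) (b x).
have mf : measurable_fun setT f by apply/measurable_complexP.
have Soo : \forall x \ae mu, (S x < +oo)%E.
  have iS : mu.-integrable setT S.
    by apply/integrableP; split => //; under eq_integral do rewrite gee0_abs//.
  apply: filterS (integrable_ae measurableT iS) => x /(_ I).
  by rewrite ge0_fin_numE.
(* The 8 is the 4 of [measurable_geometric_lim], once for the real and once for the imaginary
   part. *)
have fF k : (\int[mu]_x (nsq (f x - F k x))%:E <=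
             (8 * (4^-1) ^+ k)%:E * \int[mu]_x S x)%E.
  have c0 : 0 <= 8 * (4^-1 : R) ^+ k by rewrite mulr_ge0// exprn_ge0// invr_ge0.
  rewrite -ge0_integralZl//.
  apply: ae_ge0_le_integral => //.
  - by move=> x _; rewrite lee_fin nsq_ge0.
  - by apply: measurable_nsqE; apply: measurable_funcB => //; case: (LF k).
  - by move=> x _; rewrite mule_ge0.
  - exact: emeasurable_funM.
  apply: filterS Soo => x Sx _.
  rewrite -(@fineK _ (S x)) ?ge0_fin_numE// -EFinM lee_fin /nsq !raddfB /=.
  by have := Ha x k Sx; have := Hb x k Sx; lra.
have Lf : sqint mu f.
  have L0 : sqint mu (fun x => f x - F 0%N x).
    split; first by apply: measurable_funcB => //; case: (LF 0%N).
    apply: (le_lt_trans (fF 0%N)); rewrite lte_mul_pinfty//.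
  rewrite (_ : f = (fun x => (f x - F 0%N x) + F 0%N x)); last first.
    by apply/funext => x; rewrite subrK.
  exact: sqintD.
exists f => // e e0.
have I0 : (0 <= \int[mu]_x S x)%E by exact: integral_ge0.
have Ifin : (\int[mu]_x S x)%E \is a fin_num by rewrite ge0_fin_numE.
pose s := fine (\int[mu]_x S x)%E.
have s0 : 0 <= s by exact: fine_ge0.
have cg : (8 * s) * (4^-1) ^+ k @[k --> \oo] --> (0 : R).
  rewrite -(mulr0 (8 * s)); apply: cvgMr.
  by apply: cvg_expr; rewrite ger0_norm ?invr_ge0// invf_lt1// ltr1n.
have /cvgrPdist_le/(_ e e0)[K _ HK] := cg.
exists K => k Kk; rewrite -lee_fin nrm2E; last exact: sqintB.
apply: (le_trans (fF k)); rewrite -(fineK Ifin) -EFinM lee_fin.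
have := HK k Kk; rewrite sub0r normrN ger0_norm; last first.
  by rewrite !mulr_ge0// exprn_ge0// invr_ge0.
by rewrite -/s mulrAC.
Qed.

End completeness.

(** * Unitary maps from equal Gram matrices *)

Section combination.
Context {d} {T : measurableType d} {R : realType}.
Variables (mu : {measure set T -> \bar R}) (I : Type) (w : I -> T -> R[i]).
Hypothesis Lw : forall i, sqint mu (w i).
Implicit Types p q : seq (R[i] * I).

(** Combinations are kept formal, as lists of coefficients and indices, so that replacing [w] by
    [w'] raises no question of linear independence. *)
Definition comb p : T -> R[i] := fun x => \sum_(z <- p) z.1 * w z.2 x.

Lemma comb_nil : comb [::] = fun=> 0.
Proof. by apply/funext => x; rewrite /comb big_nil. Qed.

Lemma comb_cons z p : comb (z :: p) = fun x => z.1 * w z.2 x + comb p x.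
Proof. by apply/funext => x; rewrite /comb big_cons. Qed.

Definition scale_seq (c : R[i]) p := [seq (c * z.1, z.2) | z <- p].

Lemma comb_lin c p q :
  comb (scale_seq c p ++ q) = fun x => c * comb p x + comb q x.
Proof.
apply/funext => x; rewrite /comb big_cat/= big_map mulr_sumr.
by congr (_ + _); apply: eq_bigr => z _; rewrite mulrA.
Qed.

Lemma sqint_comb p : sqint mu (comb p).
Proof.
elim: p => [|z p IH]; first by rewrite comb_nil; exact: sqint0.
by rewrite comb_cons; apply: sqintD => //; exact: sqintZ.
Qed.

Definition total_family := forall f (e : R), sqint mu f -> 0 < e ->
  exists p, nrm2 mu (fun x => f x - comb p x) <= e.

End combination.

Section unitary_extension.
Context {d} {T : measurableType d} {R : realType}.
Variables (mu : {measure set T -> \bar R}) (I : Type).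

Section gram.
Variables w w' : I -> T -> R[i].
Hypothesis Lw : forall i, sqint mu (w i).
Hypothesis Lw' : forall i, sqint mu (w' i).
Hypothesis gram : forall i j, dot mu (w i) (w j) = dot mu (w' i) (w' j).

Lemma dot_comb p q :
  dot mu (comb w p) (comb w q) = dot mu (comb w' p) (comb w' q).
Proof.
have dot0 (g : T -> R[i]) : dot mu (fun=> 0) g = 0.
  by rewrite /dot; under eq_fun do rewrite mul0r; exact: cintegral0.
elim: p => [|z p IH]; first by rewrite !comb_nil !dot0.
rewrite !comb_cons !dotDl ?IH; try exact: sqint_comb; try exact: sqintZ.
congr (_ + _); rewrite !dotZl; try exact: sqint_comb; try exact: Lw; try exact: Lw'.
congr (_ * _); elim: q {IH} => [|y q IH].
  rewrite !comb_nil (dotC (sqint0 mu) (Lw _)) (dotC (sqint0 mu) (Lw' _)).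
  by rewrite !dot0.
rewrite !comb_cons !dotDr ?IH; try exact: sqint_comb; try exact: sqintZ;
  try exact: Lw; try exact: Lw'.
by rewrite !dotZr ?gram.
Qed.

Lemma nrm2_comb p : nrm2 mu (comb w p) = nrm2 mu (comb w' p).
Proof. by have := dot_comb p p; rewrite !dotff => /complexI. Qed.

End gram.

(* The graph of the closure of the map [w i |-> w' i]. *)
Definition gram_rel (w w' : I -> T -> R[i]) f h : Prop :=
  [/\ sqint mu f, sqint mu h & forall e : R, 0 < e -> exists p,
    nrm2 mu (fun x => f x - comb w p x) <= e /\
    nrm2 mu (fun x => h x - comb w' p x) <= e].

Lemma gram_rel_sym w w' f h : gram_rel w w' f h -> gram_rel w' w h f.
Proof. by move=> [Lf Lh r]; split => // e /r [p []]; exists p. Qed.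

Section one_sided.
Variables w w' : I -> T -> R[i].
Hypothesis Lw : forall i, sqint mu (w i).
Hypothesis Lw' : forall i, sqint mu (w' i).
Hypothesis gram : forall i j, dot mu (w i) (w j) = dot mu (w' i) (w' j).

(** On combinations the two norms agree because the Gram matrices do; the equality is carried to the
    closure by two uses of the sharp inequality [nrm2D_le_eps]. One direction is enough, the
    relation being symmetric in the two families. *)
Lemma gram_rel_nrm2_le f h : gram_rel w w' f h -> nrm2 mu f <= nrm2 mu h.
Proof.
move=> [Lf Lh r]; apply/ler_addgt0Pr => e e0.
have N0 := nrm2_ge0 mu h; set N := nrm2 mu h in N0 *.
(* The approximation is made up to [c^2] because its coefficient is [1 + c^-1], which leaves the
   small term [c^2 + c]. For [c <= 1] all error terms add up to at most [c (3 N + 6)], and [D] makes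
   this at most [e]. *)
pose D := 3 * N + 6 + e; have D0 : 0 < D by rewrite /D; lra.
pose c := e / D; have c0 : 0 < c by exact: divr_gt0.
have c1 : c <= 1 by rewrite ler_pdivrMr// /D; lra.
have cD : c * (3 * N + 6) <= e.
  rewrite /c mulrAC ler_pdivrMr// ler_pM2l// /D; lra.
have [p [p1 p2]] := r (c ^+ 2) (exprn_gt0 _ c0).
have Lp := sqint_comb Lw p; have Lp' := sqint_comb Lw' p.
have e1 : (1 + c^-1) * c ^+ 2 = c ^+ 2 + c by field; rewrite gt_eqF.
have c20 : 0 <= 1 + c^-1 by rewrite addr_ge0// invr_ge0 ltW.
have H1 : nrm2 mu f <= (1 + c) * nrm2 mu (comb w p) + (c ^+ 2 + c).
  have := nrm2D_le_eps c0 Lp (sqintB Lf Lp).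
  rewrite (_ : (fun x => _) = f); last by apply/funext => x; rewrite addrC subrK.
  by move/le_trans; apply; rewrite lerD2l -e1 ler_wpM2l.
have H2 : nrm2 mu (comb w p) <= (1 + c) * N + (c ^+ 2 + c).
  rewrite (nrm2_comb Lw Lw' gram).
  have := nrm2D_le_eps c0 Lh (sqintB Lp' Lh).
  rewrite (_ : (fun x => _) = comb w' p); last by apply/funext => x; rewrite addrC subrK.
  by move/le_trans; apply; rewrite lerD2l -e1 ler_wpM2l// nrm2_sym.
have c2 : c ^+ 2 <= c by rewrite -[leRHS]mulr1 expr2 ler_pM2l.
have cc : 0 <= c ^+ 2 by exact: sqr_ge0.
have c2N : c ^+ 2 * N <= c * N by exact: ler_wpM2r.
have c3 : c ^+ 3 <= c by rewrite -[leRHS]mulr1 exprS ler_pM2l// exprn_ile1// ltW.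
have : (1 + c) * nrm2 mu (comb w p) <= (1 + c) * ((1 + c) * N + (c ^+ 2 + c)).
  by rewrite ler_pM2l//; lra.
have -> : (1 + c) * ((1 + c) * N + (c ^+ 2 + c)) =
  N + 2 * (c * N) + c ^+ 2 * N + c ^+ 3 + 2 * c ^+ 2 + c by ring.
move: cD; rewrite mulrDr (mulrCA c 3) => cD.
by lra.
Qed.

Lemma gram_rel_lin c f h f' h' : gram_rel w w' f h -> gram_rel w w' f' h' ->
  gram_rel w w' (fun x => c * f x + f' x) (fun x => c * h x + h' x).
Proof.
move=> [Lf Lh r] [Lf' Lh' r']; split; try by apply: sqintD => //; exact: sqintZ.
move=> e e0; pose K := 2 * nsq c + 2.
have K0 : 0 < K by rewrite /K; have := nsq_ge0 c; lra.
have eK : 0 < e / K by exact: divr_gt0.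
have [p [p1 p2]] := r _ eK; have [p' [p1' p2']] := r' _ eK.
have key (v : I -> T -> R[i]) g g' : (forall i, sqint mu (v i)) -> sqint mu g -> sqint mu g' ->
  nrm2 mu (fun x => g x - comb v p x) <= e / K ->
  nrm2 mu (fun x => g' x - comb v p' x) <= e / K ->
  nrm2 mu (fun x => c * g x + g' x - (comb v (scale_seq c p ++ p')) x) <= e.
  move=> Lv Lg Lg' h1 h2; rewrite comb_lin.
  rewrite (_ : (fun x => _) = fun x => c * (g x - comb v p x) + (g' x - comb v p' x)).
    have L1 := sqintB Lg (sqint_comb Lv p).
    apply: (le_trans (nrm2D_le (sqintZ c L1) (sqintB Lg' (sqint_comb Lv p')))).
    rewrite nrm2Z//; have := ler_wpM2l (nsq_ge0 c) h1.
    have : K * (e / K) = e by rewrite mulrC divfK// gt_eqF.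
    by rewrite {1}/K; lra.
  by apply/funext => x; ring.
exists (scale_seq c p ++ p'); split; exact: key.
Qed.

Lemma gram_rel_ae f h f' h' : gram_rel w w' f h ->
  measurable_fun setT f' -> measurable_fun setT h' ->
  (\forall x \ae mu, f x = f' x) -> (\forall x \ae mu, h x = h' x) ->
  gram_rel w w' f' h'.
Proof.
move=> [Lf Lh r] mf' mh' ff hh; have Lf' := sqint_ae mf' Lf ff.
have Lh' := sqint_ae mh' Lh hh; split => // e /r [p [p1 p2]]; exists p.
have mp := (sqint_comb Lw p).1; have mp' := (sqint_comb Lw' p).1.
split.
  rewrite -(@nrm2_ae _ _ _ mu (fun x => f x - comb w p x)) //.
  - by apply: measurable_funcB => //; case: Lf.
  - exact: measurable_funcB.
  - by apply: filterS ff => x ->.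
rewrite -(@nrm2_ae _ _ _ mu (fun x => h x - comb w' p x)) //.
- by apply: measurable_funcB => //; case: Lh.
- exact: measurable_funcB.
- by apply: filterS hh => x ->.
Qed.

Lemma gram_rel_total f : total_family mu w -> sqint mu f ->
  exists h, gram_rel w w' f h.
Proof.
(* Two consecutive approximations differ by at most [2 a k.+1 + 2 a k <= 4 a k = 16^-k] in squared
   norm; so do their images, and this is the rate that [sqint_complete] asks for. *)
move=> tw Lf; pose a k : R := (16^-1) ^+ k / 4.
have a0 k : 0 < a k by rewrite divr_gt0// exprn_gt0// invr_gt0.
have [p Hp] := choice (fun k => tw f (a k) Lf (a0 k)).
pose F k := comb w' (p k).
have LF k : sqint mu (F k) by exact: sqint_comb.
have [|h Lh Hh] := sqint_complete LF.
  move=> k; pose q := scale_seq (-1) (p k) ++ p k.+1.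
  have E v : (fun x => comb v (p k.+1) x - comb v (p k) x) = comb v q.
    by rewrite comb_lin; apply/funext => x; rewrite mulN1r addrC.
  rewrite /F E -(nrm2_comb Lw Lw' gram) -E.
  apply: (le_trans (nrm2_trans (sqint_comb Lw _) Lf (sqint_comb Lw _))).
  rewrite nrm2_sym; have := Hp k; have := Hp k.+1.
  have : a k.+1 <= a k.
    rewrite /a ler_pM2r// exprS ler_piMl// ?exprn_ge0// ?invr_ge0//.
    by rewrite invf_le1// ler1n.
  have : a k * 4 = (16^-1) ^+ k by rewrite /a; field.
  by move=> <-; lra.
exists h; split => // e e0; have [K HK] := Hh e e0.
have cg : a k @[k --> \oo] --> (0 : R).
  rewrite -(mul0r (4^-1)); apply: cvgMl.
  by apply: cvg_expr; rewrite ger0_norm ?invr_ge0// invf_lt1// ltr1n.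
have /cvgrPdist_le/(_ e e0)[N _ HN] := cg.
exists (p (maxn K N)); split; last by apply: HK; exact: leq_maxl.
apply: (le_trans (Hp _)); have := HN (maxn K N) (leq_maxr _ _).
by rewrite sub0r normrN ger0_norm// ltW.
Qed.

(** Two linear isometries that permute the families in the same way, with the same scalars, preserve
    the relation. With both families equal this gives stability of a closed span; with different
    families it gives an intertwining identity. *)
Lemma gram_rel_stable (S S' : (T -> R[i]) -> T -> R[i]) (t : I -> R[i] * I) f h :
  (forall i, S (w i) = fun x => (t i).1 * w (t i).2 x) ->
  (forall i, S' (w' i) = fun x => (t i).1 * w' (t i).2 x) ->
  (forall c f g, S (fun x => c * f x + g x) = fun x => c * S f x + S g x) ->
  (forall c f g, S' (fun x => c * f x + g x) = fun x => c * S' f x + S' g x) ->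
  (forall f, sqint mu f -> sqint mu (S f) /\ nrm2 mu (S f) = nrm2 mu f) ->
  (forall f, sqint mu f -> sqint mu (S' f) /\ nrm2 mu (S' f) = nrm2 mu f) ->
  gram_rel w w' f h -> gram_rel w w' (S f) (S' h).
Proof.
move=> Sw Sw' Slin Slin' Siso Siso' [Lf Lh r].
have key (v : I -> T -> R[i]) (Z : (T -> R[i]) -> T -> R[i]) :
    (forall i, Z (v i) = fun x => (t i).1 * v (t i).2 x) ->
    (forall c f g, Z (fun x => c * f x + g x) = fun x => c * Z f x + Z g x) ->
    forall g p, (fun x => Z g x - comb v [seq (z.1 * (t z.2).1, (t z.2).2) | z <- p] x)
      = Z (fun x => g x - comb v p x).
  move=> Zv Zlin g p.
  have -> : comb v [seq (z.1 * (t z.2).1, (t z.2).2) | z <- p] = Z (comb v p).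
    elim: p => [|z p IH] /=.
      (* Linearity with coefficient -1 at two zero functions yields [Z 0 = - Z 0 + Z 0 = 0]. *)
      rewrite !comb_nil; have := Zlin (-1) (fun=> 0) (fun=> 0).
      rewrite (_ : (fun x => _) = (fun=> 0)).
        by move=> {1}->; apply/funext => x; rewrite mulN1r addNr.
      by apply/funext => x; rewrite mulr0 addr0.
    rewrite !comb_cons IH Zlin Zv; apply/funext => x /=.
    by rewrite mulrA.
  rewrite (_ : (fun x => g x - comb v p x) = (fun x => -1 * comb v p x + g x)).
    by rewrite Zlin; apply/funext => x; rewrite mulN1r addrC.
  by apply/funext => x; rewrite mulN1r addrC.
split; [exact: (Siso _ Lf).1|exact: (Siso' _ Lh).1|].
move=> e /r [p [p1 p2]]; exists [seq (z.1 * (t z.2).1, (t z.2).2) | z <- p].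
rewrite (key _ _ Sw Slin) (key _ _ Sw' Slin').
rewrite (Siso _ _).2 ?(Siso' _ _).2//; apply: sqintB => //; exact: sqint_comb.
Qed.

End one_sided.

Section unitary.
Variables w w' : I -> T -> R[i].
Hypothesis Lw : forall i, sqint mu (w i).
Hypothesis Lw' : forall i, sqint mu (w' i).
Hypothesis gram : forall i j, dot mu (w i) (w j) = dot mu (w' i) (w' j).
Hypothesis tw : total_family mu w.
Hypothesis tw' : total_family mu w'.

Lemma gram_rel_nrm2 f h : gram_rel w w' f h -> nrm2 mu f = nrm2 mu h.
Proof.
move=> r; apply/eqP; rewrite eq_le (gram_rel_nrm2_le Lw Lw' gram r).
by rewrite (gram_rel_nrm2_le Lw' Lw (fun i j => esym (gram i j)) (gram_rel_sym r)).
Qed.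

(** By linearity 0 is related to [h - h'], and related functions have equal norms. *)
Lemma gram_rel_uniq f h h' : gram_rel w w' f h -> gram_rel w w' f h' ->
  \forall x \ae mu, h x = h' x.
Proof.
move=> r r'; have [_ Lh _] := r; have [_ Lh' _] := r'.
have /gram_rel_nrm2 := gram_rel_lin Lw Lw' (-1) r' r.
rewrite (_ : (fun x => _) = (fun=> 0)).
  rewrite (nrm2_ae0 (aeW mu _))// => /esym.
  move/nrm2_eq0 => /(_ (sqintD (sqintZ _ Lh') Lh)).
  by apply: filterS => x; rewrite mulN1r addrC => /eqP; rewrite subr_eq0 => /eqP.
by apply/funext => x; rewrite mulN1r addNr.
Qed.

End unitary.

End unitary_extension.

(** * Density of subspaces stable under multipliers *)

Section smoothstep.
Context {R : realType}.
Implicit Types y : R.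

(** A polynomial self-map of [[0, 1]] with attracting fixed points 0 and 1 and a repelling one at
    1/2. Its iterates converge to a step at 1/2, which turns a multiplier into the indicator of one
    of its level sets. *)
Definition smoothstep y : R := y ^+ 2 * (3 - 2 * y).

Lemma smoothstep01 y : 0 <= y <= 1 -> 0 <= smoothstep y <= 1.
Proof.
move=> /andP[y0 y1]; rewrite /smoothstep mulr_ge0 ?sqr_ge0//=; last lra.
rewrite -subr_ge0 (_ : _ - _ = (1 - y) ^+ 2 * (1 + 2 * y)); last by ring.
by rewrite mulr_ge0 ?sqr_ge0//; lra.
Qed.

Lemma iter_smoothstep01 k y : 0 <= y <= 1 -> 0 <= iter k smoothstep y <= 1.
Proof. by move=> y01; elim: k => //= k; exact: smoothstep01. Qed.

(** Write [smoothstep z] as [z] times [z (3 - 2 z)]. For [z <= y] the second factor is at most [r],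
    its value at [y], and [1 - r = (1 - y) (1 - 2 y) > 0]; so the iterates decay geometrically. *)
Lemma cvg_iter_smoothstep_lt y : 0 <= y < 2^-1 ->
  iter k smoothstep y @[k --> \oo] --> (0 : R).
Proof.
move=> /andP[y0 y1]; pose r := y * (3 - 2 * y).
have r0 : 0 <= r by rewrite /r mulr_ge0//; lra.
have r1 : r < 1.
  rewrite -subr_gt0 (_ : _ - _ = (1 - y) * (1 - 2 * y)); last by rewrite /r; ring.
  by rewrite mulr_gt0//; lra.
have key k : 0 <= iter k smoothstep y <= y * r ^+ k.
  elim: k => [|k /andP[z0 zk]] /=; first by rewrite expr0 mulr1 y0 lexx.
  set z := iter k smoothstep y in z0 zk *.
  have zy : z <= y.
    apply: (le_trans zk); rewrite ler_piMr// exprn_ile1//.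
    exact: ltW.
  have z1 : 0 <= z * (3 - 2 * z) by rewrite mulr_ge0//; lra.
  rewrite /smoothstep expr2 -mulrA exprS (mulrCA y) mulr_ge0//=.
  rewrite [leLHS]mulrC; apply: ler_pM => //.
  rewrite /r -subr_ge0.
  have -> : y * (3 - 2 * y) - z * (3 - 2 * z) = (y - z) * (3 - 2 * (y + z)) by ring.
  by rewrite mulr_ge0//; lra.
apply: (@squeeze_cvgr _ _ _ _ (fun=> 0) (fun k => y * r ^+ k)).
- by apply: nearW => k; exact: key.
- exact: cvg_cst.
- rewrite -(mulr0 y); apply: cvgMr; apply: cvg_expr; by rewrite ger0_norm.
Qed.

Lemma iter_smoothstep_sym k y :
  iter k smoothstep (1 - y) = 1 - iter k smoothstep y.
Proof. by elim: k => //= k ->; rewrite /smoothstep; ring. Qed.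

Lemma cvg_iter_smoothstep_gt y : 2^-1 < y <= 1 ->
  iter k smoothstep y @[k --> \oo] --> (1 : R).
Proof.
move=> /andP[y0 y1].
rewrite (_ : (fun k => _) = (fun k => 1 - iter k smoothstep (1 - y))); last first.
  by apply/funext => k; rewrite -iter_smoothstep_sym opprB addrC subrK.
rewrite -[X in _ --> X]subr0; apply: cvgB; first exact: cvg_cst.
by apply: cvg_iter_smoothstep_lt; lra.
Qed.

Lemma iter_smoothstep_half k : iter k smoothstep (2^-1) = 2^-1 :> R.
Proof. by elim: k => //= k ->; rewrite /smoothstep; field. Qed.

End smoothstep.

Lemma sqr_sub_le {R : realType} (a b K : R) : `|a| <= K -> `|b| <= K ->
  (a - b) ^+ 2 <= 4 * K ^+ 2.
Proof. by move=> /ler_normlP[h1 h2] /ler_normlP[h3 h4]; nra. Qed.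

(** * Multipliers of a closed subspace *)

Section multipliers.
Context {d} {T : measurableType d} {R : realType}.
Variable mu : {measure set T -> \bar R}.
Variable M : (T -> R[i]) -> Prop.
Hypothesis M_sqint : forall f, M f -> sqint mu f.
Hypothesis M_lin : forall c f g, M f -> M g -> M (fun x => c * f x + g x).
Hypothesis M_closed : forall f, sqint mu f ->
  (forall e : R, 0 < e -> exists2 g, M g & nrm2 mu (fun x => f x - g x) <= e) -> M f.

Definition multiplier (b : T -> R[i]) : Prop :=
  [/\ measurable_fun setT b, exists K : R, forall x, nsq (b x) <= K &
      forall f, M f -> M (fun x => b x * f x)].

Lemma subspace0 f : M f -> M (fun=> 0).
Proof.
move=> Mf; rewrite (_ : (fun=> 0) = (fun x => -1 * f x + f x)); first exact: M_lin.
by apply/funext => x; rewrite mulN1r addNr.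
Qed.

Lemma subspaceZ c f : M f -> M (fun x => c * f x).
Proof.
move=> Mf; rewrite (_ : (fun _ => _) = (fun x => c * f x + 0)).
  by apply: M_lin => //; exact: subspace0 Mf.
by apply/funext => x; rewrite addr0.
Qed.

(** Closedness in norm becomes closedness under dominated pointwise limits, the form in which
    characters are turned into indicators and indicators into arbitrary functions. *)
Lemma subspace_dominated_cvg (F : nat -> T -> R[i]) f (G : T -> R) :
  (forall k, M (F k)) -> sqint mu f ->
  measurable_fun setT G -> (\int[mu]_x (G x)%:E < +oo)%E ->
  (forall k x, nsq (f x - F k x) <= G x) ->
  (forall x, nsq (f x - F k x) @[k --> \oo] --> (0 : R)) -> M f.
Proof.
move=> MF Lf mG Goo FG F0; apply: M_closed => // e e0.
have LF k := M_sqint (MF k).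
have mh k : measurable_fun setT (fun x => (nsq (f x - F k x))%:E).
  by apply: measurable_nsqE; apply: measurable_funcB; [case: Lf|case: (LF k)].
have G0 x : 0 <= G x by apply: le_trans (FG 0%N x); exact: nsq_ge0.
have iG : mu.-integrable setT (fun x => (G x)%:E).
  apply/integrableP; split; first exact/measurable_EFinP.
  by under eq_integral do rewrite gee0_abs ?lee_fin//.
have cF : \forall x \ae mu, [set: T] x -> (nsq (f x - F k x))%:E @[k --> \oo] --> 0%E.
  by apply: aeW => x _; apply: cvg_EFin; [exact: nearW|exact: F0].
have dF : \forall x \ae mu, forall k : nat, [set: T] x ->
    (`|(nsq (f x - F k x))%:E| <= (G x)%:E)%E.
  by apply: aeW => x k _; rewrite gee0_abs ?lee_fin ?nsq_ge0.
have [_ _] := dominated_convergence measurableT mh (measurable_cst _) cF iG dF.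
rewrite integral_cst// mul0e => /fine_cvgP[_ /cvgrPdist_le/(_ e e0)[K _ HK]].
exists (F K) => //; have := HK K (leqnn K).
by rewrite sub0r normrN ger0_norm// fine_ge0// integral_ge0// => x _; rewrite lee_fin nsq_ge0.
Qed.

Lemma multiplier_cst c : multiplier (fun=> c).
Proof.
split; first exact: measurable_cst.
  by exists (nsq c).
by move=> f; exact: subspaceZ.
Qed.

Lemma multiplier_lin c b b' : multiplier b -> multiplier b' ->
  multiplier (fun x => c * b x + b' x).
Proof.
move=> [mb [K bK] Mb] [mb' [K' bK'] Mb']; split.
- by apply: measurable_funcD => //; exact: measurable_funcM.
- exists (2 * (nsq c * K) + 2 * K') => x; apply: (le_trans (nsqD_le _ _)).
  rewrite nsqM; have := ler_wpM2l (nsq_ge0 c) (bK x); have := bK' x; lra.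
- move=> f Mf; rewrite (_ : (fun x => _) = (fun x => c * (b x * f x) + b' x * f x)).
    by apply: M_lin; [exact: Mb|exact: Mb'].
  by apply/funext => x; ring.
Qed.

Lemma multiplierM b b' : multiplier b -> multiplier b' ->
  multiplier (fun x => b x * b' x).
Proof.
move=> [mb [K bK] Mb] [mb' [K' bK'] Mb']; split.
- exact: measurable_funcM.
- by exists (K * K') => x; rewrite nsqM ler_pM// nsq_ge0.
- move=> f Mf; rewrite (_ : (fun x => _) = (fun x => b x * (b' x * f x))).
    by apply: Mb; exact: Mb'.
  by apply/funext => x; rewrite mulrA.
Qed.

Definition rmultiplier (b : T -> R) := multiplier (fun x => (b x)%:C%C).

Lemma rmultiplier_cst c : rmultiplier (fun=> c).
Proof. exact: multiplier_cst. Qed.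

Lemma rmultiplier_lin c b b' : rmultiplier b -> rmultiplier b' ->
  rmultiplier (fun x => c * b x + b' x).
Proof.
move=> mb mb'; have := multiplier_lin c%:C%C mb mb'.
by congr multiplier; apply/funext => x; rewrite rmorphD rmorphM.
Qed.

Lemma rmultiplierM b b' : rmultiplier b -> rmultiplier b' ->
  rmultiplier (fun x => b x * b' x).
Proof.
move=> mb mb'; have := multiplierM mb mb'.
by congr multiplier; apply/funext => x; rewrite rmorphM.
Qed.

Lemma rmultiplier_cvg (b : nat -> T -> R) (l : T -> R) (K : R) : (forall k, rmultiplier (b k)) ->
  (forall k x, `|b k x| <= K) -> (forall x, b k x @[k --> \oo] --> l x) ->
  rmultiplier l.
Proof.
move=> mb bK bl.
have mrb k : measurable_fun setT (b k).
  by have [/measurable_complexP[]] := mb k.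
have ml : measurable_fun setT l.
  by apply: (measurable_fun_cvg (h := b)) => // x _; exact: bl.
(* The sign of [K] is known only through a value of [b], hence the point [x] as an argument: [T] may
   be empty. *)
have K0 (x : T) : 0 <= K by exact: le_trans (bK 0%N x).
have lK x : `|l x| <= K.
  rewrite -(cvg_lim _ (cvg_norm (bl x)))//; apply: limr_le.
    exact: cvgP (cvg_norm (bl x)).
  by apply: nearW => k; exact: bK.
have sq (a : R) (x : T) : `|a| <= K -> nsq a%:C%C <= K ^+ 2.
  by move=> aK; rewrite nsq_real -[leLHS]real_normK ?num_real// lerXn2r// nnegrE (K0 x).
have mlc : measurable_fun setT (fun x => (l x)%:C%C) by exact: measurable_real_complex.
split => //; first by exists (K ^+ 2) => x; exact: (sq _ x).
move=> f Mf; have Lf := M_sqint Mf; have [mf _] := Lf.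
have Llf : sqint mu (fun x => (l x)%:C%C * f x).
  apply: (sqint_le (K := K ^+ 2) _ Lf); first exact: measurable_funcM.
    exact: sqr_ge0.
  by move=> x; rewrite nsqM ler_wpM2r ?nsq_ge0// (sq _ x).
have EF k x : nsq ((l x)%:C%C * f x - (b k x)%:C%C * f x) = (l x - b k x) ^+ 2 * nsq (f x).
  by rewrite -mulrBl nsqM -rmorphB nsq_real.
apply: (@subspace_dominated_cvg (fun k x => (b k x)%:C%C * f x) _ (fun x => 4 * K ^+ 2 * nsq (f x))) => //.
- by move=> k; have [_ _] := mb k; exact.
- by apply: measurable_funM => //; exact: measurable_nsq.
- under eq_integral do rewrite EFinM.
  rewrite ge0_integralZl//.
  + apply: lte_mul_pinfty => //; last by case: Lf.
    by rewrite lee_fin mulr_ge0// sqr_ge0.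
  + exact: measurable_nsqE.
  + by move=> x _; rewrite lee_fin nsq_ge0.
  + by rewrite lee_fin mulr_ge0// sqr_ge0.
- move=> k x; rewrite EF ler_wpM2r ?nsq_ge0//.
  exact: sqr_sub_le.
- move=> x; under eq_fun do rewrite EF.
  rewrite -(mul0r (nsq (f x))); apply: cvgMl.
  have h : l x - b k x @[k --> \oo] --> (0 : R).
    by rewrite -(subrr (l x)); apply: cvgB; [exact: cvg_cst|exact: bl].
  by under eq_fun do rewrite expr2; rewrite -(mulr0 (0 : R)); exact: cvgM.
Qed.

Lemma rmultiplier_smoothstep k b : rmultiplier b ->
  rmultiplier (fun x => iter k smoothstep (b x)).
Proof.
move=> mb; elim: k => //= k IH; set h := (fun x => iter k smoothstep (b x)) in IH.
have h2 := rmultiplierM IH IH.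
have h3 := rmultiplier_lin (-2) IH (rmultiplier_cst 3).
have := rmultiplierM h2 h3; congr multiplier; apply/funext => x.
by congr (_%:C)%C; rewrite /smoothstep /h; ring.
Qed.

Lemma rmultiplier_indic_half b : rmultiplier b -> (forall x, 0 <= b x <= 1) ->
  rmultiplier (\1_[set x | 2^-1 < b x]).
Proof.
move=> mb b01; pose l x : R :=
  if 2^-1 < b x then 1 else if b x == 2^-1 then 2^-1 else 0.
have ml : rmultiplier l.
  apply: (@rmultiplier_cvg (fun k x => iter k smoothstep (b x)) _ 1).
  - by move=> k; exact: rmultiplier_smoothstep.
  - by move=> k x; have /andP[h0 h1] := iter_smoothstep01 k (b01 x); rewrite ger0_norm.
  - move=> x; rewrite /l; have /andP[h0 h1] := b01 x.
    case: ltgtP => // h.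
    + by apply: cvg_iter_smoothstep_gt; rewrite h.
    + by apply: cvg_iter_smoothstep_lt; rewrite h0.
    + under eq_fun do rewrite -h iter_smoothstep_half.
      exact: cvg_cst.
(* The limit still takes the value 1/2 at the repelling fixed point; [l (2 l - 1)] sends 0, 1/2, 1
   to 0, 0, 1. *)
have := rmultiplierM ml (rmultiplier_lin 2 ml (rmultiplier_cst (-1))).
congr multiplier; apply/funext => x; congr (_%:C)%C.
rewrite indicE /l; case: ifPn => h.
  by rewrite mem_set//= mulr1n; ring.
by rewrite memNset; [rewrite /= mulr0n; case: eqP => _; field|exact/negP].
Qed.

(** At a given point, [sin ((t - a) / k.+1)] has the sign of [t - a] as soon as [k.+1] exceeds
    [|t - a|]. The set where this sine is positive is the level set above 1/2 of [(sin + 1) / 2], a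
    multiplier with values in [[0, 1]]. *)
Lemma rmultiplier_indic_gt (t : T -> R) (a : R) : 
  (forall c e : R, rmultiplier (fun x => sin (c * t x + e))) ->
  rmultiplier (\1_[set x | a < t x]).
Proof.
move=> msin; pose z k x : R := k.+1%:R^-1 * (t x - a).
have mz k : rmultiplier (\1_[set x | 0 < sin (z k x)]).
  have m1 : rmultiplier (fun x => sin (z k x)).
    have := msin (k.+1%:R^-1) (- (k.+1%:R^-1 * a)).
    by congr multiplier; apply/funext => x; rewrite /z mulrBr.
  have m2 := rmultiplier_lin (2^-1) m1 (rmultiplier_cst (2^-1)).
  have := rmultiplier_indic_half m2.
  rewrite (_ : [set x | _] = [set x | 0 < sin (z k x)]); last first.
    by apply/seteqP; split => x /=; lra.
  by apply => x; have := sin_geN1 (z k x); have := sin_le1 (z k x); lra.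
apply: (@rmultiplier_cvg (fun k => \1_[set x | 0 < sin (z k x)]) _ 1) => //.
  by move=> k x; rewrite indicE; case: (_ \in _); rewrite ?normr1 ?normr0.
move=> x.
have [N HN] : exists N : nat, `|t x - a| < N%:R.
  by exists (Num.bound `|t x - a|); exact: archi_boundP.
apply: cvg_near_cst; exists N => // k /= Nk.
have Nk1 : `|t x - a| < k.+1%:R by rewrite (lt_le_trans HN)// ler_nat leqW.
have k0 : 0 < k.+1%:R :> R by rewrite ltr0n.
have z1 : `|z k x| < 1.
  by rewrite /z normrM ger0_norm ?invr_ge0// mulrC ltr_pdivrMr// mul1r.
rewrite !indicE; congr (_%:R); congr (nat_of_bool _).
have zE : (0 < z k x) = (a < t x) by rewrite /z pmulr_rgt0 ?invr_gt0// subr_gt0.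
move: z1; rewrite ltr_norml => /andP[z1 z2].
apply/idP/idP; rewrite !inE /= -?zE => h.
- rewrite ltNge; apply/negP => z0.
  move: h; apply/negP; rewrite -leNgt.
  move: z0; rewrite le_eqVlt => /predU1P[->|z0]; first by rewrite sin0.
  by rewrite -oppr_ge0 -sinN ltW// sin2_gt0//; lra.
- by apply: sin2_gt0; lra.
Qed.

(** Complements correspond to [1 - b], intersections to products, and countable unions to bounded
    pointwise limits of finite ones. *)
Lemma sigma_algebra_rmultiplier :
  sigma_algebra setT [set E | measurable E /\ rmultiplier (\1_E)].
Proof.
have mC E : rmultiplier (\1_E) -> rmultiplier (\1_(~` E)).
  move=> mE; have := rmultiplier_lin (-1) mE (rmultiplier_cst 1).
  congr multiplier; apply/funext => x; congr (_%:C)%C; rewrite !indicE in_setC.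
  by case: (_ \in _) => /=; rewrite ?mulr1n ?mulr0n; ring.
have mI E F : rmultiplier (\1_E) -> rmultiplier (\1_F) -> rmultiplier (\1_(E `&` F)).
  move=> mE mF; have := rmultiplierM mE mF.
  by congr multiplier; apply/funext => x; rewrite indicI.
have m0 : rmultiplier (\1_set0).
  by have := rmultiplier_cst 0; congr multiplier; apply/funext => x; rewrite indic0.
split => //=.
- by move=> A [mA rA]; split; rewrite setTD; [exact: measurableC|exact: mC].
- move=> A HA; split; first by apply: bigcup_measurable => k _; case: (HA k).
  pose B k := \big[setU/set0]_(i < k) A i.
  have mB k : rmultiplier (\1_(B k)).
    elim: k => [|k IH]; first by rewrite /B big_ord0.
    rewrite /B big_ord_recr /= -[X in \1_X]setCK setCU.
    by apply/mC/mI; apply/mC => //; case: (HA k).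
  apply: (@rmultiplier_cvg (fun k => \1_(B k)) _ 1) => //.
    by move=> k x; rewrite indicE; case: (_ \in _); rewrite ?normr1 ?normr0.
  move=> x; have [[i _ Ai]|nA] := pselect ((\bigcup_k A k) x); last first.
    rewrite (_ : (fun k => _) = (fun=> \1_(\bigcup_k A k) x)); first exact: cvg_cst.
    apply/funext => k; rewrite !indicE (memNset nA) memNset//.
    by move=> Bx; apply: nA; move: Bx; rewrite /B -bigcup_mkord => -[j _ Aj]; exists j.
  apply: cvg_near_cst; exists i.+1 => // k /= ik.
  rewrite !indicE !mem_set//; first by exists i.
  by rewrite /B -bigcup_mkord; exists i.
Qed.

End multipliers.

(** * Density from indicator multipliers and one positive element *)

Section density.
Context {d} {T : measurableType d} {R : realType}.
Variable mu : {measure set T -> \bar R}.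
Variable M : (T -> R[i]) -> Prop.
Hypothesis M_sqint : forall f, M f -> sqint mu f.
Hypothesis M_lin : forall c f g, M f -> M g -> M (fun x => c * f x + g x).
Hypothesis M_closed : forall f, sqint mu f ->
  (forall e : R, 0 < e -> exists2 g, M g & nrm2 mu (fun x => f x - g x) <= e) -> M f.
Hypothesis M_indic : forall E, measurable E -> rmultiplier M (\1_E).
Variable g : T -> R.
Hypothesis mg : measurable_fun setT g.
Hypothesis g_gt0 : forall x, 0 < g x.
Hypothesis Mg : M (fun x => (g x)%:C%C).

Import HBNNSimple.

Lemma rmultiplier_nnsfun (s : {nnsfun T >-> R}) : rmultiplier M s.
Proof.
have key (t : seq R) :
    rmultiplier M (fun x => \sum_(y <- t) y * \1_(s @^-1` [set y]) x).
  elim: t => [|y t IH].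
    under eq_fun do rewrite big_nil.
    exact: (rmultiplier_cst M_lin).
  under eq_fun do rewrite big_cons.
  by apply: rmultiplier_lin => //; exact: M_indic.
have := key (finmap.enum_fset (fset_set (range s))).
by congr rmultiplier; apply/funext => x; rewrite fimfunE fsbig_finite.
Qed.

(** Positivity of [g] allows [h = (h / g) g]. Simple functions increasing to [h / g] are
    multipliers, so their products with [g] lie in [M], and the errors are dominated by [h]. *)
Lemma density_nonneg (h : T -> R) : measurable_fun setT h -> (forall x, 0 <= h x) ->
  sqint mu (fun x => (h x)%:C%C) -> M (fun x => (h x)%:C%C).
Proof.
move=> mh h0 Lh; pose q x := h x / g x.
have q0 x : 0 <= q x by rewrite divr_ge0// ltW.
have mq : measurable_fun setT q.
  apply: measurable_funM => //; apply: (measurable_comp (F := [set z : R | 0 < z])) => //.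
  - by rewrite -set_itvoy.
  - by move=> _ [x _ <-] /=.
  - apply: open_continuous_measurable_fun => //.
    move=> z; rewrite inE/= => z0; apply: cvgV; last exact: cvg_id.
    by rewrite gt_eqF.
have mqE : measurable_fun setT (EFin \o q) by exact/measurable_EFinP.
pose s := nnsfun_approx measurableT mqE.
have sq x : s k x @[k --> \oo] --> q x.
  have := cvg_nnsfun_approx measurableT mqE (fun x _ => q0 x) (x := x) Logic.I.
  by move/fine_cvgP => -[_].
have s_le k x : s k x <= q x.
  rewrite -(cvg_lim _ (sq x))//; apply: nondecreasing_cvgn_le.
    by move=> m n mn; exact/lefP/nd_nnsfun_approx.
  exact: cvgP (sq x).
have hq x : h x = q x * g x by rewrite /q divfK// gt_eqF.
apply: (subspace_dominated_cvg M_sqint M_closed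
  (F := fun k x => (s k x)%:C%C * (g x)%:C%C) (G := fun x => nsq (h x)%:C%C)) => //.
- by move=> k; have [_ _] := rmultiplier_nnsfun (s k); apply.
- by apply: measurable_nsq; case: Lh.
- by case: Lh.
- move=> k x; rewrite -rmorphM -rmorphB !nsq_real hq -mulrBl.
  do 2 rewrite exprMn; apply: ler_wpM2r; first exact: sqr_ge0.
  by apply: lerXn2r; rewrite ?nnegrE ?subr_ge0// gerBl.
- move=> x; under eq_fun do rewrite -rmorphM -rmorphB nsq_real hq -mulrBl expr2.
  have h1 : (q x - s k x) * g x @[k --> \oo] --> (0 : R).
    rewrite -(mul0r (g x)) -(subrr (q x)); apply: cvgMl.
    by apply: cvgB; [exact: cvg_cst|exact: sq].
  by rewrite -(mulr0 (0 : R)); exact: cvgM.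
Qed.

Theorem density_of_multipliers f : sqint mu f -> M f.
Proof.
move=> Lf; have [mf _] := Lf; have [mRe mIm] := (measurable_complexP _ _).1 mf.
have real (h : T -> R) : measurable_fun setT h ->
    (forall x, h x ^+ 2 <= nsq (f x)) -> M (fun x => (h x)%:C%C).
  move=> mh hf.
  have part (p : T -> R) : measurable_fun setT p -> (forall x, 0 <= p x) ->
      (forall x, p x ^+ 2 <= h x ^+ 2) -> M (fun x => (p x)%:C%C).
    move=> mp p0 ph; apply: density_nonneg => //.
    apply: (sqint_le (K := 1) _ Lf) => //; first exact: measurable_real_complex.
    by move=> x; rewrite nsq_real mul1r (le_trans (ph x)).
  have Mp : M (fun x => (h^\+ x)%:C%C).
    apply: part => //; first exact: measurable_funrpos.
    by move=> x; rewrite /funrpos; case: (leP (h x) 0) => // _; rewrite expr0n sqr_ge0.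
  have Mn : M (fun x => (h^\- x)%:C%C).
    apply: part => //; first exact: measurable_funrneg.
    by move=> x; rewrite /funrneg; case: (leP (- h x) 0) => // _; rewrite ?expr0n ?sqr_ge0// sqrrN.
  have := M_lin (-1) Mn Mp; congr M; apply/funext => x.
  by rewrite mulN1r addrC -rmorphB -[in RHS](funrposBneg h).
have M1 := real _ mRe; have M2 := real _ mIm.
have := M_lin 'i%C (M2 _) (M1 _).
rewrite (_ : (fun x => _) = f); last first.
  by apply/funext => x; rewrite addrC [RHS]complexE.
by apply => x; rewrite /nsq ?lerDl ?lerDr sqr_ge0.
Qed.

End density.

(** * Lebesgue measure on column vectors *)

Section lebesgue_cV_theory.
Context {R : realType}.

Lemma measurable_cVP {d} {S : measurableType d} n (f : S -> 'cV[R]_n) :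
  (forall i, measurable_fun setT (fun s => f s i 0)) -> measurable_fun setT f.
Proof. by move=> h; apply: measurable_matrixP => i j; rewrite ord1. Qed.

Lemma measurable_funV_entry {d} {S : measurableType d} n (f : S -> 'cV[R]_n) i :
  measurable_fun setT f -> measurable_fun setT (fun s => f s i 0).
Proof. move=> mf; exact: (measurableT_comp (measurable_entry i 0) mf). Qed.

Lemma measurable_funVD {d} {S : measurableType d} n (f g : S -> 'cV[R]_n) :
  measurable_fun setT f -> measurable_fun setT g ->
  measurable_fun setT (fun s => f s + g s).
Proof.
move=> mf mg; apply: measurable_cVP => i; under eq_fun do rewrite mxE.
by apply: measurable_funD; exact: measurable_funV_entry.
Qed.

Lemma measurable_funV_mulmx {d} {S : measurableType d} n (C : 'M[R]_n)
    (f : S -> 'cV[R]_n) :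
  measurable_fun setT f -> measurable_fun setT (fun s => C *m f s).
Proof.
move=> mf; apply: measurable_cVP => i; under eq_fun do rewrite mxE.
apply: measurable_sum => k.
apply: measurable_funM => //.
exact: measurable_funV_entry.
Qed.

Lemma ge0_integral_cons_cV n (f : 'cV[R]_n.+1 -> \bar R) :
  measurable_fun setT f -> (forall x, 0 <= f x)%E ->
  (\int[lebesgue_cV n.+1]_x f x =
   \int[lebesgue_measure]_t \int[lebesgue_cV n]_x f (cons_cV (t, x)))%E.
Proof.
move=> mf f0.
pose c : measurableTypeR R * 'cV[R]_n -> 'cV[R]_n.+1 := @cons_cV R n.
have mc : measurable_fun setT c := @measurable_cons_cV R n.
pose m : {measure set (measurableTypeR R * 'cV[R]_n) -> \bar R} :=
  (@lebesgue_measure R \x lebesgue_cV n)%E.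
have E := ge0_integral_pushforward mc m measurableT mf (fun x _ => f0 x).
rewrite preimage_setT (fubini_tonelli1 (m1 := @lebesgue_measure R)
  (m2 := lebesgue_cV n) (f \o c)) in E; first last.
- by move=> x; exact: f0.
- exact: (measurableT_comp mf).
by rewrite -[RHS]E; exact: eq_measure_integral.
Qed.

Lemma measurable_cons_cV2 n (t : R) : measurable_fun setT (fun x : 'cV[R]_n => cons_cV (t, x)).
Proof. by apply: (measurableT_comp (@measurable_cons_cV R n)); exact: pair1_measurable. Qed.

Lemma measurable_integral_cons n (f : 'cV[R]_n.+1 -> \bar R) :
  measurable_fun setT f -> (forall x, 0 <= f x)%E ->
  measurable_fun setT (fun t => \int[lebesgue_cV n]_x f (cons_cV (t, x)))%E.
Proof.
move=> mf f0.
apply: (measurable_fun_fubini_tonelli_F (m2 := lebesgue_cV n) (f \o @cons_cV R n)).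
  by apply: (measurableT_comp mf); exact: measurable_cons_cV.
by move=> x; exact: f0.
Qed.

Lemma cons_cV0 n t (x : 'cV[R]_n) : cons_cV (t, x) ord0 0 = t.
Proof. by have := cons_cVK (t, x) => /(congr1 fst). Qed.

Lemma cons_cVS n t (x : 'cV[R]_n) i : cons_cV (t, x) (lift ord0 i) 0 = x i 0.
Proof.
have -> : lift ord0 i = rshift 1 i by exact/val_inj.
by rewrite /cons_cV (@col_mxEd _ 1).
Qed.

Lemma cons_cVP n (y : 'cV[R]_n.+1) t (x : 'cV[R]_n) :
  y ord0 0 = t -> (forall i, y (lift ord0 i) 0 = x i 0) -> y = cons_cV (t, x).
Proof.
move=> h0 hS; apply/colP => i; case: (unliftP ord0 i) => [j|] ->.
  by rewrite hS cons_cVS.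
by rewrite h0 cons_cV0.
Qed.

Lemma lebesgue_measureD (a : R) (A : set R) : measurable A ->
  pushforward lebesgue_measure ((fun t => t + a) : _ -> measurableTypeR R) A
  = lebesgue_measure A.
Proof.
have ma : measurable_fun setT ((fun t => t + a) : R -> R) by exact: (measurable_funD (@measurable_id _ R setT) (measurable_cst a)).
move=> mA; apply/esym/lebesgue_measure_unique  => //.
move=> _ [[x y]] _ <-.
rewrite /= /pushforward (_ : _ @^-1` _ = `]x - a, y - a]%classic).
  rewrite !lebesgue_measure_itv/= !lte_fin ltrD2r.
  by case: ifPn => // _; rewrite -!EFinB; congr EFin; ring.
by apply/seteqP; split => t /=; rewrite !in_itv /= => /andP[h1 h2];
  apply/andP; split; lra.
Qed.

Lemma ge0_integral_shift (a : R) (f : R -> \bar R) :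
  measurable_fun setT f -> (forall x, 0 <= f x)%E ->
  (\int[lebesgue_measure]_t f (t + a)%R = \int[lebesgue_measure]_t f t)%E.
Proof.
move=> mf f0; pose phi : measurableTypeR R -> measurableTypeR R := fun t => t + a.
have mphi : measurable_fun setT phi.
  exact: (measurable_funD (@measurable_id _ R setT) (measurable_cst a)).
have mf' : measurable_fun setT (f : measurableTypeR R -> \bar R) := mf.
have E := ge0_integral_pushforward mphi lebesgue_measure measurableT mf' (fun x _ => f0 x).
rewrite preimage_setT in E; rewrite -[LHS]E.
by apply: eq_measure_integral => A mA _; exact: lebesgue_measureD.
Qed.

Lemma ge0_integral_cV_shift n (y : 'cV[R]_n) (f : 'cV[R]_n -> \bar R) :
  measurable_fun setT f -> (forall x, 0 <= f x)%E ->
  (\int[lebesgue_cV n]_x f (x + y)%R = \int[lebesgue_cV n]_x f x)%E.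
Proof.
elim: n y f => [|n IH] y f mf f0.
  by apply: eq_integral => x _; rewrite !flatmx0.
have mshift (z : 'cV[R]_n.+1) : measurable_fun setT (fun x : 'cV[R]_n.+1 => x + z).
  by apply: measurable_funVD.
rewrite [LHS]ge0_integral_cons_cV//; last exact: (measurableT_comp mf).
rewrite [RHS]ge0_integral_cons_cV//.
rewrite -[RHS](ge0_integral_shift (y ord0 0)); last first.
- by move=> t; exact: integral_ge0.
- exact: measurable_integral_cons.
apply: eq_integral => t _.
pose y' : 'cV[R]_n := \col_i y (lift ord0 i) 0.
rewrite -[RHS](IH y')//; last first.
  by apply: (measurableT_comp mf); exact: measurable_cons_cV2.
apply: eq_integral => x _; congr f; apply: cons_cVP.
  by rewrite mxE cons_cV0.
by move=> i; rewrite mxE cons_cVS !mxE.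
Qed.

Definition gaussV n (x : 'cV[R]_n) : R := expR (- \sum_i x i 0 ^+ 2).

Lemma measurable_gaussV n : measurable_fun setT (@gaussV n).
Proof.
apply: measurableT_comp => //; apply: measurable_funN; apply: measurable_sum => i.
by apply: measurable_funX; exact: measurable_entry.
Qed.

Lemma gaussV_cons n t (x : 'cV[R]_n) :
  gaussV (cons_cV (t, x)) = gauss_fun t * gaussV x.
Proof.
rewrite /gaussV /gauss_fun -expRD big_ord_recl cons_cV0 opprD; congr (expR (_ - _)).
by apply: eq_bigr => i _; rewrite cons_cVS.
Qed.

(** Positivity and finiteness allow this factor to be cancelled in the rotation argument; finiteness
    also makes the wave packets square integrable. *)
Lemma integral_gaussV_proper n :
  (0 < \int[lebesgue_cV n]_x (gaussV x)%:E < +oo)%E.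
Proof.
have g0 k (x : 'cV[R]_k) : [set: 'cV[R]_k] x -> (0 <= (gaussV x)%:E)%E.
  by move=> _; rewrite lee_fin expR_ge0.
have mg k : measurable_fun setT (fun x => (@gaussV k x)%:E).
  by apply/measurable_EFinP; exact: measurable_gaussV.
elim: n => [|n /andP[IH1 IH2]].
  rewrite integral_dirac//=; last exact: mg.
  rewrite diracE mem_set// mul1e lte_fin expR_gt0/=.
  by rewrite ltry.
rewrite ge0_integral_cons_cV//; last by move=> x; exact: g0.
rewrite (_ : integral _ _ _ = (Num.sqrt pi)%:E * \int[lebesgue_cV n]_x (gaussV x)%:E)%E.
  by rewrite mule_gt0 ?lte_fin ?sqrtr_gt0 ?pi_gt0//= lte_mul_pinfty// lee_fin sqrtr_ge0.
rewrite -integralT_gauss -ge0_integralZr//; first last.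
- exact: ltW.
- by move=> x _; rewrite lee_fin gauss_fun_ge0.
- by apply/measurable_EFinP; exact: measurable_gauss_fun.
apply: eq_integral => t _.
under eq_integral => x _ do rewrite gaussV_cons EFinM.
rewrite ge0_integralZl//; try exact: mg.
  by move=> x; exact: g0.
by rewrite lee_fin gauss_fun_ge0.
Qed.

Lemma gaussV_orthogonal n (C : 'M[R]_n) (x : 'cV[R]_n) :
  C^T *m C = 1%:M -> gaussV (C *m x) = gaussV x.
Proof.
have E (z : 'cV[R]_n) : \sum_i z i 0 ^+ 2 = (z^T *m z) 0 0.
  by rewrite mxE; apply: eq_bigr => i _; rewrite mxE expr2.
move=> CC; rewrite /gaussV !E trmx_mul -mulmxA (mulmxA C^T) CC mul1mx.
by [].
Qed.

(* Against the rotation-invariant weight G = gaussV, two translations and one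
   exchange of the integrals turn (int G) * int f(C x) into (int G) * int f. *)
Lemma ge0_integral_cV_orthogonal n (C : 'M[R]_n) (f : 'cV[R]_n -> \bar R) :
  C^T *m C = 1%:M -> measurable_fun setT f -> (forall x, 0 <= f x)%E ->
  (\int[lebesgue_cV n]_x f (C *m x)%R = \int[lebesgue_cV n]_x f x)%E.
Proof.
move=> CC mf f0; have CC' : C *m C^T = 1%:M by exact: mulmx1C.
have /andP[K0 Koo] := integral_gaussV_proper n.
set K := (\int[_]_x _)%E in K0 Koo.
have mG : measurable_fun setT (fun x : 'cV[R]_n => (gaussV x)%:E).
  by apply/measurable_EFinP; exact: measurable_gaussV.
have G0 (x : 'cV[R]_n) : (0 <= (gaussV x)%:E)%E by rewrite lee_fin expR_ge0.
have mC : measurable_fun setT (fun x : 'cV[R]_n => C *m x).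
  exact: measurable_funV_mulmx.
have mfC : measurable_fun setT (fun x : 'cV[R]_n => f (C *m x)).
  exact: measurableT_comp.
suff : (K * \int[lebesgue_cV n]_x f (C *m x)%R = K * \int[lebesgue_cV n]_x f x)%E.
  have Kn : fine K != 0 by rewrite gt_eqF// fine_gt0// K0.
  have -> : K = (fine K)%:E by rewrite fineK// ge0_fin_numE// ltW.
  by move/(congr1 (fun z => (fine K)^-1%:E * z)%E); rewrite !muleA -EFinM mulVf ?mul1e.
have mfst : measurable_fun setT (fun p : 'cV[R]_n * 'cV[R]_n => p.1) by exact: measurable_fst.
have msnd : measurable_fun setT (fun p : 'cV[R]_n * 'cV[R]_n => p.2) by exact: measurable_snd.
pose F1 (p : 'cV[R]_n * 'cV[R]_n) : \bar R := ((gaussV p.1)%:E * f (C *m p.2 + p.1)%R)%E.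
have mF1 : measurable_fun setT F1.
  apply: emeasurable_funM; first exact: (measurableT_comp mG mfst).
  apply: (measurableT_comp mf); apply: measurable_funVD => //.
  exact: measurable_funV_mulmx.
transitivity (\int[lebesgue_cV n]_y \int[lebesgue_cV n]_x F1 (y, x))%E.
  rewrite -ge0_integralZr//; last exact: integral_ge0.
  apply: eq_integral => y _; rewrite /F1 /= ge0_integralZl//; last first.
    apply: (measurableT_comp mf); apply: measurable_funVD => //.
  (* Here [C x + y = C (x + C^T y)], so a translation of [x] absorbs [y]. *)
  congr (_ * _)%E; rewrite -(ge0_integral_cV_shift (C^T *m y) mfC (fun x => f0 _)).
  by apply: eq_integral => x _; rewrite mulmxDr mulmxA CC' mul1mx.
rewrite (fubini_tonelli F1) => //; last by move=> p; rewrite mule_ge0.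
pose F2 (p : 'cV[R]_n * 'cV[R]_n) : \bar R := ((gaussV (p.2 - C *m p.1)%R)%:E * f p.2)%E.
have mF2 : measurable_fun setT F2.
  apply: emeasurable_funM; last exact: (measurableT_comp mf msnd).
  apply: (measurableT_comp mG); apply: measurable_funVD => //.
  rewrite (_ : (fun p => _) = (fun p => (- C) *m p.1)); first exact: measurable_funV_mulmx.
  by apply/funext => p; rewrite mulNmx.
transitivity (\int[lebesgue_cV n]_x \int[lebesgue_cV n]_y F2 (x, y))%E.
  apply: eq_integral => x _; rewrite -(ge0_integral_cV_shift (- (C *m x))%R (f := fun y => F1 (y, x))).
  - by apply: eq_integral => y _; rewrite /F1 /F2 /= addrCA subrr addr0.
  - by apply: (measurableT_comp mF1); exact: pair2_measurable.
  - by move=> y; rewrite mule_ge0.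
rewrite (fubini_tonelli F2)//; last by move=> p; rewrite mule_ge0.
rewrite -ge0_integralZl//; last exact: ltW.
apply: eq_integral => y _; rewrite /F2 /= ge0_integralZr//; last first.
  apply: (measurableT_comp mG); apply: measurable_funVD => //.
  rewrite (_ : (fun p => _) = (fun p => (- C) *m p)); first exact: measurable_funV_mulmx.
  by apply/funext => p; rewrite mulNmx.
congr (_ * _)%E.
transitivity (\int[lebesgue_cV n]_x (gaussV (x - C^T *m y))%:E)%E; last first.
  exact: (ge0_integral_cV_shift (- (C^T *m y)) mG G0).
apply: eq_integral => x _; congr EFin.
(* Rotating [x - C^T y] by [C] gives [C x - y], and the weight is even. *)
rewrite -(gaussV_orthogonal (x - C^T *m y) CC) mulmxBr mulmxA CC' mul1mx.
rewrite /gaussV; congr (expR (- _)); apply: eq_bigr => i _.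
by rewrite !mxE -sqrrN opprB.
Qed.

End lebesgue_cV_theory.

(** * Images of measures with a density *)

Section weighted_pushforward.
Context {d1 d2} {T1 : measurableType d1} {T2 : measurableType d2} {R : realType}.
Variables (mu : {measure set T1 -> \bar R}) (w : T1 -> R) (phi : T1 -> T2).
Hypothesis mw : measurable_fun setT w.
Hypothesis w0 : forall x, 0 <= w x.
Hypothesis mphi : measurable_fun setT phi.

Let mwE : measurable_fun setT (fun x => (w x)%:E).
Proof. exact/measurable_EFinP. Qed.

(** The image under [phi] of the measure with density [w]. It is used with the weight [expR] for the
    exponential substitution, and with an indicator and the identity map for restricting a measure
    to a support. *)
Definition wpush (E : set T2) : \bar R := (\int[mu]_(x in phi @^-1` E) (w x)%:E)%E.

Let wpush0 : wpush set0 = 0%E.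
Proof. by rewrite /wpush preimage_set0 integral_set0. Qed.

Let wpush_ge0 E : (0 <= wpush E)%E.
Proof. by apply: integral_ge0 => x _; rewrite lee_fin. Qed.

Let mpre E : measurable E -> measurable (phi @^-1` E).
Proof. by move=> mE; rewrite -[X in measurable X]setTI; exact: mphi. Qed.

Let wpush_sigma_additive : semi_sigma_additive wpush.
Proof.
move=> F mF tF mUF; rewrite /wpush preimage_bigcup ge0_integral_bigcup//.
- apply: is_cvg_ereal_nneg_natsum_cond => n _ _; by apply: integral_ge0 => x _; rewrite lee_fin.
- by move=> k; exact: mpre.
- by apply: measurable_funTS; exact/measurable_EFinP.
- by move=> x _; rewrite lee_fin.
- apply/trivIsetP => i j _ _ ij; rewrite -preimage_setI.
  by move/trivIsetP : tF => /(_ _ _ Logic.I Logic.I ij) ->; rewrite preimage_set0.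
Qed.

HB.instance Definition _ :=
  isMeasure.Build _ _ _ wpush wpush0 wpush_ge0 wpush_sigma_additive.

Definition wpush_measure : {measure set T2 -> \bar R} := wpush.

Import HBNNSimple.

Lemma ge0_integral_wpush (f : T2 -> \bar R) :
  measurable_fun setT f -> (forall x, 0 <= f x)%E ->
  (\int[wpush]_y f y = \int[mu]_x (f (phi x) * (w x)%:E))%E.
Proof.
move=> mf f0; pose h := nnsfun_approx measurableT mf.
have hf y : EFin \o h ^~ y @ \oo --> f y by exact: cvg_nnsfun_approx.
have hnd y : {homo (fun n => (h n y)%:E) : m n / (m <= n)%N >-> (m <= n)%E}.
  by move=> m n mn; rewrite lee_fin; exact/lefP/nd_nnsfun_approx.
have mhphi n : measurable_fun setT (fun x => (h n (phi x))%:E).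
  by apply/measurable_EFinP; apply: (measurableT_comp _ mphi).
transitivity (limn (fun n => \int[wpush]_y (h n y)%:E)%E).
  rewrite -monotone_convergence//.
  - by apply: eq_integral => y _; apply/esym/cvg_lim => //; exact: hf.
  - by move=> n; exact/measurable_EFinP.
  - by move=> n y _; rewrite lee_fin.
transitivity (limn (fun n => \int[mu]_x ((h n (phi x))%:E * (w x)%:E))%E); last first.
  rewrite -monotone_convergence//.
  - apply: eq_integral => x _; apply/cvg_lim => //.
    apply: cvgeZr => //; exact: hf.
  - by move=> n; exact: emeasurable_funM.
  - by move=> n x _; rewrite mule_ge0// lee_fin.
  - by move=> x _ m n mn; apply: lee_wpmul2r; [rewrite lee_fin|exact: hnd].
congr (limn _); apply/funext => n.
have mlev r : measurable (phi @^-1` (h n @^-1` [set r])) by exact: mpre.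
transitivity (\int[wpush]_y (\sum_(r \in range (h n)) (r * \1_(h n @^-1` [set r]) y)%:E))%E.
  by apply: eq_integral => y _; rewrite fimfunE -fsumEFin.
rewrite ge0_integral_fsum//; last 2 first.
- by move=> r; apply/measurable_EFinP; exact: measurable_funM.
- by move=> r y _; exact: nnfun_muleindic_ge0.
transitivity (\int[mu]_x (\sum_(r \in range (h n))
    ((r * \1_(h n @^-1` [set r]) (phi x))%:E * (w x)%:E)))%E; last first.
  apply: eq_integral => x _.
  rewrite -ge0_mule_fsuml; last by move=> r; exact: nnfun_muleindic_ge0.
  by rewrite fsumEFin// -fimfunE.
have mind r : measurable_fun setT (fun x => (r * \1_(h n @^-1` [set r]) (phi x))%:E).
  apply/measurable_EFinP; apply: measurable_funM => //.
  by apply: (measurableT_comp _ mphi).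
rewrite ge0_integral_fsum//; last 2 first.
- by move=> r; exact: emeasurable_funM.
- by move=> r x _; apply: mule_ge0; [exact: nnfun_muleindic_ge0|rewrite lee_fin].
apply: eq_fsbigr => r rhn.
have r0 : 0 <= r by move: rhn; rewrite inE => -[t _ <-].
rewrite integralZl_indic_nnsfun// integral_indic// setIT.
under eq_integral do rewrite EFinM -muleA.
rewrite ge0_integralZl//.
- congr (_ * _)%E; rewrite /wpush [LHS]integral_mkcond.
  apply: eq_integral => x _; rewrite patchE indicE.
  by case: ifPn => [/[!inE] h1|/negP h1]; [rewrite mem_set// mul1e|rewrite memNset ?mul0e// => h2; apply: h1; rewrite inE].
- apply: emeasurable_funM => //; apply/measurable_EFinP.
  by apply: (measurableT_comp _ mphi).
- by move=> x _; rewrite mule_ge0// lee_fin.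
Qed.

End weighted_pushforward.

(** * The substitution [x = e^t] or [x = - e^t] on the line *)

Section exp_substitution.
Context {R : realType}.
Local Notation leb := (@lebesgue_measure R).

Let is_derive_NexpRN (x : R) : is_derive x 1 (fun t => - expR (- t)) (expR (- x)).
Proof.
rewrite (_ : (fun t => _) = - (expR \o (-%R : R -> R))); last by apply/funext.
by apply: is_derive_eq; rewrite mulrN1 opprK.
Qed.

Lemma integral_expR_Ny (c : R) : (\int[leb]_(t in `]-oo, c]) (expR t)%:E = (expR c)%:E)%E.
Proof.
have cF : continuous (fun t : R => - expR (- t)).
  move=> x; apply/differentiable_continuous/derivable1_diffP.
  by case: (is_derive_NexpRN x).
have cf : continuous (fun t : R => expR (- t)).
  rewrite (_ : (fun t => _) = (fun t : R => - (- expR (- t)))).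
    by move=> x; apply: cvgN; exact: cF.
  by apply/funext => t; rewrite opprK.
rewrite -{1}(opprK c) ge0_integration_by_substitutionNy.
- rewrite (ge0_continuous_FTC2y (F := fun t => - expR (- t)) (l := 0)).
  + by rewrite opprK sub0e EFinN oppeK.
  + by move=> x _; exact: expR_ge0.
  + exact: continuous_subspaceT.
  + by rewrite -oppr0; apply: cvgN; exact: cvgr_expR.
  + by move=> x _; by case: (is_derive_NexpRN x).
  + by apply: cvg_at_right_filter; exact: cF.
  + move=> x _; rewrite derive1E; by case: (is_derive_NexpRN x).
- by apply: continuous_subspaceT; exact: continuous_expR.
- by move=> x _; exact: expR_ge0.
Qed.

Let mexp : measurable_fun setT (expR : measurableTypeR R -> R).
Proof. exact: measurable_expR. Qed.

Let mexp' : measurable_fun setT (expR : measurableTypeR R -> measurableTypeR R).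
Proof. exact: measurable_expR. Qed.

Let mopp : measurable_fun setT (-%R : measurableTypeR R -> measurableTypeR R).
Proof. exact: measurable_funN (@measurable_id _ R setT). Qed.

Let m1 : set (measurableTypeR R) -> \bar R :=
  wpush leb (expR : measurableTypeR R -> R) (expR : measurableTypeR R -> measurableTypeR R).

Let m1_Nyc (c : R) : m1 `]-oo, c] = (Num.max c 0)%:E.
Proof.
rewrite /m1 /wpush; have [c0|c0] := leP c 0.
  rewrite (_ : _ @^-1` _ = set0) ?integral_set0//.
  rewrite -subset0 => t /=; rewrite in_itv/= => h.
  by have := expR_gt0 t; rewrite ltNge (le_trans h).
rewrite (_ : _ @^-1` _ = `]-oo, ln c]%classic); first by rewrite integral_expR_Ny lnK.
apply/seteqP; split => t /=; rewrite !in_itv/=.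
  by move=> h; rewrite -(expRK t) ler_ln ?posrE ?expR_gt0.
by move=> h; rewrite -(lnK (x := c)) ?posrE// ler_expR.
Qed.

Let m1_Nyo (c : R) : m1 `]-oo, c[ = (Num.max c 0)%:E.
Proof.
rewrite /m1 /wpush; have [c0|c0] := leP c 0.
  rewrite (_ : _ @^-1` _ = set0) ?integral_set0//.
  rewrite -subset0 => t /=; rewrite in_itv/= => h.
  by have := expR_gt0 t; rewrite ltNge (le_trans (ltW h)).
rewrite (_ : _ @^-1` _ = `]-oo, ln c[%classic).
  rewrite integral_itv_bndo_bndc ?integral_expR_Ny ?lnK//.
  by apply: measurable_funTS; apply/measurable_EFinP; exact: measurable_expR.
apply/seteqP; split => t /=; rewrite !in_itv/=.
  by move=> h; rewrite -(expRK t) ltr_ln ?posrE ?expR_gt0.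
by move=> h; rewrite -(lnK (x := c)) ?posrE// ltr_expR.
Qed.

(* The Lebesgue measure is the sum of the images of [e^t dt] under [exp] and [- exp]. *)
Lemma ge0_integral_expR (f : R -> \bar R) :
  measurable_fun setT f -> (forall x, 0 <= f x)%E ->
  (\int[leb]_x f x = \int[leb]_t (f (expR t) * (expR t)%:E)
    + \int[leb]_t (f (- expR t)%R * (expR t)%:E))%E.
Proof.
move=> mf f0.
have w0 (x : measurableTypeR R) : 0 <= expR x :> R by exact: expR_ge0.
pose n1 := wpush_measure leb mexp w0 mexp'.
pose n2 : {measure set (measurableTypeR R) -> \bar R} := measure_add n1 (wpush_measure leb mexp w0 (measurableT_comp mopp mexp')).
have n2E (E : set (measurableTypeR R)) : n2 E = (m1 E + m1 (-%R @^-1` E))%E by exact: measure_addE.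
(* Uniqueness of the Lebesgue measure reduces this to intervals []a, b]]. Their reflections are [[-
   b, - a[], which is why [m1] has been computed on closed and on open rays. *)
have key : forall A, measurable A -> leb A = n2 A.
  apply: (@lebesgue_measure_unique R n2) => _ [[a b]] _ <-.
  rewrite /= n2E opp_preimage_itvbndbnd /=.
  have [ab|ba] := leP b a.
    rewrite set_itv_ge ?bnd_simp -?leNgt//.
    rewrite set_itv_ge ?bnd_simp -?leNgt ?lerN2//.
    have m10 : m1 set0 = 0%E by exact: (measure0 n1).
    by rewrite measure0 m10 adde0.
  rewrite lebesgue_measure_itv /= lte_fin ba.
  have mI (i : interval R) : measurable ([set` i] : set (measurableTypeR R)).
    exact: measurable_itv.
  have diff (A B : set (measurableTypeR R)) (p q : R) : measurable A -> measurable B ->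
      A `<=` B -> n1 A = p%:E -> n1 B = q%:E -> n1 (B `\` A) = (q - p)%:E.
    move=> mA mB AB nA nB.
    have -> : n1 (B `\` A) = (n1 B - n1 (B `&` A))%E.
      by apply: measureD => //; apply: (@le_lt_trans _ _ q%:E); rewrite ?ltry//; rewrite -nB.
    by rewrite setIidr// nA nB.
  have d1 : m1 `]a, b] = (Num.max b 0 - Num.max a 0)%:E.
    rewrite (_ : `]a, b]%classic = `]-oo, b] `\` `]-oo, a]).
      apply: diff => //; try exact: m1_Nyc.
      by move=> x /=; rewrite !in_itv/= => /le_trans; apply; exact: ltW.
    apply/seteqP; split => x /=; rewrite !in_itv/=.
      by move=> /andP[h1 h2]; split => //; apply/negP; rewrite -ltNge.
    by move=> [h1 /negP]; rewrite -ltNge => h2; rewrite h2.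
  have d2 : m1 `[- b, - a[ = (Num.max (- a) 0 - Num.max (- b) 0)%:E.
    rewrite (_ : `[- b, - a[%classic = `]-oo, - a[ `\` `]-oo, - b[).
      apply: diff => //; try exact: m1_Nyo.
      by move=> x /=; rewrite !in_itv/= => /lt_trans; apply; rewrite ltrN2.
    apply/seteqP; split => x /=; rewrite !in_itv/=.
      by move=> /andP[h1 h2]; split => //; apply/negP; rewrite -leNgt.
    by move=> [h1 /negP]; rewrite -leNgt => h2; rewrite h2.
  (* Since [max x 0 - max (- x) 0 = x], the two contributions add up to [b - a]. *)
  rewrite d1 d2 -?EFinD; congr EFin => /=.
  case: (leP b 0) (leP a 0) (leP (- a) 0) (leP (- b) 0) => ? [?|?] [?|?] [?|?]; lra.
rewrite (eq_measure_integral n2); last by move=> A mA _; exact: key.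
rewrite ge0_integral_measure_add// !ge0_integral_wpush//.
exact: (measurableT_comp mopp mexp').
Qed.

Definition sgnb (b : bool) : R := if b then 1 else -1.

(** For [b = false] the point 0 is included: the two half-lines, and with them the orthants, form an
    exact partition and not only one up to a null set. *)
Definition half_line (b : bool) : set R := [set x | (0 < x) = b].

Lemma ge0_integral_half (b : bool) (f : R -> \bar R) :
  measurable_fun setT f -> (forall x, 0 <= f x)%E ->
  (\int[leb]_(x in half_line b) f x =
   \int[leb]_t (f (sgnb b * expR t)%R * (expR t)%:E))%E.
Proof.
move=> mf f0.
have mH : measurable (half_line b).
  rewrite /half_line; case: b; last first.
    rewrite (_ : [set x | _] = `]-oo, (0 : R)]%classic); first exact: measurable_itv.
    apply/seteqP; split => x /=; rewrite in_itv/= leNgt; first by move=> ->.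
    by move/negbTE.
  rewrite (_ : [set x | _] = `](0 : R), +oo[%classic); first exact: measurable_itv.
  by apply/seteqP; split => x /=; rewrite in_itv/= andbT.
rewrite integral_mkcond [LHS]ge0_integral_expR; last 2 first.
- exact: (measurable_restrictT f mH).1 (measurable_funTS mf).
- by move=> x; rewrite patchE; case: ifP.
have pos t : (0 < expR t) = true :> bool by exact: expR_gt0.
have neg t : (0 < - expR t) = false :> bool by rewrite oppr_gt0 ltNge expR_ge0.
case: b mH => mH; rewrite /sgnb.
  rewrite [X in (_ + X)%E](_ : _ = 0%E) ?adde0.
    by apply: eq_integral => t _; rewrite mul1r patchE mem_set//; exact: pos.
  apply: integral0_eq => t _; rewrite patchE memNset ?mul0e//.
  by rewrite /half_line /= neg.
rewrite [X in (X + _)%E](_ : _ = 0%E) ?add0e.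
  by apply: eq_integral => t _; rewrite mulN1r patchE mem_set//; exact: neg.
apply: integral0_eq => t _; rewrite patchE memNset ?mul0e//.
by rewrite /half_line /= pos.
Qed.

End exp_substitution.

(** * Exponential coordinates in an orthant *)

Section orthants.
Context {R : realType}.

Definition orthant n (sg : 'I_n -> bool) : set 'cV[R]_n :=
  [set x | forall i, (0 < x i 0) = sg i].

Definition expV n (sg : 'I_n -> bool) (t : 'cV[R]_n) : 'cV[R]_n :=
  \col_i (sgnb (sg i) * expR (t i 0)).

Lemma measurable_half_line b : measurable (half_line b : set R).
Proof.
rewrite /half_line; case: b; last first.
  rewrite (_ : [set x | _] = `]-oo, (0 : R)]%classic); first exact: measurable_itv.
  apply/seteqP; split => x /=; rewrite in_itv/= leNgt; first by move=> ->.
  by move/negbTE.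
rewrite (_ : [set x | _] = `](0 : R), +oo[%classic); first exact: measurable_itv.
by apply/seteqP; split => x /=; rewrite in_itv/= andbT.
Qed.

Lemma measurable_orthant n (sg : 'I_n -> bool) : measurable (orthant sg).
Proof.
rewrite (_ : orthant sg = \bigcap_(i in [set: 'I_n])
    ((fun x : 'cV[R]_n => x i 0) @^-1` half_line (sg i))).
  apply: fin_bigcap_measurable => // i _.
  by rewrite -[X in measurable X]setTI; apply: measurable_entry => //; exact: measurable_half_line.
by apply/seteqP; split => x /= h i; [move=> _|]; exact: h.
Qed.

Lemma measurable_expV {d} {S : measurableType d} n (sg : 'I_n -> bool) (f : S -> 'cV[R]_n) :
  measurable_fun setT f -> measurable_fun setT (fun s => expV sg (f s)).
Proof.
move=> mf; apply: measurable_cVP => i; under eq_fun do rewrite mxE.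
apply: measurable_funM => //; apply: (measurableT_comp (@measurable_expR R)).
exact: measurable_funV_entry.
Qed.

Lemma expV_orthant n (sg : 'I_n -> bool) t : orthant sg (expV sg t).
Proof.
move=> i; rewrite mxE /sgnb; case: (sg i); first by rewrite mul1r expR_gt0.
by rewrite mulN1r oppr_gt0 ltNge expR_ge0.
Qed.

Lemma expV_cons n (sg : 'I_n.+1 -> bool) s (x : 'cV[R]_n) :
  expV sg (cons_cV (s, x)) =
  cons_cV (sgnb (sg ord0) * expR s, expV (fun i => sg (lift ord0 i)) x).
Proof.
apply: cons_cVP => [|i]; rewrite [LHS]mxE ?cons_cV0 ?cons_cVS//.
by rewrite [RHS]mxE.
Qed.

Lemma orthant_cons n (sg : 'I_n.+1 -> bool) s (x : 'cV[R]_n) :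
  orthant sg (cons_cV (s, x)) <->
  half_line (sg ord0) s /\ orthant (fun i => sg (lift ord0 i)) x.
Proof.
split=> [h|[h0 hS] i].
  split; first by have := h ord0; rewrite cons_cV0.
  by move=> i; have := h (lift ord0 i); rewrite cons_cVS.
case: (unliftP ord0 i) => [j|] ->; first by rewrite cons_cVS; exact: hS.
by rewrite cons_cV0; exact: h0.
Qed.

(** [expR (sumV t)] is the absolute value of the Jacobian determinant of [expV sg] at [t]. *)
Definition sumV n (t : 'cV[R]_n) : R := \sum_i t i 0.

Lemma measurable_sumV {d} {S : measurableType d} n (f : S -> 'cV[R]_n) :
  measurable_fun setT f -> measurable_fun setT (fun s => sumV (f s)).
Proof. by move=> mf; apply: measurable_sum => i; exact: measurable_funV_entry. Qed.

Lemma sumV_cons n s (x : 'cV[R]_n) : sumV (cons_cV (s, x)) = s + sumV x.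
Proof.
rewrite /sumV big_ord_recl cons_cV0; congr (_ + _).
by apply: eq_bigr => i _; rewrite cons_cVS.
Qed.

Lemma measurable_tailV n : measurable_fun setT
  (fun y : 'cV[R]_n.+1 => \col_i y (lift ord0 i) 0 : 'cV[R]_n).
Proof.
by apply: measurable_cVP => i; under eq_fun do rewrite mxE; exact: measurable_entry.
Qed.

Theorem ge0_integral_orthant n (sg : 'I_n -> bool) (f : 'cV[R]_n -> \bar R) :
  measurable_fun setT f -> (forall x, 0 <= f x)%E ->
  (\int[lebesgue_cV n]_(x in orthant sg) f x =
   \int[lebesgue_cV n]_t (f (expV sg t) * (expR (sumV t))%:E))%E.
Proof.
elim: n sg f => [|n IH] sg f mf f0.
  rewrite (_ : orthant sg = setT); last by apply/seteqP; split => // x _ [].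
  apply: eq_integral => x _; rewrite /sumV big_ord0 expR0 mule1.
  by rewrite !(flatmx0 _).
pose sg' i := sg (lift ord0 i).
pose tl (y : 'cV[R]_n.+1) : 'cV[R]_n := \col_i y (lift ord0 i) 0.
have mtl : measurable_fun setT tl := @measurable_tailV n.
have tl_cons s x : tl (cons_cV (s, x)) = x.
  by apply/colP => i; rewrite mxE cons_cVS.
pose hd (y : 'cV[R]_n.+1) : R := y ord0 0.
have hd_cons s (x : 'cV[R]_n) : hd (cons_cV (s, x)) = s by exact: cons_cV0.
(* The intermediate integrand of the induction: the tail coordinates are already exponentiated and
   carry their Jacobian factor, the head coordinate is still the original one. *)
pose G (y : 'cV[R]_n.+1) : \bar R :=
  (f (cons_cV (hd y, expV sg' (tl y))) * (expR (sumV (tl y)))%:E)%E.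
have mcons : measurable_fun setT (fun y : 'cV[R]_n.+1 => cons_cV (hd y, expV sg' (tl y))).
  apply: (measurableT_comp (@measurable_cons_cV R n)).
  apply: measurable_fun_pair; first exact: measurable_entry.
  exact: measurable_expV.
have mG : measurable_fun setT G.
  apply: emeasurable_funM; first exact: (measurableT_comp mf mcons).
  apply/measurable_EFinP; apply: (measurableT_comp (@measurable_expR R)).
  exact: measurable_sumV.
have G0 y : (0 <= G y)%E by rewrite mule_ge0// lee_fin expR_ge0.
rewrite integral_mkcond [LHS]ge0_integral_cons_cV; last 2 first.
- exact: (measurable_restrictT f (measurable_orthant sg)).1 (measurable_funTS mf).
- by move=> x; rewrite patchE; case: ifP.
pose Q (s : R) : \bar R := (\int[lebesgue_cV n]_x G (cons_cV (s, x)))%E.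
have mQ : measurable_fun setT Q by exact: measurable_integral_cons.
have Q0 s : (0 <= Q s)%E by exact: integral_ge0.
transitivity (\int[lebesgue_measure]_(s in half_line (sg ord0)) Q s)%E.
  rewrite [RHS]integral_mkcond; apply: eq_integral => s _; rewrite patchE.
  have [hs|hs] := pselect (half_line (sg ord0) s).
    rewrite (mem_set hs) /Q.
    have mfs : measurable_fun setT (fun x : 'cV[R]_n => f (cons_cV (s, x))).
      by apply: (measurableT_comp mf); exact: measurable_cons_cV2.
    have := IH sg' _ mfs (fun x => f0 _); rewrite [in LHS]integral_mkcond.
    move=> E; transitivity (\int[lebesgue_cV n]_t
      (f (cons_cV (s, expV sg' t)) * (expR (sumV t))%:E))%E; last first.
      by apply: eq_integral => x _; rewrite /G hd_cons tl_cons.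
    rewrite -E; apply: eq_integral => x _; rewrite !patchE.
    have [hx|hx] := pselect (orthant sg' x).
      by rewrite !mem_set//; apply/orthant_cons.
    by rewrite !memNset// => /orthant_cons[].
  rewrite memNset//; apply: integral0_eq => x _; rewrite patchE memNset//.
  by move/orthant_cons => -[].
rewrite ge0_integral_half// [RHS]ge0_integral_cons_cV; last 2 first.
- apply: emeasurable_funM; first by apply: (measurableT_comp mf); exact: measurable_expV.
  apply/measurable_EFinP; apply: (measurableT_comp (@measurable_expR R)).
  exact: measurable_sumV.
- by move=> x; rewrite mule_ge0// lee_fin expR_ge0.
apply: eq_integral => s _; rewrite /Q -ge0_integralZr//.
- apply: eq_integral => x _; rewrite /G !hd_cons tl_cons expV_cons sumV_cons.
  by rewrite expRD EFinM [in RHS](muleC (expR s)%:E) muleA.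
- by apply: (measurableT_comp mG); exact: measurable_cons_cV2.
Qed.

End orthants.

(** * The Fourier transform *)

Section gauss_fourier.
Context {R : realType}.
Local Notation leb := (@lebesgue_measure R).
Local Notation g := (@gauss_fun R).

Lemma is_derive_gauss (t : R) : is_derive t 1 g (- 2 * t * g t).
Proof.
rewrite (_ : gauss_fun = expR \o (fun t : R => - (t * t))); last first.
  by apply/funext => z; rewrite /gauss_fun /= expr2.
have h : is_derive t 1 (fun t : R => - (t * t)) (- 2 * t).
  rewrite (_ : (fun t : R => - (t * t)) = - ((@idfun R) * (@idfun R))); last by apply/funext.
  by apply: is_derive_eq; rewrite /= /GRing.scale /=; ring.
by apply: (is_derive_eq (is_derive1_comp (is_derive_expR _) h)) => /=; ring.
Qed.

Lemma is_derive_cosM (x y : R) : is_derive x 1 (fun x => cos (x * y)) (- y * sin (x * y)).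
Proof.
rewrite (_ : (fun x => _) = (@cos R) \o (fun x : R => x * y)); last by apply/funext.
have h : is_derive x 1 (fun x : R => x * y) y.
  rewrite (_ : (fun x : R => x * y) = (@idfun R) * cst y); last by apply/funext.
  by apply: is_derive_eq; rewrite /= /GRing.scale /=; ring.
by apply: (is_derive_eq (is_derive1_comp (is_derive_cos _) h)) => /=; ring.
Qed.

Lemma is_derive_Msin (w t : R) : is_derive t 1 (fun t => sin (w * t)) (w * cos (w * t)).
Proof.
rewrite (_ : (fun t => _) = (@sin R) \o (fun t : R => w * t)); last by apply/funext.
have h : is_derive t 1 (fun t : R => w * t) w.
  rewrite (_ : (fun t : R => w * t) = cst w * (@idfun R)); last by apply/funext.
  by apply: is_derive_eq; rewrite /= /GRing.scale /=; ring.
by apply: (is_derive_eq (is_derive1_comp (is_derive_sin _) h)) => /=; ring.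
Qed.

(** From [|t| <= 1 + t^2 / 2 <= e^(t^2 / 2)] the function is at most [e^(- t^2 / 2)], a multiple of
    the normal density. It is the dominating function for differentiating [gaussF] under the
    integral sign. *)
Lemma integrable_normMgauss : leb.-integrable setT (fun t => (`|t| * g t)%:E).
Proof.
have s1 : (1 : R) != 0 by [].
have I1 := integrableZl measurableT ((normal_peak 1)^-1) (@integrable_normal_pdf R 0 1).
apply: (le_integrable measurableT _ _ I1).
  apply/measurable_EFinP; apply: measurable_funM; last exact: measurable_gauss_fun.
  exact: normr_measurable.
move=> t _; rewrite !gee0_abs ?lee_fin ?mulr_ge0 ?expR_ge0 ?invr_ge0 ?normal_peak_ge0 ?normal_pdf_ge0//.
rewrite /normal_pdf (negbTE s1) mulrA mulVf ?mul1r; last by rewrite gt_eqF// normal_peak_gt0.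
have -> : normal_fun 0 1 t = expR (- (t ^+ 2 / 2)).
  by rewrite /normal_fun subr0 expr1n mulr2n; congr expR; field.
have -> : g t = expR (- (t ^+ 2 / 2)) * expR (- (t ^+ 2 / 2)).
  by rewrite /gauss_fun -expRD; congr expR; field.
rewrite mulrA; apply: ler_piMl; first exact: expR_ge0.
rewrite expRN ler_pdivrMr ?expR_gt0// mul1r.
apply: le_trans (expR_ge1Dx _); rewrite -(real_normK (num_real t)).
by have := sqr_ge0 (`|t| - 1); rewrite sqrrB mulr1 expr1n; lra.
Qed.

Lemma integrable_boundMgauss (h : R -> R) : measurable_fun setT h ->
  (forall t, `|h t| <= 1) -> leb.-integrable setT (fun t => (h t * g t)%:E).
Proof.
move=> mh h1; apply: (le_integrable measurableT _ _ (@integrableT_gauss R)).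
  by apply/measurable_EFinP; apply: measurable_funM => //; exact: measurable_gauss_fun.
move=> t _; rewrite lee_fin normrM (ger0_norm (gauss_fun_ge0 t)).
by rewrite ler_piMl ?gauss_fun_ge0.
Qed.

Definition gaussF (w : R) : R := \int[leb]_t (cos (w * t) * g t).

Lemma normr_cos_le1 (x : R) : `|cos x| <= 1.
Proof. by rewrite ler_norml cos_geN1 cos_le1. Qed.

Lemma normr_sin_le1 (x : R) : `|sin x| <= 1.
Proof. by rewrite ler_norml sin_geN1 sin_le1. Qed.

Let mcos (w : R) : measurable_fun setT (fun t => cos (w * t)).
Proof.
apply: (measurableT_comp (continuous_measurable_fun (@continuous_cos R))).
exact: measurable_funM.
Qed.

Let msin (w : R) : measurable_fun setT (fun t => sin (w * t)).
Proof.
apply: (measurableT_comp (continuous_measurable_fun (@continuous_sin R))).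
exact: measurable_funM.
Qed.

Let Icos w := integrable_boundMgauss (mcos w) (fun t => normr_cos_le1 _).

Lemma integrable_tsin (w : R) : leb.-integrable setT (fun t => (t * sin (w * t) * g t)%:E).
Proof.
apply: (le_integrable measurableT _ _ integrable_normMgauss).
  apply/measurable_EFinP; apply: measurable_funM; last exact: measurable_gauss_fun.
  by apply: measurable_funM; [exact: measurable_id|exact: msin].
move=> t _; rewrite lee_fin !normrM normr_id (ger0_norm (gauss_fun_ge0 t)).
by rewrite ler_wpM2r ?gauss_fun_ge0// ler_piMr// normr_sin_le1.
Qed.

Lemma is_derive_gaussF (w : R) :
  is_derive w 1 gaussF (- \int[leb]_t (t * sin (w * t) * g t)).
Proof.
pose f (x y : R) := cos (x * y) * g y.
have d1 (x y : R) : is_derive x 1 (f ^~ y) (- y * sin (x * y) * g y).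
  rewrite (_ : f ^~ y = (fun x => cos (x * y)) * cst (g y)); last by apply/funext.
  have h := is_derive_cosM x y.
  by apply: is_derive_eq; rewrite /= /GRing.scale /=; ring.
have p1 (x y : R) : partial1of2 f x y = - y * sin (x * y) * g y.
  by rewrite partial1of2E; case: (d1 x y).
have If (x : R) : w - 1 < x < w + 1 -> leb.-integrable setT (EFin \o f x) by move=> _; exact: Icos.
have Dw : w - 1 < w < w + 1 by lra.
have D1 (x y : R) : w - 1 < x < w + 1 -> setT y -> derivable (f ^~ y) x 1.
  by move=> _ _; case: (d1 x y).
have G0 (y : R) : 0 <= `|y| * g y by rewrite mulr_ge0// gauss_fun_ge0.
have GB (x y : R) : w - 1 < x < w + 1 -> setT y -> `|partial1of2 f x y| <= `|y| * g y.
  move=> _ _; rewrite p1 !normrM normrN (ger0_norm (gauss_fun_ge0 y)).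
  by rewrite ler_wpM2r ?gauss_fun_ge0// ler_piMr// normr_sin_le1.
have inI (x : R) : `]w - 1, w + 1[%classic x -> w - 1 < x < w + 1 by rewrite /= in_itv.
have Iw : `]w - 1, w + 1[%classic w by rewrite /= in_itv.
have A1 := @derivable_under_integral R _ _ leb f setT measurableT w (w - 1) (w + 1) Iw
  (fun x h => If x (inI x h)) (fun x y h => D1 x y (inI x h)) _ G0 integrable_normMgauss
  (fun x y h => GB x y (inI x h)).
have A2 := @differentiation_under_integral R _ _ leb f setT measurableT w (w - 1) (w + 1) Iw
  (fun x h => If x (inI x h)) (fun x y h => D1 x y (inI x h)) _ G0 integrable_normMgauss
  (fun x y h => GB x y (inI x h)).
split; first exact: A1.
rewrite -derive1E A2.
rewrite -[RHS]mulN1r -RintegralZl//; last exact: integrable_tsin.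
by apply: eq_Rintegral => t _; rewrite p1; ring.
Qed.

(* The boundary terms of exp (-t^2) sin (w t) vanish at infinity. *)
Lemma gaussF_by_parts (w : R) :
  \int[leb]_t (t * sin (w * t) * g t) = w / 2 * gaussF w.
Proof.
have alg (a b : R) : - 2 * a + w * b = 0 -> a = w / 2 * b by move=> h; lra.
pose F (t : R) := sin (w * t) * g t.
pose f (t : R) := - 2 * (t * sin (w * t) * g t) + w * (cos (w * t) * g t).
have dF (t : R) : is_derive t 1 F (f t).
  rewrite (_ : F = (fun t => sin (w * t)) * gauss_fun); last by apply/funext.
  have h := is_derive_Msin w t; have h' := is_derive_gauss t.
  by apply: is_derive_eq; rewrite /= /GRing.scale /= /f; ring.
have I1 := integrable_tsin w.
have I1' := integrableZl measurableT (- 2) I1.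
have I2' := integrableZl measurableT w (Icos w).
have If : leb.-integrable setT (fun t => (f t)%:E).
  have := integrableD measurableT I1' I2'; apply: eq_integrable => // t _.
have intf : \int[leb]_t f t = - 2 * \int[leb]_t (t * sin (w * t) * g t) + w * gaussF w.
  rewrite /f RintegralD; [|by []|exact: I1'|exact: I2'].
  have -> := RintegralZl (-2) measurableT I1.
  by have -> := RintegralZl w measurableT (Icos w).
suff : \int[leb]_t f t = 0 by rewrite intf; exact: alg.
have cF : continuous F.
  move=> x; apply/differentiable_continuous/derivable1_diffP; by case: (dF x).
have cf : continuous f.
  have cg := @continuous_gauss_fun R.
  have cw : continuous (fun t : R => w * t) by move=> t; apply: cvgMr; exact: cvg_id.
  have cs : continuous (fun t => sin (w * t)).
    by move=> t; apply: continuous_comp; [exact: cw|exact: continuous_sin].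
  have cc : continuous (fun t => cos (w * t)).
    by move=> t; apply: continuous_comp; [exact: cw|exact: continuous_cos].
  move=> t; apply: cvgD; apply: cvgMr; apply: cvgM; try exact: cg; last exact: cc.
  by apply: cvgM; [exact: cvg_id|exact: cs].
(* The fundamental theorem of calculus applies on bounded intervals, nondegenerate also for [n = 0];
   dominated convergence with the bound [|f|] then reaches the whole line. *)
pose h (n : nat) := f \_ `[- n.+1%:R, n.+1%:R].
have mf : measurable_fun setT f by exact: continuous_measurable_fun.
have mE n : measurable (`[- n.+1%:R, n.+1%:R] : set R) by exact: measurable_itv.
have mh n : measurable_fun setT (fun t => (h n t)%:E).
  apply/measurable_EFinP; exact: (measurable_restrictT f (mE n)).1 (measurable_funTS mf).
have hf : \forall t \ae leb, setT t -> (h n t)%:E @[n --> \oo] --> (f t)%:E.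
  apply: aeW => t _; apply: cvg_EFin; first exact: nearW.
  apply: cvg_near_cst; exists (Num.bound `|t|) => // n /= tn.
  rewrite /h patchE mem_set//= in_itv/= -ler_norml.
  by rewrite (le_trans (ltW (archi_boundP (normr_ge0 t))))// ler_nat leqW.
have hb : \forall t \ae leb, forall n : nat, setT t -> (`|(h n t)%:E| <= (`|f t|)%:E)%E.
  apply: aeW => t n _; rewrite lee_fin /h patchE.
  by case: ifP; rewrite ?normr0.
have If' : leb.-integrable setT (fun t => (`|f t|)%:E).
  have := integrable_abse If; apply: eq_integrable => //.
have mfE : measurable_fun setT (fun t => (f t)%:E) by exact/measurable_EFinP.
have [_ _] := @dominated_convergence _ (measurableTypeR R) R leb setT measurableT
  (fun n t => (h n t)%:E) (fun t => (f t)%:E) _ mh mfE hf If' hb.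
have -> : [sequence (\int[leb]_t (h n t)%:E)%E]_n =
    (fun n : nat => (F n.+1%:R - F (- n.+1%:R))%:E).
  apply/funext => n /=.
  have n0 : - n.+1%:R < n.+1%:R :> R by apply: (@lt_trans _ _ 0); rewrite ?oppr_lt0 ltr0n.
  rewrite EFinB -(@continuous_FTC2 R f F (- n.+1%:R) n.+1%:R n0); last 3 first.
  - exact: continuous_subspaceT.
  - split.
    + by move=> t _; case: (dF t).
    + by apply: cvg_at_right_filter; exact: cF.
    + by apply: cvg_at_left_filter; exact: cF.
  - by move=> t _; rewrite derive1E; case: (dF t).
  rewrite [RHS]integral_mkcond; apply: eq_integral => t _.
  by rewrite /h !patchE; case: ifP.
have cvF : (F n.+1%:R - F (- n.+1%:R))%:E @[n --> \oo] --> (0 : R)%:E.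
  apply: cvg_EFin; first exact: nearW.
  have FE n : `|F n.+1%:R - F (- n.+1%:R)| <= 2 * g n.+1%:R.
    have gN : g (- n.+1%:R) = g n.+1%:R by rewrite /gauss_fun sqrrN.
    rewrite /F gN -mulrBl normrM (ger0_norm (gauss_fun_ge0 _)).
    rewrite ler_wpM2r ?gauss_fun_ge0// (le_trans (ler_normB _ _))//.
    have := normr_sin_le1 (w * n.+1%:R); have := normr_sin_le1 (w * - n.+1%:R); lra.
  apply: norm_cvg0.
  apply: (@squeeze_cvgr _ _ _ _ (fun=> 0) (fun n : nat => 2 * g n.+1%:R)).
  - by apply: nearW => n; rewrite normr_ge0 FE.
  - exact: cvg_cst.
  - rewrite -(mulr0 2); apply: cvgMr.
    apply: (cvg_comp (fun n : nat => n.+1%:R : R) g); last exact: cvg_gauss_fun.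
    by rewrite (cvg_shiftS (fun n : nat => n%:R : R)); exact: cvgr_idn.
move=> /cvg_unique => /(_ _ _ cvF) => /(_ (@ereal_hausdorff R)).
by rewrite /Rintegral => ->.
Qed.

(** Differentiation under the integral and integration by parts give the equation
    [F' = - (w / 2) F], so [F e^(w^2 / 4)] is constant. The constant [gaussF 0] stays symbolic,
    because it enters both Gram matrices in the same way. *)
Lemma gaussFE (w : R) : gaussF w = gaussF 0 * expR (- (w ^+ 2 / 4)).
Proof.
pose Q (x : R) := gaussF x * expR (x ^+ 2 / 4).
have dE (x : R) : is_derive x 1 (fun x : R => expR (x ^+ 2 / 4)) (x / 2 * expR (x ^+ 2 / 4)).
  rewrite (_ : (fun x => _) = expR \o (fun x : R => x * x / 4)); last first.
    by apply/funext => z; rewrite /= expr2.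
  have h : is_derive x 1 (fun x : R => x * x / 4) (x / 2).
    rewrite (_ : (fun x : R => x * x / 4) = (@idfun R) * (@idfun R) * cst 4^-1); last by apply/funext.
    by apply: is_derive_eq; rewrite /= /GRing.scale /=; field.
  by apply: (is_derive_eq (is_derive1_comp (is_derive_expR _) h)) => /=; rewrite expr2; ring.
have dQ (x : R) : is_derive x 1 Q 0.
  rewrite (_ : Q = gaussF * (fun x : R => expR (x ^+ 2 / 4))); last by apply/funext.
  have h1 := is_derive_gaussF x; have h2 := dE x.
  by apply: is_derive_eq; rewrite gaussF_by_parts /= /GRing.scale /=; field.
have := is_derive_0_is_cst w 0 dQ.
rewrite /Q expr0n mul0r expR0 mulr1 => <-.
by rewrite -mulrA -expRD subrr expR0 mulr1.
Qed.

End gauss_fourier.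

(** * Translation, parity and separation of variables for signed integrals *)

Section integrals_cV.
Context {R : realType}.
Local Notation leb := (@lebesgue_measure R).

Lemma Rintegral_cV_shift n (y : 'cV[R]_n) (f : 'cV[R]_n -> R) :
  measurable_fun setT f ->
  \int[lebesgue_cV n]_x f (x + y) = \int[lebesgue_cV n]_x f x.
Proof.
move=> mf; rewrite /Rintegral; congr fine; rewrite integralE [RHS]integralE.
have mfE : measurable_fun setT (EFin \o f) by exact/measurable_EFinP.
rewrite -(ge0_integral_cV_shift y (f := (EFin \o f)^\+%E)) //; last exact: measurable_funepos.
rewrite -(ge0_integral_cV_shift y (f := (EFin \o f)^\-%E)) //; last exact: measurable_funeneg.
by congr (_ - _)%E; apply: eq_integral => x _; rewrite ?funeposE ?funenegE.
Qed.

Lemma cintegral_cV_shift n (y : 'cV[R]_n) (f : 'cV[R]_n -> R[i]) :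
  measurable_fun setT f ->
  cintegral (lebesgue_cV n) (fun x => f (x + y)) = cintegral (lebesgue_cV n) f.
Proof.
move=> /measurable_complexP[m1 m2].
by rewrite /cintegral (Rintegral_cV_shift _ m1) (Rintegral_cV_shift _ m2).
Qed.

Lemma Rintegral_odd (f : R -> R) : measurable_fun setT f -> (forall t, f (- t) = - f t) ->
  \int[leb]_t f t = 0.
Proof.
move=> mf fodd; rewrite /Rintegral integralE.
have mfE : measurable_fun setT (EFin \o f) by exact/measurable_EFinP.
pose phi : measurableTypeR R -> measurableTypeR R := -%R.
have mphi : measurable_fun setT phi by exact: measurable_funN (@measurable_id _ R setT).
have mfp : measurable_fun setT ((EFin \o f)^\+%E : measurableTypeR R -> \bar R).
  exact: measurable_funepos.
have E := ge0_integral_pushforward mphi leb measurableT mfp (fun x _ => funepos_ge0 _ x).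
rewrite preimage_setT in E.
have -> : (\int[leb]_x (fun x => (f x)%:E)^\+ x = \int[leb]_x (fun x => (f x)%:E)^\- x)%E.
  transitivity (\int[pushforward leb phi]_y (EFin \o f)^\+%E y)%E.
    by apply: eq_measure_integral => A mA _; exact/esym/lebesgue_measureN.
  rewrite E; apply: eq_integral => t _ /=.
  by rewrite funeposE funenegE /phi /= fodd.
(* Integrability is not assumed: for infinite [I] the difference is still sent to 0 by [fine]. *)
set I := (\int[_]_x _)%E; have : (0 <= I)%E by exact: integral_ge0.
by case: I => [r| |]//= _; rewrite subrr.
Qed.

Definition tailV n (y : 'cV[R]_n.+1) : 'cV[R]_n := \col_i y (lift ord0 i) 0.

Lemma tailV_cons n t (x : 'cV[R]_n) : tailV (cons_cV (t, x)) = x.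
Proof. by apply/colP => i; rewrite mxE cons_cVS. Qed.

Section separated.
Variable n : nat.
Local Notation mprod u v := (fun y : 'cV[R]_n.+1 => u (y ord0 0) * v (tailV y)).

Let ge0_separated (u : R -> R) (v : 'cV[R]_n -> R) :
  measurable_fun setT u -> measurable_fun setT v ->
  (forall t, 0 <= u t) -> (forall x, 0 <= v x) ->
  (\int[lebesgue_cV n.+1]_y (u (y ord0 ord0) * v (tailV y))%:E =
   \int[leb]_t (u t)%:E * \int[lebesgue_cV n]_x (v x)%:E)%E.
Proof.
move=> mu mv u0 v0.
have muE : measurable_fun setT (fun t => (u t)%:E) by exact/measurable_EFinP.
have mvE : measurable_fun setT (fun t => (v t)%:E) by exact/measurable_EFinP.
rewrite ge0_integral_cons_cV; last 2 first.
- apply/measurable_EFinP; apply: measurable_funM.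
    by apply: (measurableT_comp mu); exact: measurable_entry.
  by apply: (measurableT_comp mv); exact: measurable_tailV.
- by move=> x; rewrite lee_fin mulr_ge0.
rewrite -ge0_integralZr//; [|by move=> t _; rewrite lee_fin
  |by apply: integral_ge0 => x _; rewrite lee_fin].
apply: eq_integral => t _; rewrite -ge0_integralZl//; [|by move=> x _; rewrite lee_fin
  |by rewrite lee_fin].
by apply: eq_integral => x _; rewrite tailV_cons (cons_cV0 t x).
Qed.

Lemma integrable_separated (u : R -> R) (v : 'cV[R]_n -> R) :
  leb.-integrable setT (fun t => (u t)%:E) ->
  (lebesgue_cV n).-integrable setT (fun x => (v x)%:E) ->
  (lebesgue_cV n.+1).-integrable setT (fun y => (u (y ord0 0%R) * v (tailV y))%:E).
Proof.
move=> /integrableP[/measurable_EFinP mu uoo] /integrableP[/measurable_EFinP mv voo].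
apply/integrableP; split.
  apply/measurable_EFinP; apply: measurable_funM.
    by apply: (measurableT_comp mu); exact: measurable_entry.
  by apply: (measurableT_comp mv); exact: measurable_tailV.
have := @ge0_separated (fun t => `|u t|) (fun x => `|v x|)
  (measurableT_comp (@normr_measurable R setT) mu) (measurableT_comp (@normr_measurable R setT) mv)
  (fun t => normr_ge0 _) (fun x => normr_ge0 _).
rewrite (_ : (\int[lebesgue_cV n.+1]_y _ = \int[lebesgue_cV n.+1]_y `|(u (y ord0 ord0) * v (tailV y))%:E|)%E).
  by move=> ->; apply: lte_mul_pinfty => //; [exact: integral_ge0|
    rewrite ge0_fin_numE//; exact: integral_ge0].
by apply: eq_integral => y _ /=; rewrite normrM.
Qed.

(** Bilinearity reduces this to nonnegative factors, where it is Tonelli; the factors are split into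
    positive and negative parts one at a time. *)
Lemma Rintegral_separated (u : R -> R) (v : 'cV[R]_n -> R) :
  leb.-integrable setT (fun t => (u t)%:E) ->
  (lebesgue_cV n).-integrable setT (fun x => (v x)%:E) ->
  \int[lebesgue_cV n.+1]_y (u (y ord0 0) * v (tailV y)) =
  \int[leb]_t u t * \int[lebesgue_cV n]_x v x.
Proof.
move=> Iu Iv.
have pos (u' : R -> R) (v' : 'cV[R]_n -> R) :
    leb.-integrable setT (fun t => (u' t)%:E) ->
    (lebesgue_cV n).-integrable setT (fun x => (v' x)%:E) ->
    (forall t, 0 <= u' t) -> (forall x, 0 <= v' x) ->
    \int[lebesgue_cV n.+1]_y (u' (y ord0 0) * v' (tailV y)) =
    \int[leb]_t u' t * \int[lebesgue_cV n]_x v' x.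
  move=> Iu' Iv' u0 v0; rewrite /Rintegral ge0_separated//.
  - by rewrite fineM//; exact: integrable_fin_num.
  - by have /integrableP[/measurable_EFinP] := Iu'.
  - by have /integrableP[/measurable_EFinP] := Iv'.
have Iup := integrable_funrpos measurableT Iu; have Iun := integrable_funrneg measurableT Iu.
have Ivp := integrable_funrpos measurableT Iv; have Ivn := integrable_funrneg measurableT Iv.
have uE t : u t = u^\+ t - u^\- t by rewrite -[in LHS](funrposBneg u).
have vE t : v t = v^\+ t - v^\- t by rewrite -[in LHS](funrposBneg v).
have IuE : \int[leb]_t u t = \int[leb]_t u^\+ t - \int[leb]_t u^\- t.
  rewrite -RintegralB; [|by []|exact: Iup|exact: Iun].
  by apply: eq_Rintegral => t _.
have IvE : \int[lebesgue_cV n]_x v x = \int[lebesgue_cV n]_x v^\+ x - \int[lebesgue_cV n]_x v^\- x.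
  rewrite -RintegralB; [|by []|exact: Ivp|exact: Ivn].
  by apply: eq_Rintegral => t _.
have step (u' : R -> R) : leb.-integrable setT (fun t => (u' t)%:E) ->
    (forall t, 0 <= u' t) ->
    \int[lebesgue_cV n.+1]_y (u' (y ord0 0) * v (tailV y)) =
    \int[leb]_t u' t * \int[lebesgue_cV n]_x v x.
  move=> Iu' u0.
  under eq_Rintegral do rewrite vE mulrBr.
  rewrite RintegralB; [|by []|exact: integrable_separated..].
  by rewrite IvE mulrBr !pos.
under eq_Rintegral do rewrite uE mulrBl.
rewrite RintegralB; [|by []|exact: integrable_separated..].
by rewrite IuE mulrBl !step.
Qed.

Lemma cintegral_separated (u : R -> R[i]) (v : 'cV[R]_n -> R[i]) :
  cinteg leb u -> cinteg (lebesgue_cV n) v ->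
  cinteg (lebesgue_cV n.+1) (mprod u v) /\
  cintegral (lebesgue_cV n.+1) (mprod u v) =
  cintegral leb u * cintegral (lebesgue_cV n) v.
Proof.
move=> [u1 u2] [v1 v2].
have I11 := integrable_separated u1 v1; have I12 := integrable_separated u1 v2.
have I21 := integrable_separated u2 v1; have I22 := integrable_separated u2 v2.
have ReM (a b : R[i]) : Re (a * b) = Re a * Re b - Im a * Im b by case: a b => ? ? [].
have ImM (a b : R[i]) : Im (a * b) = Re a * Im b + Im a * Re b by case: a b => ? ? [].
split.
  split.
    by apply: (integrable_ext _ (integrableB measurableT I11 I22)) => y /=; rewrite ReM EFinB.
  by apply: (integrable_ext _ (integrableD measurableT I12 I21)) => y /=; rewrite ImM EFinD.
rewrite /cintegral.
under eq_Rintegral do rewrite ReM.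
under [X in Complex _ X]eq_Rintegral do rewrite ImM.
rewrite RintegralB; [|by []|exact: I11|exact: I22].
rewrite RintegralD; [|by []|exact: I12|exact: I21].
rewrite (Rintegral_separated u1 v1) (Rintegral_separated u2 v2).
by rewrite (Rintegral_separated u1 v2) (Rintegral_separated u2 v1).
Qed.

End separated.

End integrals_cV.

Section cis.
Context {R : realType}.

Definition cis (x : R) : R[i] := Complex (cos x) (sin x).

Lemma cisD x y : cis (x + y) = cis x * cis y.
Proof. by rewrite /cis cosD sinD; simpc; congr Complex; ring. Qed.

Lemma conj_cis x : conjc (cis x) = cis (- x).
Proof. by rewrite /cis cosN sinN. Qed.

Lemma conjcM (a b : R[i]) : conjc (a * b) = conjc a * conjc b.
Proof. exact: rmorphM. Qed.

Lemma nsq_cis x : nsq (cis x) = 1.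
Proof. by rewrite /nsq /= cos2Dsin2. Qed.

Lemma cis0 : cis 0 = 1.
Proof. by rewrite /cis cos0 sin0. Qed.

Lemma measurable_cis {d} {T : measurableType d} (f : T -> R) :
  measurable_fun setT f -> measurable_fun setT (fun x => cis (f x)).
Proof.
move=> mf; apply/measurable_complexP; split.
  exact: (measurableT_comp (continuous_measurable_fun (@continuous_cos R)) mf).
exact: (measurableT_comp (continuous_measurable_fun (@continuous_sin R)) mf).
Qed.

Definition dotV n (x y : 'cV[R]_n) : R := \sum_i x i 0 * y i 0.

Lemma measurable_dotV {d} {T : measurableType d} n (f g : T -> 'cV[R]_n) :
  measurable_fun setT f -> measurable_fun setT g ->
  measurable_fun setT (fun x => dotV (f x) (g x)).
Proof.
by move=> mf mg; apply: measurable_sum => i; apply: measurable_funM;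
  exact: measurable_funV_entry.
Qed.

Lemma dotVDl n (x y z : 'cV[R]_n) : dotV (x + y) z = dotV x z + dotV y z.
Proof. by rewrite /dotV -big_split; apply: eq_bigr => i _; rewrite mxE mulrDl. Qed.

Lemma dotVDr n (x y z : 'cV[R]_n) : dotV x (y + z) = dotV x y + dotV x z.
Proof. by rewrite /dotV -big_split; apply: eq_bigr => i _; rewrite mxE mulrDr. Qed.

Lemma dotVNl n (x y : 'cV[R]_n) : dotV (- x) y = - dotV x y.
Proof. by rewrite /dotV -sumrN; apply: eq_bigr => i _; rewrite mxE mulNr. Qed.

Lemma dotVNr n (x y : 'cV[R]_n) : dotV x (- y) = - dotV x y.
Proof. by rewrite /dotV -sumrN; apply: eq_bigr => i _; rewrite mxE mulrN. Qed.

Lemma dotVZl n a (x y : 'cV[R]_n) : dotV (a *: x) y = a * dotV x y.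
Proof. by rewrite /dotV mulr_sumr; apply: eq_bigr => i _; rewrite mxE mulrA. Qed.

Lemma dotVZr n a (x y : 'cV[R]_n) : dotV x (a *: y) = a * dotV x y.
Proof. by rewrite /dotV mulr_sumr; apply: eq_bigr => i _; rewrite mxE mulrCA. Qed.

Lemma dotVC n (x y : 'cV[R]_n) : dotV x y = dotV y x.
Proof. by apply: eq_bigr => i _; rewrite mulrC. Qed.

Lemma gaussVE n (x : 'cV[R]_n) : gaussV x = expR (- dotV x x).
Proof. by congr (expR (- _)); apply: eq_bigr => i _; rewrite expr2. Qed.

Lemma dotV_cons n t (x : 'cV[R]_n) (c : 'cV[R]_n.+1) :
  dotV c (cons_cV (t, x)) = c ord0 0 * t + dotV (tailV c) x.
Proof.
rewrite /dotV big_ord_recl cons_cV0; congr (_ + _).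
by apply: eq_bigr => i _; rewrite cons_cVS mxE.
Qed.

End cis.

(** * The Fourier integral of the Gaussian in dimension [n] *)

Section gauss_fourier_cV.
Context {R : realType}.
Local Notation leb := (@lebesgue_measure R).

Let cis1 (w t : R) : R[i] := cis (w * t) * (gauss_fun t)%:C%C.

Let cis1E w t : cis1 w t = Complex (cos (w * t) * gauss_fun t) (sin (w * t) * gauss_fun t).
Proof. by rewrite /cis1 /cis; simpc. Qed.

Let msin (w : R) : measurable_fun setT (fun t => sin (w * t)).
Proof.
apply: (measurableT_comp (continuous_measurable_fun (@continuous_sin R))).
exact: measurable_funM.
Qed.

Let mcos (w : R) : measurable_fun setT (fun t => cos (w * t)).
Proof.
apply: (measurableT_comp (continuous_measurable_fun (@continuous_cos R))).
exact: measurable_funM.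
Qed.

Let cinteg_cis1 w : cinteg leb (cis1 w).
Proof.
split.
  apply: (integrable_ext _ (integrable_boundMgauss (mcos w) (fun t => normr_cos_le1 _))).
  by move=> t; rewrite cis1E.
apply: (integrable_ext _ (integrable_boundMgauss (msin w) (fun t => normr_sin_le1 _))).
by move=> t; rewrite cis1E.
Qed.

Let cintegral_cis1 w : cintegral leb (cis1 w) = (gaussF 0 * expR (- (w ^+ 2 / 4)))%:C%C.
Proof.
rewrite -gaussFE /cintegral; congr Complex.
  by apply: eq_Rintegral => t _; rewrite cis1E.
transitivity (\int[leb]_t (sin (w * t) * gauss_fun t)).
  by apply: eq_Rintegral => t _; rewrite cis1E.
rewrite Rintegral_odd//= => [|t].
  apply: measurable_funM; last exact: measurable_gauss_fun.
  exact: msin.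
by rewrite mulrN sinN mulNr /gauss_fun sqrrN.
Qed.

Lemma cintegral_cis_gaussV n (w : 'cV[R]_n) :
  cinteg (lebesgue_cV n) (fun t => cis (dotV w t) * (gaussV t)%:C%C) /\
  cintegral (lebesgue_cV n) (fun t => cis (dotV w t) * (gaussV t)%:C%C) =
  (gaussF 0 ^+ n * expR (- (dotV w w / 4)))%:C%C.
Proof.
elim: n w => [|n IH] w.
  have E : (fun t : 'cV[R]_0 => cis (dotV w t) * (gaussV t)%:C%C) = (fun=> 1%:C%C).
    apply/funext => t; rewrite gaussVE /dotV !big_ord0 cis0 oppr0 expR0.
    by rewrite rmorph1 mulr1.
  have I1 : (lebesgue_cV 0).-integrable setT (fun _ : 'cV[R]_0 => (1 : R)%:E).
    apply/integrableP; split; first exact: measurable_cst.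
    by rewrite integral_dirac// diracE mem_set// mul1e /= normr1 ltry.
  rewrite E; split.
    split => /=; first exact: I1.
    exact: (integrable_ext _ (integrable0 _ _)).
  rewrite cintegral_real /Rintegral integral_dirac// diracE mem_set// mul1e.
  by rewrite expr0 mul1r /dotV big_ord0 mul0r oppr0 expR0.
have [IH1 IH2] := IH (tailV w).
have [S1 S2] := cintegral_separated (cinteg_cis1 (w ord0 0)) IH1.
have E : (fun t => cis (dotV w t) * (gaussV t)%:C%C) =
   (fun y : 'cV[R]_n.+1 => cis1 (w ord0 0) (y ord0 0) *
      (cis (dotV (tailV w) (tailV y)) * (gaussV (tailV y))%:C%C)).
  apply/funext => y; rewrite -[y](@uncons_cVK R n) /uncons_cV; set t := y ord0 0.
  set x := dsubmx _; rewrite dotV_cons gaussV_cons tailV_cons (cons_cV0 t x) /cis1 cisD.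
  by rewrite rmorphM /= mulrACA.
rewrite E; split => //; rewrite S2 cintegral_cis1 IH2 -rmorphM; congr (_%:C)%C.
rewrite mulrACA -expRD -exprS; congr (_ * expR _).
have -> : dotV w w = w ord0 0 ^+ 2 + dotV (tailV w) (tailV w).
  rewrite {1}/dotV big_ord_recl expr2; congr (_ + _).
  by apply: eq_bigr => i _; rewrite !mxE.
by field.
Qed.

End gauss_fourier_cV.

(** * Gaussian wave packets and their Gram matrices *)

Section gabor.
Context {R : realType} (n : nat).
Local Notation mu := (@lebesgue_cV R n).
Implicit Types (x t b c : 'cV[R]_n) (i j : 'cV[R]_n * 'cV[R]_n).

Definition hgauss t : R := expR (- (dotV t t / 2)).

(** The packet with position [i.1] and frequency [i.2]. *)
Definition gabor i t : R[i] := cis (dotV i.2 t) * (hgauss (t - i.1))%:C%C.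

(** This is the integral of [e^(i s.t)] against [gabor i t], up to the normalizing factor
    [(2 pi)^(- n / 2)]. It is again a packet, with position [- i.2] and frequency [i.1], up to a
    phase. *)
Definition gabor_hat i s : R[i] := cis (dotV i.1 (s + i.2)) * (hgauss (s + i.2))%:C%C.

Let measurable_id_cV : measurable_fun setT (fun t : 'cV[R]_n => t).
Proof. exact: measurable_id. Qed.

Lemma measurable_hgauss : measurable_fun setT hgauss.
Proof.
apply: (measurableT_comp (@measurable_expR R)); apply: measurable_funN.
by apply: measurable_funM => //; exact: measurable_dotV.
Qed.

Lemma measurable_gabor i : measurable_fun setT (gabor i).
Proof.
apply: measurable_funcM.
  by apply: measurable_cis; apply: measurable_dotV.
apply: measurable_real_complex; apply: (measurableT_comp measurable_hgauss).
exact: measurable_funVD.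
Qed.

Lemma gabor_hatE i :
  gabor_hat i = fun s => cis (dotV i.1 i.2) * gabor (- i.2, i.1) s.
Proof.
apply/funext => s; rewrite /gabor_hat /gabor /= opprK mulrA -cisD dotVDr.
by rewrite [in RHS]addrC.
Qed.

Lemma gaborE i : gabor i = fun s => cis (dotV i.1 i.2) * gabor_hat (i.2, - i.1) s.
Proof.
apply/funext => s; rewrite gabor_hatE /= opprK mulrA -cisD.
rewrite dotVNr (dotVC i.2) subrr cis0 mul1r.
by case: i.
Qed.

Lemma nsq_gabor i t : nsq (gabor i t) = gaussV (t - i.1).
Proof.
rewrite /gabor nsqM nsq_cis mul1r nsq_real gaussVE /hgauss -expRM_natl.
by congr expR; rewrite -mulr_natl; field.
Qed.

Lemma sqint_gabor i : sqint mu (gabor i).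
Proof.
split; first exact: measurable_gabor.
under eq_integral do rewrite nsq_gabor.
rewrite (ge0_integral_cV_shift (- i.1) (f := fun t => (gaussV t)%:E)).
- by have /andP[] := @integral_gaussV_proper R n.
- by apply/measurable_EFinP; exact: measurable_gaussV.
- by move=> x; rewrite lee_fin expR_ge0.
Qed.

Lemma sqint_gabor_hat i : sqint mu (gabor_hat i).
Proof. by rewrite gabor_hatE; apply: sqintZ; exact: sqint_gabor. Qed.

(* Completing the square around the midpoint of [b] and [b']. *)
Lemma hgauss_mul t b b' : hgauss (t + 2^-1 *: (b + b') - b) * hgauss (t + 2^-1 *: (b + b') - b') =
  gaussV t * expR (- (dotV (b - b') (b - b') / 4)).
Proof.
rewrite /hgauss gaussVE -!expRD; congr expR.
rewrite !(dotVDl, dotVDr, dotVNl, dotVNr, dotVZl, dotVZr).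
rewrite (dotVC b t) (dotVC b' t) (dotVC b' b).
by field.
Qed.

Let gram_int w : cintegral mu (fun t => cis (dotV w t) * (gaussV t)%:C%C) =
  (gaussF 0 ^+ n * expR (- (dotV w w / 4)))%:C%C := (cintegral_cis_gaussV w).2.

Lemma dot_gabor i j : dot mu (gabor i) (gabor j) =
  cis (dotV (i.2 - j.2) (2^-1 *: (i.1 + j.1))) *
  (expR (- (dotV (i.1 - j.1) (i.1 - j.1) / 4)) *
   (gaussF 0 ^+ n * expR (- (dotV (i.2 - j.2) (i.2 - j.2) / 4))))%:C%C.
Proof.
(* Seen from the midpoint of the positions, the product of the two Gaussians is a centred one, and
   what remains is its Fourier integral at the difference of the frequencies. *)
rewrite /dot -(cintegral_cV_shift (2^-1 *: (i.1 + j.1))); last first.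
  apply: measurable_funcM; first exact: measurable_gabor.
  by apply: measurable_conjc; exact: measurable_gabor.
have CM (a b : R) : (a * b)%:C%C = a%:C%C * b%:C%C by exact: rmorphM.
rewrite CM -gram_int mulrA -cintegralZ; last exact: (cintegral_cis_gaussV _).1.
congr cintegral; apply/funext => t; rewrite /gabor conjcM conj_cis conjc_real.
rewrite mulrACA -CM hgauss_mul -cisD -dotVNl -dotVDl dotVDr cisD CM.
by ring.
Qed.

(** Parseval's identity on packets: the modulus in [dot_gabor] is symmetric under exchanging
    position and frequency, and the phases of [gabor_hatE] account for the rest. *)
Lemma dot_gabor_hat i j : dot mu (gabor_hat i) (gabor_hat j) = dot mu (gabor i) (gabor j).
Proof.
rewrite !gabor_hatE dotZl; [|exact: sqint_gabor|exact/sqintZ/sqint_gabor].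
rewrite dotZr; [|exact: sqint_gabor..].
rewrite conj_cis mulrA -cisD !dot_gabor /= mulrA -cisD.
congr (cis _ * (_)%:C%C).
  rewrite !(dotVDl, dotVDr, dotVNl, dotVNr, dotVZl, dotVZr).
  rewrite (dotVC i.2 i.1) (dotVC i.2 j.1) (dotVC j.2 i.1) (dotVC j.2 j.1).
  by field.
rewrite mulrCA [RHS]mulrCA; congr (_ * _).
rewrite mulrC; congr (expR (- (_ / 4)) * expR _).
by rewrite !(dotVDl, dotVDr, dotVNl, dotVNr); ring.
Qed.

End gabor.

(** The maps arise from a choice of representatives, so linearity and compatibility with equality
    can be asked only almost everywhere. *)
Definition isometric_map {d d'} {T : measurableType d} {T' : measurableType d'} {R : realType}
    (mu : {measure set T -> \bar R}) (mu' : {measure set T' -> \bar R})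
    (U : (T -> R[i]) -> T' -> R[i]) : Prop :=
  [/\ forall f, sqint mu f -> sqint mu' (U f) /\ nrm2 mu' (U f) = nrm2 mu f,
      forall c f g, sqint mu f -> sqint mu g ->
        \forall x \ae mu', U (fun x => c * f x + g x) x = c * U f x + U g x &
      forall f g, sqint mu f -> sqint mu g -> (\forall x \ae mu, f x = g x) ->
        \forall x \ae mu', U f x = U g x].

(** * Totality of the packets and the Fourier transform *)

Section fourier.
Context {R : realType} (n : nat).
Local Notation mu := (@lebesgue_cV R n).
Implicit Types (t b c s : 'cV[R]_n).

Let Lw := @sqint_gabor R n.
Let Lw' := @sqint_gabor_hat R n.

Lemma sqint_cis (th : 'cV[R]_n -> R) (f : 'cV[R]_n -> R[i]) : measurable_fun setT th ->
  sqint mu f -> sqint mu (fun t => cis (th t) * f t) /\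
  nrm2 mu (fun t => cis (th t) * f t) = nrm2 mu f.
Proof.
move=> mth Lf.
have E t : nsq (cis (th t) * f t) = nsq (f t) by rewrite nsqM nsq_cis mul1r.
split; last by rewrite /nrm2; under eq_integral do rewrite E.
split; last by under eq_integral do rewrite E; case: Lf.
by apply: measurable_funcM; [exact: measurable_cis|case: Lf].
Qed.

Let measurable_dotVr c : measurable_fun setT (fun t : 'cV[R]_n => dotV c t).
Proof. by apply: measurable_dotV => //; exact: measurable_id. Qed.

(** The closed span of the packets, encoded as the diagonal of [gram_rel] for two equal families so
    that [gram_rel_lin] and [gram_rel_stable] apply to it. *)
Let M (f : 'cV[R]_n -> R[i]) := gram_rel mu (@gabor R n) (@gabor R n) f f.

Let M_sqint f : M f -> sqint mu f. Proof. by case. Qed.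

Let M_lin (z : R[i]) f g : M f -> M g -> M (fun x => z * f x + g x).
Proof. exact: (gram_rel_lin Lw Lw). Qed.

Let M_closed f : sqint mu f ->
  (forall e : R, 0 < e -> exists2 g, M g & nrm2 mu (fun x => f x - g x) <= e) -> M f.
Proof.
move=> Lf H; split => // e e0; have e4 : 0 < e / 4 by exact: divr_gt0.
have [g [Lg _ Mg] fg] := H _ e4; have [p [gp _]] := Mg _ e4; exists p.
suff : nrm2 mu (fun x => f x - comb (@gabor R n) p x) <= e by [].
apply: (le_trans (nrm2_trans Lf Lg (sqint_comb Lw p))).
by move: fg gp e0; set a := nrm2 _ _; set a' := nrm2 _ _ => *; lra.
Qed.

Let M_gabor i : M (gabor i).
Proof.
split; [exact: Lw..|] => e e0; exists [:: (1, i)].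
have E : (fun x => gabor i x - comb (@gabor R n) [:: (1, i)] x) = fun=> 0.
  by apply/funext => x; rewrite comb_cons comb_nil /= mul1r addr0 subrr.
rewrite !E nrm2_ae0 //; first by rewrite !ltW.
exact: aeW.
Qed.

Let multiplier_cis c : multiplier M (fun t => cis (dotV c t)).
Proof.
split; first exact: measurable_cis.
  by exists 1 => t; rewrite nsq_cis.
move=> f; pose S (g : 'cV[R]_n -> R[i]) t := cis (dotV c t) * g t.
apply: (@gram_rel_stable _ _ _ mu _ _ _ Lw Lw S S (fun i => (1, (i.1, i.2 + c)))).
- by move=> i; apply/funext => t; rewrite /S mul1r /gabor /= mulrA -cisD dotVDl addrC.
- by move=> i; apply/funext => t; rewrite /S mul1r /gabor /= mulrA -cisD dotVDl addrC.
- by move=> a g h; apply/funext => t; rewrite /S mulrDr mulrCA.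
- by move=> a g h; apply/funext => t; rewrite /S mulrDr mulrCA.
- by move=> g; exact: sqint_cis.
- by move=> g; exact: sqint_cis.
Qed.

Let rmultiplier_sin (j : 'I_n) (c e : R) : rmultiplier M (fun t => sin (c * t j 0 + e)).
Proof.
have dE (a : R) t : dotV (a *: delta_mx j 0) t = a * t j 0.
  rewrite /dotV (bigD1 j)//= big1 ?addr0 => [|i ij]; rewrite !mxE ?eqxx ?mulr1//.
  by rewrite (negbTE ij) mulr0 mul0r.
have m0 : multiplier M (fun=> 0) by exact: (multiplier_cst M_lin).
have m1 := multiplier_lin M_lin (cis (- e)) (multiplier_cis ((- c) *: delta_mx j 0)) m0.
have m2 := multiplier_lin M_lin (cis e) (multiplier_cis (c *: delta_mx j 0)) m0.
have m3 := multiplier_lin M_lin (-1) m1 m2.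
(* Euler's formula: [sin x = (- i / 2) (e^(i x) - e^(- i x))]. *)
have := multiplier_lin M_lin (Complex 0 (- 2^-1)) m3 m0.
congr multiplier; apply/funext => t; rewrite !addr0 -!cisD !dE.
have -> : - e + - c * t j 0 = - (c * t j 0 + e) by ring.
rewrite (addrC e) /cis cosN sinN; set x := _ + e.
by simpc; congr Complex; field.
Qed.

(** The half-spaces [a < t j 0] generate the sigma-algebra, and sines of affine functions of [t j 0]
    are multipliers. *)
Let M_indic E : measurable E -> rmultiplier M (\1_E).
Proof.
have SA := sigma_algebra_rmultiplier M_sqint M_lin M_closed.
suff : measurable `<=` [set E | measurable E /\ rmultiplier M (\1_E)] by move=> H /H [].
apply: (smallest_sub SA) => _ [j [k [B mB ->]]]; rewrite !ord1.
have := sigma_algebra_image (fun t : 'cV[R]_n => t j 0) SA.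
set G := image_set_system _ _ _ => SG.
suff : (@ocitv R).-sigma.-measurable `<=` G by move=> /(_ _ mB); rewrite /G /image_set_system /= setTI.
rewrite RGenOInfty.measurableE; apply: (smallest_sub SG) => _ [a ->].
rewrite /G /image_set_system /= setTI.
have -> : (fun t : 'cV[R]_n => t j 0) @^-1` `]a, +oo[ = [set t : 'cV[R]_n | a < t j 0].
  by apply/seteqP; split => t; rewrite /= in_itv /= andbT.
split; last exact: (rmultiplier_indic_gt M_sqint M_lin M_closed).
rewrite -[X in measurable X]setTI -[X in measurable X]setTI.
have := @measurable_entry _ R n 1 j 0 measurableT _ (measurable_itv `]a, +oo[).
congr measurable; apply/seteqP; split => t; rewrite /= in_itv /= andbT.
  by move=> [].
by move=> [].
Qed.

Lemma total_gabor : total_family mu (@gabor R n).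
Proof.
move=> f e Lf e0; suff [_ _ /(_ e e0)[p [Hp _]]] : M f by exists p.
apply: (density_of_multipliers M_sqint M_lin M_closed M_indic (@measurable_hgauss R n)) => //.
  by move=> t; exact: expR_gt0.
have := M_gabor (0, 0); congr (gram_rel _ _ _ _ _); apply/funext => t;
  rewrite /gabor /= subr0 /dotV big1 ?cis0 ?mul1r// => i _; by rewrite mxE mul0r.
Qed.

(** Up to phases and relabelling both families consist of the same functions, so the same
    combinations can be written with either. *)
Lemma total_gabor_hat : total_family mu (@gabor_hat R n).
Proof.
move=> f e Lf e0; have [p Hp] := total_gabor Lf e0.
exists [seq (z.1 * cis (dotV z.2.1 z.2.2), (z.2.2, - z.2.1)) | z <- p].
rewrite (_ : comb _ _ = comb (@gabor R n) p)//; apply/funext => x.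
rewrite /comb big_map; apply: eq_bigr => z _.
by rewrite gaborE mulrA.
Qed.


Lemma gram_rel_isometric w w' (U : ('cV[R]_n -> R[i]) -> 'cV[R]_n -> R[i]) :
  (forall i, sqint mu (w i)) -> (forall i, sqint mu (w' i)) ->
  (forall i j, dot mu (w i) (w j) = dot mu (w' i) (w' j)) ->
  (forall f, sqint mu f -> @gram_rel _ _ _ mu ('cV[R]_n * 'cV[R]_n)%type w w' f (U f)) ->
  isometric_map mu mu U.
Proof.
move=> Lv Lv' gr HU.
split=> [f Lf|c f g Lf Lg|f g Lf Lg fg].
- by have [_ LU _] := HU f Lf; rewrite (gram_rel_nrm2 Lv Lv' gr (HU f Lf)).
- apply: (gram_rel_uniq Lv Lv' gr (HU _ (sqintD (sqintZ c Lf) Lg))).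
  exact: (gram_rel_lin Lv Lv' c (HU f Lf) (HU g Lg)).
- have [_ [mU _] _] := HU f Lf.
  apply: (gram_rel_uniq Lv Lv' gr _ (HU g Lg)).
  by apply: (gram_rel_ae Lv Lv' (HU f Lf)) => //; [case: Lg|exact: aeW].
Qed.

(* [U] is the Fourier transform up to normalization and sign of the frequency. *)
Lemma fourier_exists : exists U Ui : ('cV[R]_n -> R[i]) -> 'cV[R]_n -> R[i],
  [/\ isometric_map mu mu U, isometric_map mu mu Ui,
      forall f, sqint mu f -> \forall x \ae mu, Ui (U f) x = f x,
      forall f, sqint mu f -> \forall x \ae mu, U (Ui f) x = f x &
      forall b f, sqint mu f -> \forall s \ae mu,
        U (fun t => f (t + b)) s = cis (- dotV b s) * U f s].
Proof.
have ex w w' : (forall i, sqint mu (w i)) -> (forall i, sqint mu (w' i)) ->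
   (forall i j, dot mu (w i) (w j) = dot mu (w' i) (w' j)) ->
   total_family mu w -> exists U : ('cV[R]_n -> R[i]) -> 'cV[R]_n -> R[i],
   forall f, sqint mu f -> @gram_rel _ _ _ mu ('cV[R]_n * 'cV[R]_n)%type w w' f (U f).
  move=> L L' gr tw.
  have /choice[U HU] : forall f, exists h, sqint mu f -> gram_rel mu w w' f h.
    move=> f; have [Lf|nLf] := pselect (sqint mu f); last by exists f.
    by have [h Hh] := gram_rel_total L L' gr tw Lf; exists h.
  by exists U.
have gr i j := esym (@dot_gabor_hat R n i j); have gr' := @dot_gabor_hat R n.
have [U HU] := ex _ _ Lw Lw' gr total_gabor.
have [Ui HUi] := ex _ _ Lw' Lw gr' total_gabor_hat.
have iU := gram_rel_isometric Lw Lw' gr HU.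
have iUi := gram_rel_isometric Lw' Lw gr' HUi.
exists U, Ui; split => //.
- move=> f Lf; have [_ LUf _] := HU _ Lf.
  exact: (gram_rel_uniq Lw' Lw gr' (HUi _ LUf) (gram_rel_sym (HU _ Lf))).
- move=> f Lf; have [_ LUf _] := HUi _ Lf.
  exact: (gram_rel_uniq Lw Lw' gr (HU _ LUf) (gram_rel_sym (HUi _ Lf))).
move=> b f Lf.
pose S (g : 'cV[R]_n -> R[i]) t := g (t + b).
pose S' (g : 'cV[R]_n -> R[i]) s := cis (- dotV b s) * g s.
have isoS g : sqint mu g -> sqint mu (S g) /\ nrm2 mu (S g) = nrm2 mu g.
  move=> [mg Lg]; have E : (\int[mu]_t (nsq (S g t))%:E = \int[mu]_t (nsq (g t))%:E)%E.
    apply: (ge0_integral_cV_shift b (f := fun t => (nsq (g t))%:E)) => //.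
    - by apply/measurable_EFinP; exact: measurable_nsq.
    - by move=> x; rewrite lee_fin nsq_ge0.
  split; last by rewrite /nrm2 E.
  by split; [apply: (measurableT_comp mg); exact: measurable_funVD|rewrite E].
have isoS' g : sqint mu g -> sqint mu (S' g) /\ nrm2 mu (S' g) = nrm2 mu g.
  by apply: sqint_cis; apply: measurable_funN; exact: measurable_dotVr.
(* Translation by [b] moves a packet from position [i.1] to [i.1 - b] and creates the phase
   [i.2 . b]; the modulation [S'] acts on [gabor_hat] with the same phase and the same new index. *)
have RS : gram_rel mu (@gabor R n) (@gabor_hat R n) (S f) (S' (U f)).
  apply: (@gram_rel_stable _ _ _ mu _ _ _ Lw Lw' S S'
    (fun i => (cis (dotV i.2 b), (i.1 - b, i.2)))) => //; last exact: HU.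
  - move=> i; apply/funext => t; rewrite /S /gabor /= opprB addrA mulrA -cisD.
    by rewrite dotVDr (addrC (dotV i.2 b)).
  - move=> i; apply/funext => s; rewrite /S' /gabor_hat /= !mulrA -!cisD.
    congr (cis _ * _); rewrite !dotVDl !dotVDr !dotVNl (dotVC i.2 b).
    by ring.
  - by move=> c g h; apply/funext => s; rewrite /S' mulrDr mulrCA.
exact: (gram_rel_uniq Lw Lw' gr (HU _ (isoS f Lf).1) RS).
Qed.

End fourier.

(** * Simultaneous orthogonal diagonalization *)

Section orthogonal_diagonalization.
Context {R : realType}.
Local Notation RC := (real_complex R).

Lemma mul_row_tr n (v : 'rV[R]_n) : v *m v^T = (\sum_j v 0 j ^+ 2)%:M.
Proof.
apply/matrixP => i j; rewrite !ord1 !mxE eqxx mulr1n.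
by apply: eq_bigr => k _; rewrite mxE expr2.
Qed.

Lemma sumsq_eq0 n (v : 'rV[R]_n) : (\sum_j v 0 j ^+ 2 == 0) = (v == 0).
Proof.
rewrite psumr_eq0 => [|j _]; last exact: sqr_ge0.
apply/allP/eqP => [H|-> j _]; last by rewrite mxE expr0n eqxx.
apply/rowP => j; have := H j (mem_index_enum _); rewrite /= sqrf_eq0 mxE.
by move=> /eqP.
Qed.

(** Computing [v A vb^T] from the left and from the right gives [a] and [conj a] times the positive
    number [v vb^T]. *)
Lemma symmetric_eigenvalue_real n (A : 'M[R]_n) (a : R[i]) :
  A^T = A -> eigenvalue (map_mx RC A) a -> exists r : R, a = r%:C%C.
Proof.
move=> sA /eigenvalueP[v vA v0].
pose vb := map_mx (@conjc R) v; pose Ac := map_mx RC A.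
have sAc : Ac^T = Ac by rewrite /Ac map_trmx sA.
have cA : map_mx (@conjc R) Ac = Ac by apply/matrixP => i j; rewrite !mxE conjc_real.
have vbA : vb *m Ac = conjc a *: vb.
  by rewrite -cA -map_mxM vA map_mxZ.
have E : a *: (v *m vb^T) = conjc a *: (v *m vb^T).
  rewrite scalemxAl -vA -mulmxA -[X in v *m (X *m _)]sAc -trmx_mul vbA.
  by rewrite linearZ /= scalemxAr.
have N : v *m vb^T = (\sum_j nsq (v 0 j))%:C%C%:M.
  apply/matrixP => i j; rewrite !ord1 !mxE eqxx mulr1n rmorph_sum.
  by apply: eq_bigr => k _; rewrite !mxE mulc_conj.
have S0 : (\sum_j nsq (v 0 j)) != 0.
  rewrite psumr_eq0 => [|j _]; last exact: nsq_ge0.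
  apply: contraNN v0 => /allP H; apply/eqP/rowP => j; rewrite mxE; apply: nsq_eq0.
  by apply/eqP/(H j); exact: mem_index_enum.
have : a = conjc a.
  move/matrixP : E => /(_ 0 0); rewrite N !mxE eqxx mulr1n => /mulIf; apply.
  by rewrite (_ : 0 = 0%:C%C)// (inj_eq (@complexI R)).
case: a {vA vbA E} => x y; rewrite /= => -[] yy; exists x; congr Complex.
by lra.
Qed.

(** Take a nonzero subspace [U] of minimal rank stable under the whole family. Each [A] has an
    eigenvector in it, and its eigenspace cuts [U] in a subspace that is stable by commutation,
    hence equal to [U]. So every nonzero vector of [U] is a common eigenvector; [F] may be
    infinite. *)
Lemma symmetric_common_eigenvector n (F : set 'M[R]_n) : (0 < n)%N ->
  (forall A, F A -> A^T = A) -> (forall A B, F A -> F B -> comm_mx A B) ->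
  exists2 v : 'rV[R]_n, v != 0 & forall A, F A -> exists a, v *m A = a *: v.
Proof.
move=> n0 Fsym Fcom.
pose stable (U : 'M[R]_n) := U != 0 /\ forall A, F A -> stablemx U A.
have [k [U [U0 Us] Uk] mink] : exists2 k, exists2 U, stable U & \rank U = k &
    forall U, stable U -> (k <= \rank U)%N.
  have ex : exists k, `[< exists2 U, stable U & \rank U = k >].
    exists n; apply/asboolP; exists 1%:M; last by rewrite mxrank1.
    split; first by rewrite -mxrank_eq0 mxrank1 -lt0n.
    by move=> A _; rewrite submx1.
  exists (ex_minn ex); case: ex_minnP => m /asboolP[U sU rU] H; first by exists U.
  by move=> V sV; apply: H; apply/asboolP; exists V.
exists (nz_row U) => [|A FA]; first by rewrite nz_row_eq0.
suff [a Ua] : exists a, (U <= eigenspace A a)%MS.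
  by exists a; apply/eigenspaceP; apply: submx_trans Ua; exact: nz_row_sub.
have r0 : (0 < \rank U)%N by rewrite lt0n mxrank_eq0.
have [z] := eigenvalue_closed (map_mx RC (restrictmx U A)) r0.
move=> /eigenvalueP[w wz w0].
pose v := w *m map_mx RC (row_base U).
have vA : v *m map_mx RC A = z *: v.
  rewrite /v -mulmxA -map_mxM.
  have <- : restrictmx U A *m row_base U = row_base U *m A.
    by rewrite /conjmx mulmxKpV// stablemx_row_base Us.
  by rewrite map_mxM mulmxA wz scalemxAl.
have v0 : v != 0 by rewrite mulmx_free_eq0// row_free_map row_base_free.
have ezA : eigenvalue (map_mx RC A) z by apply/eigenvalueP; exists v.
have [a za] := symmetric_eigenvalue_real (Fsym A FA) ezA; exists a.
pose W := (eigenspace A a :&: U)%MS.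
(* The eigenvector [v] is complex. It lies in the complexification of [W], which shows that the real
   subspace [W] is nonzero. *)
have vU : (v <= map_mx RC W)%MS.
  rewrite map_capmx sub_capmx; apply/andP; split.
    rewrite map_eigenspace; apply/eigenspaceP.
    by rewrite vA za.
  by rewrite /v (submx_trans (submxMl _ _))// map_submx eq_row_base.
have sW : stable W.
  split.
    apply: contraNN v0 => /eqP W0; move: vU; rewrite W0 map_mx0 submx0.
    by [].
  move=> B FB; rewrite sub_capmx; apply/andP; split.
    apply: (submx_trans (submxMr _ (capmxSl _ _))).
    exact/comm_mx_stable_eigenspace/Fcom.
  by apply: (submx_trans (submxMr _ (capmxSr _ _))); exact: Us.
have : (W <= U)%MS by exact: capmxSr.
move/mxrank_leqif_sup => /geq_leqif; rewrite Uk mink// => /esym UW.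
by apply: submx_trans UW _; exact: capmxSl.
Qed.

(** The reflection in the hyperplane orthogonal to [v - e] exchanges the first basis vector [e] with
    the unit vector [v]. It completes [v] to an orthonormal basis and is its own inverse and
    transpose. *)
Lemma householder n (v : 'rV[R]_(1 + n)) : v *m v^T = 1%:M ->
  exists H : 'M[R]_(1 + n), [/\ H^T = H, H *m H = 1%:M & row_mx 1%:M 0 *m H = v].
Proof.
move=> v1; pose e : 'rV[R]_(1 + n) := row_mx 1%:M 0; pose w := v - e.
pose s := \sum_j w 0 j ^+ 2.
have e1 : e *m e^T = 1%:M.
  by rewrite /e tr_row_mx mul_row_col trmx1 trmx0 mulmx0 addr0 mulmx1.
have ws : w *m w^T = s%:M by exact: mul_row_tr.
(* When [v = e], the convention that the inverse of [s = 0] is 0 makes [H] the identity. *)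
pose H : 'M[R]_(1 + n) := 1%:M - (2 / s) *: (w^T *m w).
have sH : H^T = H by rewrite /H linearB linearZ /= trmx_mul trmxK trmx1.
exists H; split => //.
  have XX : (w^T *m w) *m (w^T *m w) = s *: (w^T *m w).
    by rewrite mulmxA -(mulmxA w^T) ws mul_mx_scalar -scalemxAl.
  rewrite /H; move: (w^T *m w) XX => X XX.
  rewrite mulmxBl mul1mx mulmxBr mulmx1 -scalemxAl -scalemxAr XX !scalerA.
  have [s0|s0] := eqVneq s 0; first by rewrite s0 invr0 !(mulr0, mul0r) !scale0r !subr0.
  have -> : 2 / s * (2 / s) * s = 2 / s + 2 / s by field.
  rewrite scalerDl opprD; move: (_ *: X) => Y.
  by rewrite opprK addKr subrK.
have -> : row_mx 1%:M 0 *m H = e - (2 / s) *: (e *m w^T *m w).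
  by rewrite /H -mulmxA; move: (w^T *m w) => X; rewrite mulmxBr mulmx1 -scalemxAr.
have [s0|s0] := eqVneq s 0.
  move: (s0) => /eqP; rewrite sumsq_eq0 => /eqP w0; rewrite w0 mulmx0 scaler0 subr0.
  by apply/esym/eqP; rewrite -subr_eq0; exact/eqP.
pose c := (v *m e^T) 0 0.
have ve : v *m e^T = c%:M by rewrite [LHS]mx11_scalar.
have ev : e *m v^T = c%:M by rewrite -[LHS]trmxK trmx_mul trmxK ve tr_scalar_mx.
have sE : s = 2 - 2 * c.
  have := ws; rewrite /w linearB /= mulmxBl !mulmxBr v1 e1 ve ev -!raddfB.
  by move=> /matrixP/(_ 0 0); rewrite !mxE eqxx !mulr1n => <-; ring.
have -> : e *m w^T = (c - 1)%:M.
  by rewrite /w linearB /= mulmxBr ev e1 -raddfB.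
rewrite mul_scalar_mx scalerA.
have -> : 2 / s * (c - 1) = -1.
  by rewrite (_ : c - 1 = - (s / 2)); [field|rewrite sE; field].
by rewrite scaleN1r opprK /w addrC subrK.
Qed.

(** Deflation: conjugation by the reflection clears the first row outside the diagonal, by the
    eigenvector property, and then the first column, by symmetry. The remaining blocks are symmetric
    and commute. *)
Lemma symmetric_codiagonalizable n (F : set 'M[R]_n) :
  (forall A, F A -> A^T = A) -> (forall A B, F A -> F B -> comm_mx A B) ->
  exists2 C : 'M[R]_n, orthogonal_mx C & forall A, F A -> is_diag_mx (C^T *m A *m C).
Proof.
elim: n F => [|n IH] F Fsym Fcom.
  by exists 1%:M; [rewrite /orthogonal_mx trmx1 mulmx1|move=> A _; apply/is_diag_mxP => -[]].
have [v0 v00 v0e] := symmetric_common_eigenvector (ltn0Sn n) Fsym Fcom.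
pose s := \sum_j v0 0 j ^+ 2.
have s0 : 0 < s.
  by rewrite lt_def sumsq_eq0 v00 sumr_ge0// => j _; exact: sqr_ge0.
pose v : 'rV[R]_(1 + n) := (Num.sqrt s)^-1 *: v0.
have v1 : v *m v^T = 1%:M.
  rewrite /v linearZ /= -scalemxAl -scalemxAr mul_row_tr -/s scalerA -invfM.
  by rewrite -expr2 sqr_sqrtr ?ltW// -scalemx1 scalerA mulVf ?scale1r// gt_eqF.
have vF A : F A -> exists a, v *m A = a *: v.
  by move=> /v0e[a va]; exists a; rewrite /v -scalemxAl va !scalerA mulrC.
have [H [sH HH eH]] := householder v1.
have blk A : F A -> exists a, H *m (A : 'M[R]_(1 + n)) *m H =
    block_mx a%:M 0 0 (drsubmx (H *m A *m H)).
  move=> FA; have [a va] := vF A FA; exists a.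
  set B := H *m A *m H.
  have sB : B^T = B by rewrite /B !trmx_mul sH (Fsym _ FA) mulmxA.
  have uB : usubmx B = row_mx a%:M 0.
    have -> : usubmx B = row_mx 1%:M 0 *m B.
      by rewrite -[in RHS](vsubmxK B) mul_row_col mul1mx mul0mx addr0.
    rewrite /B !mulmxA eH va -scalemxAl -eH -mulmxA HH mulmx1.
    by rewrite scale_row_mx scaler0 scalemx1.
  have ur : ursubmx B = 0 by rewrite /ursubmx uB row_mxKr.
  have ul : ulsubmx B = a%:M by rewrite /ulsubmx uB row_mxKl.
  rewrite -[LHS](@submxK _ 1 n 1 n) ul ur.
  suff -> : dlsubmx B = 0 by [].
  by rewrite -[LHS]trmxK trmx_dlsub sB ur trmx0.
pose F' := [set drsubmx (H *m (A : 'M[R]_(1 + n)) *m H) | A in F].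
have [|B B'|C oC dC] := IH F'.
- by move=> _ [A FA <-]; rewrite trmx_drsub !trmx_mul sH (Fsym _ FA) mulmxA.
- move=> [A FA <-] [A' FA' <-].
  have [a Ha] := blk _ FA; have [a' Ha'] := blk _ FA'.
  have : (H *m (A : 'M[R]_(1 + n)) *m H) *m (H *m A' *m H) =
         (H *m A' *m H) *m (H *m (A : 'M[R]_(1 + n)) *m H).
    rewrite -!mulmxA ![H *m (H *m _)]mulmxA HH !mul1mx; congr (_ *m _).
    by rewrite !mulmxA; congr (_ *m _); exact: Fcom.
  rewrite Ha Ha' !mulmx_block !mulmx0 !mul0mx !addr0 !add0r.
  by rewrite !block_mxKdr => /eq_block_mx[].
pose D : 'M[R]_(1 + n) := block_mx 1%:M 0 0 C.
have DT : D^T = block_mx 1%:M 0 0 C^T by rewrite tr_block_mx !trmx0 trmx1.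
have DD : D^T *m D = 1%:M.
  rewrite DT mulmx_block !mulmx0 !mul0mx !addr0 !add0r mulmx1 oC.
  by rewrite -scalar_mx_block.
exists (H *m D).
  by rewrite /orthogonal_mx trmx_mul sH -mulmxA (mulmxA H) HH mul1mx.
move=> A FA; have [a Ha] := blk _ FA.
have -> : (H *m D)^T *m A *m (H *m D) = D^T *m (H *m (A : 'M[R]_(1 + n)) *m H) *m D.
  by rewrite trmx_mul sH !mulmxA.
rewrite Ha DT !mulmx_block !mulmx0 !mul0mx !addr0 !add0r mulmx1 mul1mx.
have : is_diag_mx (block_mx (a%:M : 'M[R]_1) 0 0 (C^T *m drsubmx (H *m (A : 'M[R]_(1 + n)) *m H) *m C)).
  rewrite is_diag_block_mx// !eqxx scalar_mx_is_diag /=.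
  by apply: dC; exists A.
by rewrite !mul0mx.
Qed.

End orthogonal_diagonalization.

(** * Averages of translations *)

Section complex_fubini.
Context {d1 d2} {X : measurableType d1} {Y : measurableType d2} {R : realType}.
Variables (m1 : {sigma_finite_measure set X -> \bar R})
          (m2 : {sigma_finite_measure set Y -> \bar R}).

Lemma measurable_Rintegral_section (f : X * Y -> R) : measurable_fun setT f ->
  measurable_fun setT (fun x => \int[m2]_y f (x, y)).
Proof.
move=> mf; apply: (measurableT_comp (@fine_measurable R _ measurableT)) => /=.
under eq_fun do rewrite integralE.
have mfE : measurable_fun setT (EFin \o f) by exact/measurable_EFinP.
apply: emeasurable_funB.
  rewrite (_ : (fun x => _) = fubini_F m2 ((EFin \o f)^\+)%E).
    by apply: measurable_fun_fubini_tonelli_F => //; exact: measurable_funepos.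
  by apply/funext => x; apply: eq_integral => y _; rewrite !funeposE.
rewrite (_ : (fun x => _) = fubini_F m2 ((EFin \o f)^\-)%E).
  by apply: measurable_fun_fubini_tonelli_F => //; exact: measurable_funeneg.
by apply/funext => x; apply: eq_integral => y _; rewrite !funenegE.
Qed.

Lemma measurable_cintegral_section (f : X * Y -> R[i]) : measurable_fun setT f ->
  measurable_fun setT (fun x => cintegral m2 (fun y => f (x, y))).
Proof.
move=> /measurable_complexP[mR mI]; apply/measurable_complexP; split;
  exact: (measurable_Rintegral_section (f := fun z => _ (f z))).
Qed.

Let Rfubini (f : X * Y -> R) : measurable_fun setT f ->
  (\int[m1]_x \int[m2]_y `|f (x, y)|%:E < +oo)%E ->
  [/\ \forall x \ae m1, m2.-integrable setT (fun y => (f (x, y))%:E),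
      \forall y \ae m2, m1.-integrable setT (fun x => (f (x, y))%:E),
      m1.-integrable setT (fun x => (\int[m2]_y f (x, y))%:E) &
      \int[m1]_x \int[m2]_y f (x, y) = \int[m2]_y \int[m1]_x f (x, y)].
Proof.
move=> mf foo; have mfE : measurable_fun setT (EFin \o f) by exact/measurable_EFinP.
have If : (m1 \x m2)%E.-integrable setT (EFin \o f) by exact/(integrable12ltyP _ _ mfE).
have a1 := ae_integrable1 If; have a2 := ae_integrable2 If.
have mF := measurable_Rintegral_section mf.
have aF : ae_eq m1 setT (fubini_F m2 (EFin \o f)) (fun x => (\int[m2]_y f (x, y))%:E).
  apply: filterS a1 => x Ix _; rewrite /Rintegral fineK//.
  exact: integrable_fin_num.
have IF := integrable_fubini_F If.
split=> //.
  have mFE := (measurable_EFinP _ _).2 mF.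
  apply/integrableP; split => //.
  have /integrableP[mFF] := IF; congr (_ < _)%E; apply: ae_eq_integral => //.
  - exact: measurableT_comp.
  - exact: measurableT_comp.
  - by apply: filterS aF => x h _; rewrite h.
rewrite [LHS]/Rintegral [RHS]/Rintegral; congr fine.
transitivity (\int[m1]_x fubini_F m2 (EFin \o f) x)%E.
  apply: ae_eq_integral => //; first exact/measurable_EFinP.
    exact: measurable_int IF.
  by apply: filterS aF => x h _; rewrite h.
rewrite (Fubini If); apply: ae_eq_integral => //.
- exact: (measurable_fubini_G If).
- apply/measurable_EFinP; apply: (measurableT_comp (@fine_measurable R _ measurableT)).
  exact: (measurable_fubini_G If).
- apply: filterS a2 => y Iy _; rewrite /Rintegral fineK//.
  exact: integrable_fin_num.
Qed.

Lemma cintegral_fubini (f : X * Y -> R[i]) : measurable_fun setT f ->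
  (\int[m1]_x \int[m2]_y (normc (f (x, y)))%:E < +oo)%E ->
  [/\ \forall x \ae m1, cinteg m2 (fun y => f (x, y)),
      \forall y \ae m2, cinteg m1 (fun x => f (x, y)),
      cinteg m1 (fun x => cintegral m2 (fun y => f (x, y))) &
      cintegral m1 (fun x => cintegral m2 (fun y => f (x, y))) =
      cintegral m2 (fun y => cintegral m1 (fun x => f (x, y)))].
Proof.
move=> mf foo; have [mR mI] := (measurable_complexP _ _).1 mf.
have part (p : R[i] -> R) : measurable_fun setT (fun z => p (f z)) ->
    (forall z, `|p z| <= normc z) ->
    (\int[m1]_x \int[m2]_y `|p (f (x, y))|%:E < +oo)%E.
  move=> mp pn; apply: le_lt_trans foo.
  have mn : measurable_fun setT (fun z => (normc (f z))%:E).
    by apply/measurable_EFinP; exact: measurable_normc.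
  have mpn : measurable_fun setT (fun z => `|p (f z)|%:E).
    by apply/measurable_EFinP; exact: (measurableT_comp (@normr_measurable _ setT) mp).
  apply: ge0_le_integral => //.
  - by move=> x _; apply: integral_ge0 => y _; rewrite lee_fin.
  - by apply: (@measurable_fun_fubini_tonelli_F _ _ _ _ _ m2 _ mpn) => z; rewrite lee_fin.
  - by apply: (@measurable_fun_fubini_tonelli_F _ _ _ _ _ m2 _ mn) => z; rewrite lee_fin normc_ge0.
  - move=> x _; apply: ge0_le_integral => //.
    + by apply: (measurableT_comp mpn); exact: pair1_measurable.
    + by apply: (measurableT_comp mn); exact: pair1_measurable.
    + by move=> y _; rewrite lee_fin.
have [R1 R2 R3 R4] := Rfubini mR (part _ mR (@normr_Re_le _)).
have [I1 I2 I3 I4] := Rfubini mI (part _ mI (@normr_Im_le _)).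
split.
- by apply: filterS2 R1 I1 => x; split.
- by apply: filterS2 R2 I2 => y; split.
- by split.
- by rewrite /cintegral /= R4 I4.
Qed.

End complex_fubini.

(** * Cauchy-Schwarz inequality with a weight *)

Section cauchy_schwarz.
Context {d} {T : measurableType d} {R : realType}.
Variable mu : {measure set T -> \bar R}.

Let amgm (w p a H : R) : 0 <= w -> 0 <= H ->
  2 * a * H * (w * p) <= a ^+ 2 * w + H ^+ 2 * (w * p ^+ 2).
Proof.
move=> w0 H0; have : 0 <= w * (a - H * p) ^+ 2 by rewrite mulr_ge0// sqr_ge0.
by rewrite (_ : w * _ = a ^+ 2 * w + H ^+ 2 * (w * p ^+ 2) - 2 * a * H * (w * p)); [lra|ring].
Qed.

Lemma weighted_cauchy_schwarz (w p : T -> R) :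
  measurable_fun setT p -> (forall x, 0 <= w x) -> (forall x, 0 <= p x) ->
  mu.-integrable setT (EFin \o w) ->
  mu.-integrable setT (fun x => (w x * p x ^+ 2)%:E) ->
  mu.-integrable setT (fun x => (w x * p x)%:E) /\
  (\int[mu]_x (w x * p x)) ^+ 2 <= (\int[mu]_x w x) * \int[mu]_x (w x * p x ^+ 2).
Proof.
move=> mp w0 p0 Iw Ip.
have mw : measurable_fun setT w by exact/measurable_EFinP/(measurable_int _ Iw).
have Iwp : mu.-integrable setT (fun x => (w x * p x)%:E).
  apply: (le_integrable measurableT _ _ (integrableD measurableT Iw Ip)).
    by apply/measurable_EFinP; exact: measurable_funM.
  move=> x _ /=; rewrite lee_fin ger0_norm ?mulr_ge0//.
  rewrite ger0_norm ?addr_ge0 ?mulr_ge0 ?sqr_ge0//.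
  have := amgm (p x) 1 (w0 x) (ler01 : 0 <= 1 :> R).
  have : 0 <= w x * p x by rewrite mulr_ge0.
  rewrite !expr1n mulr1 !mul1r; lra.
split=> //; set H := \int[mu]_x w x; set a := \int[mu]_x (w x * p x).
set B := \int[mu]_x (w x * p x ^+ 2).
have H0 : 0 <= H by apply: Rintegral_ge0.
have B0 : 0 <= B by apply: Rintegral_ge0 => x _; rewrite mulr_ge0// sqr_ge0.
have a0 : 0 <= a by apply: Rintegral_ge0 => x _; rewrite mulr_ge0.
have key (c k : R) : 0 <= k -> 2 * c * k * a <= c ^+ 2 * H + k ^+ 2 * B.
  move=> k0; rewrite /a /H /B.
  have I1 : mu.-integrable setT (fun x => (2 * c * k * (w x * p x))%:E).
    exact: (integrableZl measurableT _ Iwp).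
  have I2 : mu.-integrable setT (fun x => (c ^+ 2 * w x)%:E).
    exact: (integrableZl measurableT _ Iw).
  have I3 : mu.-integrable setT (fun x => (k ^+ 2 * (w x * p x ^+ 2))%:E).
    exact: (integrableZl measurableT _ Ip).
  rewrite -(RintegralZl _ measurableT Iwp) -(RintegralZl _ measurableT Iw).
  rewrite -(RintegralZl _ measurableT Ip) -(RintegralD measurableT I2 I3).
  apply: le_Rintegral => //; first exact: (integrableD measurableT I2 I3).
  by move=> x _; exact: amgm.
(* In [key] the best choice is [c = a], [k = H], followed by division by [H]. For [H = 0] the choice
   [c = B + 1], [k = a] gives [2 (B + 1) a^2 <= B a^2] and forces [a = 0]. *)
have [H00|H00] := eqVneq H 0.
  have := key (B + 1) a a0; rewrite H00 mulr0 add0r mul0r.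
  have [->|aN] := eqVneq a 0; first by rewrite expr0n.
  have a2 : 0 < a ^+ 2 by rewrite exprn_gt0// lt_def aN.
  rewrite -mulrA -expr2 mulrC ler_pM2l//.
  by lra.
have HP : 0 < H by rewrite lt_def H00.
have := key a H H0.
rewrite (_ : 2 * a * H * a = 2 * (H * a ^+ 2)); last by ring.
rewrite (_ : H ^+ 2 * B = H * (H * B)); last by ring.
rewrite (mulrC (a ^+ 2)) => h; rewrite -(ler_pM2l HP); lra.
Qed.

End cauchy_schwarz.

(** * The average of translations and its multiplier *)

Section translation_average.
Context {d} {Omega : measurableType d} {R : realType} {n : nat}.
Variable nu : {sigma_finite_measure set Omega -> \bar R}.
Variables (h : Omega -> R[i]) (b : Omega -> 'cV[R]_n).
Hypothesis Ih : cinteg nu h.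
Hypothesis mb : measurable_fun setT b.
Local Notation mu := (@lebesgue_cV R n).
Implicit Types F G : 'cV[R]_n -> R[i].

Definition trans_avg F (t : 'cV[R]_n) : R[i] := cintegral nu (fun u => h u * F (t + b u)).

Definition trans_symbol (s : 'cV[R]_n) : R[i] :=
  cintegral nu (fun u => h u * cis (- dotV (b u) s)).

Let mh : measurable_fun setT h := cinteg_measurable Ih.

Let H : R := fine (\int[nu]_u (normc (h u))%:E).

Let HE : H%:E = (\int[nu]_u (normc (h u))%:E)%E.
Proof.
rewrite fineK// ge0_fin_numE; first exact: cinteg_normc_lty.
by apply: integral_ge0 => u _; rewrite lee_fin normc_ge0.
Qed.

Let H0 : 0 <= H.
Proof. by rewrite -lee_fin HE; apply: integral_ge0 => u _; rewrite lee_fin normc_ge0. Qed.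

Let mfst {d'} {T : measurableType d'} (f : 'cV[R]_n -> T) : measurable_fun setT f ->
  measurable_fun setT (fun z : 'cV[R]_n * Omega => f z.1).
Proof. by move=> mf; exact: (measurableT_comp mf measurable_fst). Qed.

Let msnd {d'} {T : measurableType d'} (f : Omega -> T) : measurable_fun setT f ->
  measurable_fun setT (fun z : 'cV[R]_n * Omega => f z.2).
Proof. by move=> mf; exact: (measurableT_comp mf measurable_snd). Qed.

Let mtrans {d'} {T : measurableType d'} (f : 'cV[R]_n -> T) : measurable_fun setT f ->
  measurable_fun setT (fun z : 'cV[R]_n * Omega => f (z.1 + b z.2)).
Proof.
move=> mf; apply: (measurableT_comp mf).
by apply: measurable_funVD; [exact: measurable_fst|exact: msnd].
Qed.

Let tonelli_lty (p : 'cV[R]_n * Omega -> R) (C : R) : measurable_fun setT p ->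
  (forall z, 0 <= p z) -> (forall u, \int[mu]_t (p (t, u))%:E <= C%:E)%E ->
  (\int[mu]_t \int[nu]_u (normc (h u) * p (t, u))%:E < +oo)%E.
Proof.
move=> mp p0 pC.
have mw : measurable_fun setT (fun z : 'cV[R]_n * Omega => (normc (h z.2) * p z)%:E).
  apply/measurable_EFinP; apply: measurable_funM => //.
  exact: (msnd (measurable_normc mh)).
have w0 z : (0 <= (normc (h z.2) * p z)%:E)%E by rewrite lee_fin mulr_ge0// normc_ge0.
have -> := @fubini_tonelli _ _ _ _ _ mu nu _ mw w0.
apply: (@le_lt_trans _ _ (\int[nu]_u ((normc (h u))%:E * C%:E))%E).
  apply: ge0_le_integral => //.
  - move=> u _; apply: integral_ge0 => t _.
    by rewrite lee_fin mulr_ge0// normc_ge0.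
  - exact: (@measurable_fun_fubini_tonelli_G _ _ _ _ _ mu _ mw w0).
  - apply: emeasurable_funM => //; apply/measurable_EFinP.
    exact: measurable_normc.
  - move=> u _.
    have -> : (\int[mu]_t (normc (h u) * p (t, u))%:E =
        (normc (h u))%:E * \int[mu]_t (p (t, u))%:E)%E.
      apply: (ge0_integralZl_EFin _ measurableT (f1 := fun t => (p (t, u))%:E)).
      + by move=> t _; rewrite lee_fin.
      + by apply/measurable_EFinP; apply: (measurableT_comp mp); exact: pair2_measurable.
      + exact: normc_ge0.
    by rewrite lee_wpmul2l// lee_fin normc_ge0.
(* [C] is known to be nonnegative only through the bound at some [u]; over an empty [Omega] the
   integral is 0. *)
have [u0|e] := pselect (exists u : Omega, True); last first.
  rewrite (_ : (\int[nu]_u _)%E = 0%E)//; apply: integral0_eq => u _.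
  by exfalso; apply: e; exists u.
have C0 : 0 <= C.
  case: u0 => u _; rewrite -lee_fin; apply: le_trans (pC u).
  by apply: integral_ge0 => t _; rewrite lee_fin.
rewrite ge0_integralZr//; first by rewrite -HE -EFinM ltry.
- by apply/measurable_EFinP; exact: measurable_normc.
- by move=> u _; rewrite lee_fin normc_ge0.
Qed.

Let shift_nsq F u : sqint mu F ->
  (\int[mu]_t (nsq (F (t + b u)))%:E)%E = (nrm2 mu F)%:E.
Proof.
move=> [mF LF]; rewrite nrm2E//.
apply: (ge0_integral_cV_shift (b u) (f := fun t => (nsq (F t))%:E)).
- by apply/measurable_EFinP; exact: measurable_nsq.
- by move=> t; rewrite lee_fin nsq_ge0.
Qed.

Let mint F : measurable_fun setT F ->
  measurable_fun setT (fun z : 'cV[R]_n * Omega => h z.2 * F (z.1 + b z.2)).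
Proof. by move=> mF; apply: measurable_funcM; [exact: msnd|exact: mtrans]. Qed.

Lemma measurable_trans_avg F : measurable_fun setT F -> measurable_fun setT (trans_avg F).
Proof. by move=> mF; exact: (measurable_cintegral_section nu (mint mF)). Qed.


Let mabs F : measurable_fun setT F ->
  measurable_fun setT (fun z : 'cV[R]_n * Omega => normc (h z.2) * nsq (F (z.1 + b z.2))).
Proof.
move=> mF; apply: measurable_funM; first exact: (msnd (measurable_normc mh)).
exact: (mtrans (measurable_nsq mF)).
Qed.

Let abs_lty F : sqint mu F ->
  (\int[mu]_t \int[nu]_u (normc (h u) * nsq (F (t + b u)))%:E < +oo)%E.
Proof.
move=> LF; apply: (tonelli_lty (p := fun z => nsq (F (z.1 + b z.2))) (C := nrm2 mu F)).
- by apply: (mtrans (measurable_nsq _)); case: LF.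
- by move=> z; exact: nsq_ge0.
- by move=> u; rewrite shift_nsq.
Qed.

(** Cauchy-Schwarz with the weight [|h|]. Integrated over [t], the right-hand side is [2 H^2] times
    the squared norm of [F] by Tonelli and translation invariance, which stands in for Minkowski's
    integral inequality. *)
Lemma trans_avg_ae F : sqint mu F -> \forall t \ae mu,
  cinteg nu (fun u => h u * F (t + b u)) /\
  ((nsq (trans_avg F t))%:E <=
     (2 * H)%:E * \int[nu]_u (normc (h u) * nsq (F (t + b u)))%:E)%E.
Proof.
move=> LF; have [mF _] := LF; have mA := mabs mF.
have IA : (mu \x nu)%E.-integrable setT
    (fun z : 'cV[R]_n * Omega => (normc (h z.2) * nsq (F (z.1 + b z.2)))%:E).
  apply/integrable12ltyP; first exact/measurable_EFinP.
  move: (abs_lty LF); congr (_ < _)%E; apply: eq_integral => t _; apply: eq_integral => u _.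
  by rewrite /= ger0_norm// mulr_ge0 ?normc_ge0 ?nsq_ge0.
have Iw : nu.-integrable setT (EFin \o (fun u => normc (h u))).
  apply/integrableP; split; first by apply/measurable_EFinP; exact: measurable_normc.
  rewrite (eq_integral (fun u => (normc (h u))%:E)); first by rewrite -HE ltry.
  by move=> u _; rewrite /= ger0_norm// normc_ge0.
have := ae_integrable1 IA; apply: filterS => t /= It.
have mt : measurable_fun setT (fun u => h u * F (t + b u)).
  by have := measurableT_comp (mint mF) (pair1_measurable t).
have mp : measurable_fun setT (fun u => normc (F (t + b u))).
  apply: measurable_normc; apply: (measurableT_comp mF).
  by apply: measurable_funVD => //; exact: measurable_cst.
have [||I1 cs] := weighted_cauchy_schwarz mp (fun u => normc_ge0 (h u)) _ Iw.
- by move=> u; exact: normc_ge0.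
- by move: It; apply: integrable_ext => u; rewrite nsqE.
have E1 : (\int[nu]_u (normc (h u * F (t + b u)))%:E)%E =
    (\int[nu]_u (normc (h u) * normc (F (t + b u))))%:E.
  rewrite fineK; last exact: integrable_fin_num.
  by apply: eq_integral => u _; rewrite ComplexField.Normc.normcM.
have IC : cinteg nu (fun u => h u * F (t + b u)).
  by apply: cinteg_normc => //; rewrite E1 ltry.
split=> //.
have -> : (\int[nu]_u (normc (h u) * nsq (F (t + b u)))%:E)%E =
    (\int[nu]_u (normc (h u) * normc (F (t + b u)) ^+ 2))%:E.
  under eq_Rintegral do rewrite -nsqE.
  by rewrite fineK//; exact: integrable_fin_num.
rewrite -EFinM lee_fin; apply: (le_trans (nsq_cintegral_le IC)).
rewrite E1 /= -mulrA ler_pM2l//; exact: cs.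
Qed.

Lemma sqint_trans_avg F : sqint mu F -> sqint mu (trans_avg F).
Proof.
move=> LF; have [mF _] := LF; split; first exact: measurable_trans_avg.
have mA := (measurable_EFinP _ _).2 (mabs mF).
have A0 (z : 'cV[R]_n * Omega) : (0 <= (normc (h z.2) * nsq (F (z.1 + b z.2)))%:E)%E.
  by rewrite lee_fin mulr_ge0 ?normc_ge0 ?nsq_ge0.
have mB := @measurable_fun_fubini_tonelli_F _ _ _ _ _ nu _ mA A0.
apply: (@le_lt_trans _ _ (\int[mu]_t ((2 * H)%:E *
    \int[nu]_u (normc (h u) * nsq (F (t + b u)))%:E))%E).
  apply: ae_ge0_le_integral => //.
  - by move=> t _; rewrite lee_fin nsq_ge0.
  - by apply/measurable_EFinP; apply: measurable_nsq; exact: measurable_trans_avg.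
  - move=> t _; apply: mule_ge0; first by rewrite lee_fin mulr_ge0.
    by apply: integral_ge0 => u _; exact: (A0 (t, u)).
  - by apply: emeasurable_funM.
  - by have := trans_avg_ae LF; apply: filterS => t [].
rewrite (ge0_integralZl_EFin _ measurableT _ mB) ?mulr_ge0//; last first.
  by move=> t _; apply: integral_ge0 => u _; exact: (A0 (t, u)).
have := abs_lty LF; rewrite -ge0_fin_numE; last first.
  by apply: integral_ge0 => t _; apply: integral_ge0 => u _; exact: (A0 (t, u)).
by move=> /fineK <-; rewrite -EFinM ltry.
Qed.

Let msym : measurable_fun setT (fun z : 'cV[R]_n * Omega => h z.2 * cis (- dotV (b z.2) z.1)).
Proof.
apply: measurable_funcM; first exact: msnd.
apply: measurable_cis; apply: measurable_funN; apply: measurable_dotV.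
  exact: msnd.
exact: measurable_fst.
Qed.

Lemma measurable_trans_symbol : measurable_fun setT trans_symbol.
Proof. exact: (measurable_cintegral_section nu msym). Qed.

Let normc_cis x : normc (cis x) = 1 :> R.
Proof. by rewrite normc_sqrt nsq_cis sqrtr1. Qed.

Lemma trans_symbol_bounded s : nsq (trans_symbol s) <= 2 * H ^+ 2.
Proof.
have E : (\int[nu]_u (normc (h u * cis (- dotV (b u) s)))%:E)%E = H%:E.
  rewrite HE; apply: eq_integral => u _.
  by rewrite ComplexField.Normc.normcM normc_cis mulr1.
have mt : measurable_fun setT (fun u => h u * cis (- dotV (b u) s)).
  by have := measurableT_comp msym (pair1_measurable s).
have IC : cinteg nu (fun u => h u * cis (- dotV (b u) s)).
  by apply: cinteg_normc => //; rewrite E ltry.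
by have := nsq_cintegral_le IC; rewrite E.
Qed.

Lemma sqint_trans_symbolM F : sqint mu F -> sqint mu (fun s => trans_symbol s * F s).
Proof.
move=> LF; apply: (sqint_le (K := 2 * H ^+ 2) _ LF).
- by apply: measurable_funcM; [exact: measurable_trans_symbol|case: LF].
- by rewrite mulr_ge0// sqr_ge0.
- by move=> s; rewrite nsqM ler_wpM2r ?nsq_ge0// trans_symbol_bounded.
Qed.

Section pairing.
Variables U : ('cV[R]_n -> R[i]) -> 'cV[R]_n -> R[i].
Hypothesis isoU : isometric_map mu mu U.
Hypothesis Utrans : forall c F, sqint mu F ->
  \forall s \ae mu, U (fun t => F (t + c)) s = cis (- dotV c s) * U F s.

Let sqint_shift F u : sqint mu F -> sqint mu (fun t => F (t + b u)).
Proof.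
move=> LF; split; last by rewrite shift_nsq// ltry.
apply: (measurableT_comp LF.1); apply: measurable_funVD; first exact: measurable_id.
exact: measurable_cst.
Qed.

(** After Fubini it suffices to compare the inner products for fixed [u]: [U] preserves them and
    turns the translation by [b u] into a phase. A second use of Fubini assembles the phases into
    the symbol. *)
Lemma dot_trans_avg F G : sqint mu F -> sqint mu G ->
  dot mu (trans_avg F) G = dot mu (fun s => trans_symbol s * U F s) (U G).
Proof.
move=> LF LG; have [isoU1 isoU2 isoU3] := isoU.
have [LUF _] := isoU1 _ LF; have [LUG _] := isoU1 _ LG.
pose f (z : 'cV[R]_n * Omega) := h z.2 * F (z.1 + b z.2) * conjc (G z.1).
pose g (z : 'cV[R]_n * Omega) := h z.2 * cis (- dotV (b z.2) z.1) * U F z.1 * conjc (U G z.1).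
have mf : measurable_fun setT f.
  apply: measurable_funcM; first by apply: mint; case: LF.
  by apply: measurable_conjc; apply: mfst; case: LG.
have mg : measurable_fun setT g.
  apply: measurable_funcM.
    by apply: measurable_funcM; [exact: msym|apply: mfst; case: LUF].
  by apply: measurable_conjc; apply: mfst; case: LUG.
(* Absolute convergence, common to the two double integrals: [|p conj q| <= |p|^2 + |q|^2], and the
   norms of the sections at [u] do not depend on [u]. *)
have bound (p q : 'cV[R]_n * Omega -> R[i]) (k : 'cV[R]_n * Omega -> R[i]) (C1 C2 : R) :
    measurable_fun setT p -> measurable_fun setT q -> measurable_fun setT k ->
    (forall z, normc (k z) = normc (h z.2) * normc (p z * conjc (q z))) ->
    (forall u, \int[mu]_t (nsq (p (t, u)))%:E = C1%:E)%E ->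
    (forall u, \int[mu]_t (nsq (q (t, u)))%:E = C2%:E)%E ->
    (\int[mu]_t \int[nu]_u (normc (k (t, u)))%:E < +oo)%E.
  move=> mp mq mk kE p1 q1.
  have mpq : measurable_fun setT (fun z => nsq (p z) + nsq (q z)).
    by apply: measurable_funD; exact: measurable_nsq.
  have mhpq : measurable_fun setT (fun z : 'cV[R]_n * Omega =>
      (normc (h z.2) * (nsq (p z) + nsq (q z)))%:E).
    apply/measurable_EFinP; apply: measurable_funM => //.
    exact: (msnd (measurable_normc mh)).
  have mkE : measurable_fun setT (fun z : 'cV[R]_n * Omega => (normc (k z))%:E).
    by apply/measurable_EFinP; exact: measurable_normc.
  have k0 z : (0 <= (normc (k z))%:E)%E by rewrite lee_fin normc_ge0.
  have hpq0 (z : 'cV[R]_n * Omega) : (0 <= (normc (h z.2) * (nsq (p z) + nsq (q z)))%:E)%E.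
    by rewrite lee_fin; apply: mulr_ge0; [exact: normc_ge0|apply: addr_ge0; exact: nsq_ge0].
  apply: (@le_lt_trans _ _ (\int[mu]_t \int[nu]_u
     (normc (h u) * (nsq (p (t, u)) + nsq (q (t, u))))%:E)%E); last first.
    apply: (tonelli_lty (p := fun z => nsq (p z) + nsq (q z)) (C := C1 + C2)) => //.
    - by move=> z; apply: addr_ge0; exact: nsq_ge0.
    - move=> u; under eq_integral do rewrite EFinD.
      rewrite ge0_integralD//; first by rewrite p1 q1 -EFinD.
      + by move=> t _; rewrite lee_fin nsq_ge0.
      + apply/measurable_EFinP; apply: (measurableT_comp (measurable_nsq mp)).
        exact: pair2_measurable.
      + by move=> t _; rewrite lee_fin nsq_ge0.
      + apply/measurable_EFinP; apply: (measurableT_comp (measurable_nsq mq)).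
        exact: pair2_measurable.
  apply: ge0_le_integral => //.
  - by move=> t _; apply: integral_ge0 => u _; exact: k0.
  - exact: (@measurable_fun_fubini_tonelli_F _ _ _ _ _ nu _ mkE k0).
  - exact: (@measurable_fun_fubini_tonelli_F _ _ _ _ _ nu _ mhpq hpq0).
  - move=> t _; apply: ge0_le_integral => //.
    + by apply: (measurableT_comp mkE); exact: pair1_measurable.
    + by have := measurableT_comp mhpq (pair1_measurable t).
    + move=> u _; rewrite lee_fin kE ler_wpM2l ?normc_ge0//.
      exact: normc_mul_conj_le.
have fin_f : (\int[mu]_t \int[nu]_u (normc (f (t, u)))%:E < +oo)%E.
  apply: (bound (fun z => F (z.1 + b z.2)) (fun z => G z.1) _ (nrm2 mu F) (nrm2 mu G)) => //.
  - by apply: mtrans; case: LF.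
  - by apply: mfst; case: LG.
  - by move=> z; rewrite /f -mulrA ComplexField.Normc.normcM.
  - by move=> u; exact: shift_nsq.
  - by move=> u; rewrite nrm2E.
have fin_g : (\int[mu]_t \int[nu]_u (normc (g (t, u)))%:E < +oo)%E.
  apply: (bound (fun z => U F z.1) (fun z => U G z.1) _ (nrm2 mu (U F)) (nrm2 mu (U G))) => //.
  - by apply: mfst; case: LUF.
  - by apply: mfst; case: LUG.
  - move=> z; rewrite /g -mulrA ComplexField.Normc.normcM ComplexField.Normc.normcM.
    by rewrite normc_cis mulr1.
  - by move=> u; rewrite nrm2E.
  - by move=> u; rewrite nrm2E.
have [f1 f2 _ fE] := cintegral_fubini mf fin_f.
have [g1 g2 _ gE] := cintegral_fubini mg fin_g.
have Zr (m : {measure set Omega -> \bar R}) (k : Omega -> R[i]) c : cinteg m k ->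
    cintegral m k * c = cintegral m (fun u => k u * c).
  by move=> Ik; rewrite mulrC -cintegralZ//; congr cintegral; apply/funext => u; rewrite mulrC.
have mcf := measurable_cintegral_section nu mf.
have mcg := measurable_cintegral_section nu mg.
transitivity (cintegral mu (fun t => cintegral nu (fun u => f (t, u)))).
  apply: ae_eq_cintegral => //.
    apply: measurable_funcM; first by apply: measurable_trans_avg; case: LF.
    by apply: measurable_conjc; case: LG.
  by have := trans_avg_ae LF; apply: filterS => t [It _]; rewrite /trans_avg Zr.
transitivity (cintegral mu (fun s => cintegral nu (fun u => g (s, u)))); last first.
  congr cintegral; apply/funext => s; rewrite /trans_symbol Zr; last first.
    apply: cinteg_normc; first by have := measurableT_comp msym (pair1_measurable s).
    under eq_integral do rewrite ComplexField.Normc.normcM normc_cis mulr1.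
    by rewrite -HE ltry.
  rewrite Zr//.
  have Is : cinteg nu (fun u => h u * cis (- dotV (b u) s)).
    apply: cinteg_normc; first by have := measurableT_comp msym (pair1_measurable s).
    under eq_integral do rewrite ComplexField.Normc.normcM normc_cis mulr1.
    by rewrite -HE ltry.
  have := cintegZ (U F s) Is; rewrite /cinteg.
  by congr (_ /\ _); congr integrable; apply/funext => u; rewrite mulrC.
rewrite fE gE; congr cintegral; apply/funext => u.
have Lt := sqint_shift u LF.
rewrite (_ : cintegral mu _ = h u * dot mu (fun t => F (t + b u)) G); last first.
  rewrite /dot -cintegralZ; last exact: cinteg_dot.
  by congr cintegral; apply/funext => t; rewrite /f /= mulrA.
rewrite -(dot_isometry Lt LG isoU1 isoU2).
have Lc : sqint mu (fun s => cis (- dotV (b u) s) * U F s).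
  apply: (sqint_cis _ LUF).1; apply: measurable_funN; apply: measurable_dotV.
    exact: measurable_cst.
  exact: measurable_id.
rewrite (dot_ae (f' := fun s => cis (- dotV (b u) s) * U F s) (g' := U G)).
- rewrite /dot -cintegralZ; last exact: cinteg_dot.
  by congr cintegral; apply/funext => s; rewrite /g /= !mulrA.
- by case: (isoU1 _ Lt) => -[].
- by case: Lc.
- by case: LUG.
- by case: LUG.
- exact: Utrans.
- exact: aeW.
Qed.

Variable Ui : ('cV[R]_n -> R[i]) -> 'cV[R]_n -> R[i].
Hypothesis isoUi : isometric_map mu mu Ui.
Hypothesis UiK : forall F, sqint mu F -> \forall x \ae mu, Ui (U F) x = F x.

(** Both sides have the same inner product with every square-integrable function, in particular with
    their own difference, which therefore has norm 0. *)
Theorem trans_avgE F : sqint mu F ->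
  \forall t \ae mu, trans_avg F t = Ui (fun s => trans_symbol s * U F s) t.
Proof.
move=> LF; have [isoU1 isoU2 isoU3] := isoU; have [isoUi1 isoUi2 isoUi3] := isoUi.
have [LUF _] := isoU1 _ LF; have LK := sqint_trans_avg LF.
have Ls := sqint_trans_symbolM LUF; have [LV _] := isoUi1 _ Ls.
pose V := Ui (fun s => trans_symbol s * U F s).
have LD := sqintB LK LV.
have E G : sqint mu G -> dot mu (trans_avg F) G = dot mu V G.
  move=> LG; have [LUG _] := isoU1 _ LG; rewrite dot_trans_avg//.
  rewrite -(dot_isometry Ls LUG isoUi1 isoUi2); apply: dot_ae => //.
  - by case: LV.
  - by case: LV.
  - by case: (isoUi1 _ LUG) => -[].
  - by case: LG.
  - exact: aeW.
  - exact: UiK.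
have : dot mu (fun t => trans_avg F t - V t) (fun t => trans_avg F t - V t) = 0.
  by rewrite dotBl// E// subrr.
rewrite dotff => /(@complexI _ _ 0) /(nrm2_eq0 LD).
by apply: filterS => t /eqP; rewrite subr_eq0 => /eqP.
Qed.

End pairing.

End translation_average.

(** * Logarithmic coordinates in the orthants *)

Section orthant_decomposition.
Context {R : realType} {n : nat}.
Local Notation mu := (@lebesgue_cV R n).
Local Notation signs := {ffun 'I_n -> bool}.
Implicit Types (sg : signs) (f g : 'cV[R]_n -> R[i]).

Lemma ge0_integral_orthants (f : 'cV[R]_n -> \bar R) :
  measurable_fun setT f -> (forall x, 0 <= f x)%E ->
  (\int[mu]_x f x = \sum_(sg : signs) \int[mu]_t (f (expV sg t) * (expR (sumV t))%:E))%E.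
Proof.
move=> mf f0; under [RHS]eq_bigr do rewrite -ge0_integral_orthant//.
transitivity (\int[mu]_x (\sum_(sg : signs) (f \_ (orthant sg)) x))%E.
  apply: eq_integral => x _; pose s : signs := [ffun i => 0 < x i 0].
  rewrite (bigD1 s)//= big1 ?adde0 => [|sg sgs]; rewrite patchE.
    by rewrite mem_set// => i; rewrite ffunE.
  rewrite memNset// => ox; move/negP: sgs; apply; apply/eqP/ffunP => i.
  by rewrite ffunE ox.
rewrite ge0_integral_sum//.
- by apply: eq_bigr => sg _; rewrite -integral_mkcond.
- move=> sg; apply/(measurable_restrictT f (measurable_orthant sg)).
  exact: measurable_funTS.
- by move=> sg x _; rewrite patchE; case: ifP.
Qed.

Definition lnV (y : 'cV[R]_n) : 'cV[R]_n := \col_i ln `|y i 0|.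

Definition signV (y : 'cV[R]_n) : signs := [ffun i => 0 < y i 0].

Lemma lnV_expV sg (t : 'cV[R]_n) : lnV (expV sg t) = t.
Proof.
apply/colP => i; rewrite !mxE /sgnb normrM (ger0_norm (expR_ge0 _)).
by case: (sg i); rewrite ?normrN normr1 mul1r expRK.
Qed.

Lemma signV_expV sg (t : 'cV[R]_n) : signV (expV sg t) = sg.
Proof. by apply/ffunP => i; rewrite ffunE expV_orthant. Qed.

Variable C : 'M[R]_n.
Hypothesis oC : orthogonal_mx C.

Definition to_orthants f sg (t : 'cV[R]_n) : R[i] :=
  (expR (sumV t / 2))%:C%C * f (C *m expV sg t).

(** Where a coordinate of [C^T x] vanishes, the logarithm and the sign take default values; [expV]
    never reaches such points, so [to_orthants] does not see them. *)
Definition of_orthants (F : signs -> 'cV[R]_n -> R[i]) (x : 'cV[R]_n) : R[i] :=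
  let y := C^T *m x in (expR (- (sumV (lnV y) / 2)))%:C%C * F (signV y) (lnV y).

Lemma to_orthantsK F sg t : to_orthants (of_orthants F) sg t = F sg t.
Proof.
rewrite /to_orthants /of_orthants mulmxA oC mul1mx lnV_expV signV_expV mulrA.
by rewrite -rmorphM -expRD subrr expR0 mul1r.
Qed.

Lemma measurable_to_orthants f sg : measurable_fun setT f ->
  measurable_fun setT (to_orthants f sg).
Proof.
move=> mf; have mid : measurable_fun setT (fun t : 'cV[R]_n => t) by exact: measurable_id.
apply: measurable_funcM.
  apply: measurable_real_complex; apply: (measurableT_comp (@measurable_expR R)).
  by apply: measurable_funM => //; exact: measurable_sumV.
apply: (measurableT_comp mf); apply: measurable_funV_mulmx.
exact: measurable_expV.
Qed.

Lemma measurable_of_orthants F : (forall sg, measurable_fun setT (F sg)) ->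
  measurable_fun setT (of_orthants F).
Proof.
move=> mF; have mid : measurable_fun setT (fun t : 'cV[R]_n => t) by exact: measurable_id.
have mCT : measurable_fun setT (fun x : 'cV[R]_n => C^T *m x) by exact: measurable_funV_mulmx.
have mln : measurable_fun setT (fun x : 'cV[R]_n => lnV (C^T *m x)).
  apply: measurable_cVP => i; under eq_fun do rewrite mxE.
  apply: (measurableT_comp (@measurable_ln R)).
  apply: (measurableT_comp (@normr_measurable R setT)).
  exact: measurable_funV_entry.
(* The dependence on [signV] is a case distinction over finitely many measurable sets; as a sum of
   indicators it is measurable by closure properties. *)
have indE x : of_orthants F x = \sum_(sg : signs)
    (expR (- (sumV (lnV (C^T *m x)) / 2)) * \1_(orthant sg) (C^T *m x))%:C%C *
    F sg (lnV (C^T *m x)).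
  rewrite (bigD1 (signV (C^T *m x)))//= big1 ?addr0 => [|sg sgs]; rewrite indicE.
    rewrite mem_set; first by rewrite mulr1.
    by move=> i; rewrite ffunE.
  rewrite memNset ?mulr0 ?mul0r// => ox; move/negP: sgs; apply.
  by apply/eqP/ffunP => i; rewrite ffunE ox.
have -> : of_orthants F = fun x => \sum_(sg : signs)
    (expR (- (sumV (lnV (C^T *m x)) / 2)) * \1_(orthant sg) (C^T *m x))%:C%C *
    F sg (lnV (C^T *m x)) by apply/funext => x; exact: indE.
elim: (index_enum _) => [|sg s IH].
  under eq_fun do rewrite big_nil.
  exact: measurable_cst.
under eq_fun do rewrite big_cons.
apply: measurable_funcD => //; apply: measurable_funcM.
  apply: measurable_real_complex; apply: measurable_funM.
    apply: (measurableT_comp (@measurable_expR R)); apply: measurable_funN.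
    by apply: measurable_funM => //; exact: measurable_sumV.
  apply: (measurableT_comp _ mCT); apply: measurable_indic.
  exact: measurable_orthant.
exact: (measurableT_comp (mF sg) mln).
Qed.

Lemma integral_nsq_to_orthants f : measurable_fun setT f ->
  (\int[mu]_x (nsq (f x))%:E =
   \sum_(sg : signs) \int[mu]_t (nsq (to_orthants f sg t))%:E)%E.
Proof.
move=> mf; have mn : measurable_fun setT (fun x => (nsq (f x))%:E).
  by apply/measurable_EFinP; exact: measurable_nsq.
rewrite -(ge0_integral_cV_orthogonal oC mn); last by move=> x; rewrite lee_fin nsq_ge0.
rewrite ge0_integral_orthants; last 2 first.
- apply: (measurableT_comp mn); apply: measurable_funV_mulmx.
  exact: measurable_id.
- by move=> x; rewrite lee_fin nsq_ge0.
apply: eq_bigr => sg _; apply: eq_integral => t _.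
rewrite /to_orthants nsqM nsq_real -EFinM mulrC; congr (_ * _)%:E.
by rewrite expr2 -expRD -splitr.
Qed.

Lemma sqint_to_orthants f sg : sqint mu f -> sqint mu (to_orthants f sg).
Proof.
move=> [mf Lf]; split; first exact: measurable_to_orthants.
apply: le_lt_trans Lf; rewrite (integral_nsq_to_orthants mf) (bigD1 sg)//= leeDl//.
by apply: sume_ge0 => s _; apply: integral_ge0 => t _; rewrite lee_fin nsq_ge0.
Qed.

Lemma nrm2_to_orthants f : sqint mu f -> nrm2 mu f = \sum_sg nrm2 mu (to_orthants f sg).
Proof.
move=> Lf; apply: EFin_inj; rewrite -sumEFin nrm2E// integral_nsq_to_orthants; last by case: Lf.
by apply: eq_bigr => sg _; rewrite nrm2E//; exact: sqint_to_orthants.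
Qed.

Lemma sqint_orthantsP f : measurable_fun setT f ->
  (forall sg, sqint mu (to_orthants f sg)) -> sqint mu f.
Proof.
move=> mf Lf; split => //; rewrite integral_nsq_to_orthants//.
by apply: lte_sum_pinfty => sg _; case: (Lf sg).
Qed.

Lemma sqint_of_orthants F : (forall sg, sqint mu (F sg)) -> sqint mu (of_orthants F).
Proof.
move=> LF; apply: sqint_orthantsP.
  by apply: measurable_of_orthants => sg; case: (LF sg).
move=> sg; rewrite (_ : to_orthants _ _ = F sg)//.
by apply/funext => t; exact: to_orthantsK.
Qed.

Lemma to_orthantsD f g c sg t :
  to_orthants (fun x => c * f x + g x) sg t = c * to_orthants f sg t + to_orthants g sg t.
Proof. by rewrite /to_orthants mulrDr mulrCA. Qed.

(** Null sets are transported through norms: all components have norm 0, hence so has [f], and no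
    image of a null set under [expV] has to be measured. *)
Lemma ae0_to_orthants f : measurable_fun setT f ->
  (forall sg, \forall t \ae mu, to_orthants f sg t = 0) -> \forall x \ae mu, f x = 0.
Proof.
move=> mf f0.
have Lf : sqint mu f.
  apply: sqint_orthantsP => // sg.
  apply: (sqint_ae _ (sqint0 mu)); first exact: measurable_to_orthants.
  by have := f0 sg; apply: filterS => t.
apply: (nrm2_eq0 Lf); rewrite nrm2_to_orthants// big1// => sg _.
by apply: nrm2_ae0 => //; exact: measurable_to_orthants.
Qed.

Lemma ae_eq_to_orthants f g sg : sqint mu f -> sqint mu g ->
  (\forall x \ae mu, f x = g x) ->
  \forall t \ae mu, to_orthants f sg t = to_orthants g sg t.
Proof.
move=> Lf Lg fg; have L := sqintD (sqintZ (-1) Lf) Lg.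
have N0 : nrm2 mu (fun x => -1 * f x + g x) = 0.
  apply: nrm2_ae0; last by case: L.
  by apply: filterS fg => x ->; rewrite mulN1r addNr.
have : nrm2 mu (to_orthants (fun x => -1 * f x + g x) sg) = 0.
  apply/eqP; move: N0; rewrite nrm2_to_orthants// => /eqP.
  rewrite psumr_eq0 => [/allP/(_ sg (mem_index_enum _))//|s _]; exact: nrm2_ge0.
move/(nrm2_eq0 (sqint_to_orthants sg L)); apply: filterS => t.
by rewrite to_orthantsD mulN1r addrC => /eqP; rewrite subr_eq0 => /eqP ->.
Qed.

Lemma ae_eq_orthantsP f g : measurable_fun setT f -> measurable_fun setT g ->
  (forall sg, \forall t \ae mu, to_orthants f sg t = to_orthants g sg t) ->
  \forall x \ae mu, f x = g x.
Proof.
move=> mf mg fg.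
have : \forall x \ae mu, -1 * f x + g x = 0.
  apply: ae0_to_orthants => [|sg]; first by apply: measurable_funcD => //; exact: measurable_funcM.
  by have := fg sg; apply: filterS => t; rewrite to_orthantsD mulN1r => ->; rewrite addNr.
by apply: filterS => x; rewrite mulN1r addrC => /eqP; rewrite subr_eq0 => /eqP ->.
Qed.

Lemma ae_orthants (B : set 'cV[R]_n) : measurable B ->
  (forall sg, \forall t \ae mu, ~ B (C *m expV sg t)) -> \forall x \ae mu, ~ B x.
Proof.
move=> mB HB; have : \forall x \ae mu, (\1_B x : R)%:C%C = 0 :> R[i].
  apply: ae0_to_orthants; first by apply: measurable_real_complex; exact: measurable_indic.
  move=> sg; have := HB sg; apply: filterS => t nB.
  by rewrite /to_orthants indicE memNset// mulr0.
apply: filterS => x; rewrite indicE => + Bx; rewrite mem_set// => /eqP.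
by rewrite (_ : 0 = 0%:C%C)// (inj_eq (@complexI R)) oner_eq0.
Qed.

(** Polarization: the norm identity for [f + g] gives the real parts, and the imaginary parts are
    the real parts for [- i f]. *)
Lemma dot_to_orthants f g : sqint mu f -> sqint mu g ->
  \sum_sg dot mu (to_orthants f sg) (to_orthants g sg) = dot mu f g.
Proof.
have ReE f' g' : sqint mu f' -> sqint mu g' ->
    Re (\sum_sg dot mu (to_orthants f' sg) (to_orthants g' sg)) = Re (dot mu f' g').
  move=> Lf Lg; have Lf1 := sqintZ 1 Lf.
  have := nrm2_to_orthants (sqintD Lf Lg); rewrite nrm2D//.
  under eq_bigr => sg _.
    rewrite (_ : to_orthants _ sg = fun t => to_orthants f' sg t + to_orthants g' sg t).
      rewrite nrm2D; [|exact: sqint_to_orthants..].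
      over.
    by apply/funext => t; rewrite /to_orthants mulrDr.
  rewrite !big_split/= -!nrm2_to_orthants// -mulr_sumr => /addrI /(@mulfI _ 2) ->.
    by elim/big_rec2: _ => [//|sg x y _ <-]; rewrite raddfD.
  by rewrite pnatr_eq0.
move=> Lf Lg; have := ReE _ _ (sqintZ (Complex 0 (-1)) Lf) Lg.
rewrite dotZl//; under eq_bigr => sg _.
  rewrite (_ : to_orthants _ sg = fun t => Complex 0 (-1) * to_orthants f sg t).
    rewrite dotZl; [|exact: sqint_to_orthants..].
    over.
  by apply/funext => t; rewrite /to_orthants mulrCA.
rewrite -mulr_sumr; have := ReE _ _ Lf Lg.
case: (\sum_sg _) => a b; case: (dot mu f g) => a' b' /= -> .
by move=> E; congr Complex; lra.
Qed.

End orthant_decomposition.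

(** * Vector-valued functions through their components *)

Section vector_L2.
Context {R : realType} {n : nat}.
Local Notation leb := (@lebesgue_cV R n).
Local Notation "f =L2 g" := (f = g %[ae leb]) (at level 70).

Lemma conj_opE (z : R[i]) : z^* = conjc z.
Proof. by []. Qed.

Lemma sqnormE m (v : 'cV[R[i]]_m) : sqnorm v = \sum_k nsq (v k 0).
Proof. by apply: eq_bigr => k _; rewrite nsqE. Qed.

Lemma L2sqE m (f : 'cV[R]_n -> 'cV[R[i]]_m) : measurable_fun setT f ->
  L2sq f = (\sum_k \int[leb]_x (nsq (f x k 0))%:E)%E.
Proof.
move=> mf; rewrite /L2sq; under eq_integral do rewrite sqnormE -sumEFin.
rewrite ge0_integral_sum//.
- move=> k; apply/measurable_EFinP; apply: measurable_nsq.
  exact: (measurableT_comp (measurable_entry k 0) mf).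
- by move=> k x _; rewrite lee_fin nsq_ge0.
Qed.

Lemma L2funP m (f : 'cV[R]_n -> 'cV[R[i]]_m) :
  L2fun f <-> forall k, sqint leb (fun x => f x k 0).
Proof.
split=> [[mf Lf] k|Lf].
  split; first exact: (measurableT_comp (measurable_entry k 0) mf).
  apply: le_lt_trans Lf; rewrite L2sqE// (bigD1 k)//= leeDl//.
  by apply: sume_ge0 => j _; apply: integral_ge0 => x _; rewrite lee_fin nsq_ge0.
have mf : measurable_fun setT f.
  by apply: measurable_matrixP => k j; rewrite ord1; case: (Lf k).
split=> //; rewrite L2sqE//; apply: lte_sum_pinfty => k _; by case: (Lf k).
Qed.

Lemma L2sq_nrm2 m (f : 'cV[R]_n -> 'cV[R[i]]_m) : L2fun f ->
  L2sq f = (\sum_k nrm2 leb (fun x => f x k 0))%:E.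
Proof.
move=> Lf; rewrite L2sqE; last by case: Lf.
rewrite -sumEFin; apply: eq_bigr => k _; rewrite nrm2E//.
by have /L2funP := Lf.
Qed.

Lemma L2dotE m (f g : 'cV[R]_n -> 'cV[R[i]]_m) : L2fun f -> L2fun g ->
  L2dot f g = \sum_k dot leb (fun x => f x k 0) (fun x => g x k 0).
Proof.
move=> /L2funP Lf /L2funP Lg; rewrite /L2dot /dot.
suff [] : cinteg leb (fun x => \sum_k f x k 0 * (g x k 0)^*) /\
  cintegral leb (fun x => \sum_k f x k 0 * (g x k 0)^*) =
  \sum_k cintegral leb (fun x => f x k 0 * (g x k 0)^*%C) by [].
elim: (index_enum _) => [|k s [IH1 IH2]].
  under eq_fun do rewrite big_nil.
  by rewrite big_nil cintegral0; split => //; exact: cinteg0.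
under eq_fun do rewrite big_cons.
have Ik := cinteg_dot (Lf k) (Lg k).
split; first exact: cintegD.
by rewrite big_cons cintegralD// IH2.
Qed.

Lemma L2_aeP m (f g : 'cV[R]_n -> 'cV[R[i]]_m) :
  f =L2 g <-> forall k, \forall x \ae leb, f x k 0 = g x k 0.
Proof.
split=> [fg k|fg]; first by apply: filterS fg => x ->.
have : \forall x \ae leb, forall k, f x k 0 = g x k 0 by exact: filter_forall.
apply: filterS => x H _.
by apply/matrixP => k j; rewrite ord1.
Qed.

Lemma L2fun_lin m (c : R[i]) (f g : 'cV[R]_n -> 'cV[R[i]]_m) :
  L2fun f -> L2fun g -> L2fun (fun x => c *: f x + g x).
Proof.
move=> /L2funP Lf /L2funP Lg; apply/L2funP => k.
rewrite (_ : (fun x => _) = fun x => c * f x k 0 + g x k 0).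
  by apply: sqintD => //; exact: sqintZ.
by apply/funext => x; rewrite !mxE.
Qed.

Lemma L2_measurable_entry m (f : 'cV[R]_n -> 'cV[R[i]]_m) k :
  L2fun f -> measurable_fun setT (fun x => f x k 0).
Proof. by move=> /L2funP/(_ k)[]. Qed.

Lemma L2dot_ae m (f f' g g' : 'cV[R]_n -> 'cV[R[i]]_m) :
  L2fun f -> L2fun f' -> L2fun g -> L2fun g' -> f =L2 f' -> g =L2 g' ->
  L2dot f g = L2dot f' g'.
Proof.
move=> Lf Lf' Lg Lg' /L2_aeP ff /L2_aeP gg; rewrite !L2dotE//.
apply: eq_bigr => k _; apply: dot_ae => //.
- exact: (L2_measurable_entry k Lf).
- exact: (L2_measurable_entry k Lf').
- exact: (L2_measurable_entry k Lg).
- exact: (L2_measurable_entry k Lg').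
Qed.

Lemma L2sq_ae m (f g : 'cV[R]_n -> 'cV[R[i]]_m) : L2fun f -> L2fun g ->
  f =L2 g -> L2sq f = L2sq g.
Proof.
move=> Lf Lg /L2_aeP fg; rewrite !L2sq_nrm2//; congr (_%:E).
apply: eq_bigr => k _; apply: nrm2_ae => //.
- exact: (L2_measurable_entry k Lf).
- exact: (L2_measurable_entry k Lg).
Qed.

Lemma bounded_operator_comp m1 m2 m3
    (S : ('cV[R]_n -> 'cV[R[i]]_m2) -> 'cV[R]_n -> 'cV[R[i]]_m3)
    (T : ('cV[R]_n -> 'cV[R[i]]_m1) -> 'cV[R]_n -> 'cV[R[i]]_m2) :
  bounded_operator S -> bounded_operator T -> bounded_operator (S \o T).
Proof.
move=> [S1 S2 S3 [M SM]] [T1 T2 T3 [N TN]]; split => /=.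
- by move=> f Lf; apply/S1/T1.
- by move=> f g Lf Lg fg; apply: S2; [exact: T1|exact: T1|exact: T2].
- move=> c f g Lf Lg.
  have h1 := S3 c _ _ (T1 _ Lf) (T1 _ Lg).
  have h2 := S2 _ _ (T1 _ (L2fun_lin c Lf Lg)) (L2fun_lin c (T1 _ Lf) (T1 _ Lg)) (T3 c _ _ Lf Lg).
  by apply: filterS2 h1 h2 => x e1 e2 _; rewrite e2// e1.
- exists (`|M| * N) => f Lf; apply: (le_trans (SM _ (T1 _ Lf))).
  have T0 : (0 <= L2sq (T f))%E.
    by rewrite L2sq_nrm2; [rewrite lee_fin sumr_ge0// => k _; exact: nrm2_ge0|exact: T1].
  apply: (@le_trans _ _ (`|M|%:E * L2sq (T f))%E).
    by apply: lee_wpmul2r => //; rewrite lee_fin ler_norm.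
  by rewrite EFinM -muleA lee_wpmul2l ?lee_fin//; exact: TN.
Qed.

Lemma bounded_operator_ae m1 m2
    (S T : ('cV[R]_n -> 'cV[R[i]]_m1) -> 'cV[R]_n -> 'cV[R[i]]_m2) :
  bounded_operator S -> (forall f, L2fun f -> L2fun (T f)) ->
  (forall f, L2fun f -> T f =L2 S f) -> bounded_operator T.
Proof.
move=> [S1 S2 S3 [M SM]] T1 TS; split => //.
- move=> f g Lf Lg fg; have h := S2 _ _ Lf Lg fg.
  apply: filterS3 (TS _ Lf) (TS _ Lg) h => x e1 e2 e3 _.
  by rewrite e1// e2// e3.
- move=> c f g Lf Lg; have h1 := TS _ (L2fun_lin c Lf Lg).
  have h2 := S3 c _ _ Lf Lg; have h3 : \forall x \ae leb, T f x = S f x /\ T g x = S g x.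
    by apply: filterS2 (TS _ Lf) (TS _ Lg) => x e1 e2; rewrite e1// e2.
  by apply: filterS3 h1 h2 h3 => x e1 e2 [e3 e4] _; rewrite e1// e2// e3 e4.
- by exists M => f Lf; rewrite (L2sq_ae (T1 _ Lf) (S1 _ Lf) (TS _ Lf)); exact: SM.
Qed.

Lemma bounded_mul_operator m (phi : 'cV[R]_n -> R[i]) (K : R) : measurable_fun setT phi ->
  (forall s, nsq (phi s) <= K) -> @bounded_operator R n m m (mul_operator phi).
Proof.
move=> mphi phiK.
have K0 : 0 <= K by apply: le_trans (phiK 0); exact: nsq_ge0.
have L f : sqint leb f -> sqint leb (fun x => phi x * f x) /\
   nrm2 leb (fun x => phi x * f x) <= K * nrm2 leb f.
  move=> Lf; have mpf : measurable_fun setT (fun x => phi x * f x).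
    by apply: measurable_funcM => //; case: Lf.
  have b x : nsq (phi x * f x) <= K * nsq (f x) by rewrite nsqM ler_wpM2r ?nsq_ge0.
  by split; [exact: (sqint_le mpf Lf K0)|exact: nrm2_le].
have E (f : 'cV[R]_n -> 'cV[R[i]]_m) k :
   (fun x => mul_operator phi f x k 0) = (fun x => phi x * f x k 0).
  by apply/funext => x; rewrite mxE.
have Lm (f : 'cV[R]_n -> 'cV[R[i]]_m) : L2fun f -> L2fun (mul_operator phi f).
  by move=> /L2funP Lf; apply/L2funP => k; rewrite E; exact: (L _ (Lf k)).1.
split => //.
- by move=> f g Lf Lg; apply: filterS => x e _; rewrite /mul_operator e.
- move=> c f g Lf Lg; apply: aeW => x _; rewrite /mul_operator scalerDr.
  by rewrite !scalerA mulrC.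
- exists K => f Lf; rewrite !L2sq_nrm2//; last exact: Lm.
  rewrite -EFinM lee_fin mulr_sumr; apply: ler_sum => k _; rewrite E.
  exact: (L _ ((L2funP f).1 Lf k)).2.
Qed.

Lemma L2dot_mul_operator m (phi : 'cV[R]_n -> R[i]) (f g : 'cV[R]_n -> 'cV[R[i]]_m) :
  L2dot (mul_operator phi f) g = L2dot f (mul_operator (fun x => conjc (phi x)) g).
Proof.
congr cintegral; apply/funext => x; apply: eq_bigr => k _.
by rewrite !mxE conj_opE conj_opE conjcM conjcK mulrCA mulrA.
Qed.

Section normal.
Context {m1 m2 : nat}.
Variables (V : ('cV[R]_n -> 'cV[R[i]]_m1) -> 'cV[R]_n -> 'cV[R[i]]_m2)
          (W : ('cV[R]_n -> 'cV[R[i]]_m2) -> 'cV[R]_n -> 'cV[R[i]]_m1).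
Hypothesis VW : unitary_operator V W.
Variables (phi : 'cV[R]_n -> R[i]) (K : R).
Hypothesis mphi : measurable_fun setT phi.
Hypothesis phiK : forall s, nsq (phi s) <= K.
Variable T : ('cV[R]_n -> 'cV[R[i]]_m1) -> 'cV[R]_n -> 'cV[R[i]]_m1.
Hypothesis LT : forall f, L2fun f -> L2fun (T f).
Hypothesis TE : forall f, L2fun f -> T f =L2 W (mul_operator phi (V f)).

(** The adjoint is [W] times multiplication by [conj phi] times [V]; it commutes with [T] because
    the two multiplications commute and [V W] is the identity. *)
Lemma normal_operator_unitary_mul : normal_operator T.
Proof.
have [bV bW Vdot WV VWid] := VW.
have [LV Vae _ _] := bV; have [LW Wae _ _] := bW.
pose psi x := conjc (phi x).
have bphi : @bounded_operator R n m2 m2 (mul_operator phi).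
  exact: bounded_mul_operator mphi phiK.
have bpsi : @bounded_operator R n m2 m2 (mul_operator psi).
  apply: (@bounded_mul_operator _ _ K); first exact: measurable_conjc.
  by move=> s; rewrite nsq_conj.
have bT : bounded_operator T.
  by apply: (bounded_operator_ae (bounded_operator_comp bW (bounded_operator_comp bphi bV))).
split=> //; pose S f := W (mul_operator psi (V f)).
have bS : bounded_operator S.
  exact: (bounded_operator_comp bW (bounded_operator_comp bpsi bV)).
have [LS Sae _ _] := bS.
have [Lphi phiae _ _] := bphi; have [Lpsi psiae _ _] := bpsi.
have Wdot f g : L2fun f -> L2fun g -> L2dot (W f) (W g) = L2dot f g.
  move=> Lf Lg; rewrite -Vdot; [|exact: LW|exact: LW].
  by apply: L2dot_ae; rewrite ?VWid//; do ?[exact/LV/LW]; exact: VWid.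
exists S; first split=> //.
  move=> f g Lf Lg.
  have LVf := LV _ Lf; have LVg := LV _ Lg.
  have -> : L2dot (T f) g = L2dot (W (mul_operator phi (V f))) (W (V g)).
    apply: L2dot_ae => //.
    - exact: LT.
    - exact/LW/Lphi.
    - exact: LW.
    - exact: TE.
    - by apply: filterS (WV _ Lg) => x e _; rewrite e.
  rewrite Wdot//; last exact: Lphi.
  rewrite L2dot_mul_operator -Wdot//; last exact: Lpsi.
  apply: L2dot_ae => //.
  - exact: LW.
  - exact: LS.
  - exact: LS.
  - exact: WV.
  - exact: aeW.
move=> f Lf; have LVf := LV _ Lf; have LSf := LS _ Lf; have LTf := LT Lf.
have h1 : T (S f) =L2 W (mul_operator phi (mul_operator psi (V f))).
  have e1 : W (mul_operator phi (V (S f))) =L2 W (mul_operator phi (mul_operator psi (V f))).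
    apply: Wae; [exact/Lphi/LV|exact/Lphi/Lpsi|].
    by apply: phiae; [exact: LV|exact: Lpsi|apply: VWid; exact: Lpsi].
  by apply: filterS2 (TE LSf) e1 => x e2 e3 _; rewrite e2// e3.
have h2 : S (T f) =L2 W (mul_operator psi (mul_operator phi (V f))).
  apply: Wae; [exact/Lpsi/LV|exact/Lpsi/Lphi|].
  apply: psiae; [exact: LV|exact: Lphi|].
  have e1 : V (T f) =L2 V (W (mul_operator phi (V f))).
    by apply: Vae => //; [exact/LW/Lphi|exact: TE].
  by apply: filterS2 e1 (VWid _ (Lphi _ LVf)) => x e2 e3 _; rewrite e2// e3.
apply: filterS2 h1 h2 => x e1 e2 _; rewrite e1// e2//.
congr W; apply/funext => y; rewrite /mul_operator !scalerA.
by rewrite mulrC.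
Qed.

End normal.

End vector_L2.

(** * The unitary map onto functions with [2^n] components *)

Section orthant_unitary.
Context {R : realType} {n : nat}.
Local Notation leb := (@lebesgue_cV R n).
Local Notation signs := {ffun 'I_n -> bool}.

Lemma card_signs : #|{: signs}| = (2 ^ n)%N.
Proof. by rewrite card_ffun card_bool card_ord. Qed.

(** Any enumeration of the sign patterns serves, as a scalar multiplication acts alike on all
    components. *)
Definition sign_of (k : 'I_(2 ^ n)) : signs := enum_val (cast_ord (esym card_signs) k).

Definition sign_index (sg : signs) : 'I_(2 ^ n) := cast_ord card_signs (enum_rank sg).

Lemma sign_indexK : cancel sign_index sign_of.
Proof. by move=> sg; rewrite /sign_of /sign_index cast_ordK enum_rankK. Qed.

Lemma sign_ofK : cancel sign_of sign_index.
Proof. by move=> k; rewrite /sign_of /sign_index enum_valK cast_ordKV. Qed.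

Lemma sum_sign_of {M : nmodType} (F : signs -> M) : \sum_k F (sign_of k) = \sum_sg F sg.
Proof.
by rewrite [RHS](reindex sign_of)//; exists sign_index => x _;
  [exact: sign_ofK|exact: sign_indexK].
Qed.

Variable C : 'M[R]_n.
Hypothesis oC : orthogonal_mx C.
Variables U Ui : ('cV[R]_n -> R[i]) -> 'cV[R]_n -> R[i].
Hypothesis isoU : isometric_map leb leb U.
Hypothesis isoUi : isometric_map leb leb Ui.
Hypothesis UiK : forall f, sqint leb f -> \forall x \ae leb, Ui (U f) x = f x.
Hypothesis UK : forall f, sqint leb f -> \forall x \ae leb, U (Ui f) x = f x.

Definition orthantV (f : 'cV[R]_n -> 'cV[R[i]]_1) : 'cV[R]_n -> 'cV[R[i]]_(2 ^ n) :=
  fun x => \col_k U (to_orthants C (fun y => f y 0 0) (sign_of k)) x.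

Definition orthantVinv (G : 'cV[R]_n -> 'cV[R[i]]_(2 ^ n)) : 'cV[R]_n -> 'cV[R[i]]_1 :=
  fun x => const_mx (of_orthants C (fun sg => Ui (fun t => G t (sign_index sg) 0)) x).

Let VE f k : (fun x => orthantV f x k 0) = U (to_orthants C (fun y => f y 0 0) (sign_of k)).
Proof. by apply/funext => x; rewrite mxE. Qed.

Let WE G k : (fun x => orthantVinv G x k 0) =
  of_orthants C (fun sg => Ui (fun t => G t (sign_index sg) 0)).
Proof. by apply/funext => x; rewrite mxE. Qed.

Let L1 (f : 'cV[R]_n -> 'cV[R[i]]_1) : L2fun f -> sqint leb (fun y => f y 0 0).
Proof. by move=> /L2funP/(_ 0). Qed.

Let LV f : L2fun f -> L2fun (orthantV f).
Proof.
move=> /L1 Lf; apply/L2funP => k; rewrite VE.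
by have [h _ _] := isoU; apply: (h _ _).1; exact: sqint_to_orthants.
Qed.

Let LUi G sg : L2fun G -> sqint leb (Ui (fun t => G t (sign_index sg) 0)).
Proof. by move=> /L2funP LG; have [h _ _] := isoUi; exact: (h _ (LG _)).1. Qed.

Let LW G : L2fun G -> L2fun (orthantVinv G).
Proof.
move=> LG; apply/L2funP => k; rewrite WE; apply: sqint_of_orthants => // sg.
exact: LUi.
Qed.

Let VW g : L2fun g -> orthantV (orthantVinv g) = g %[ae leb].
Proof.
move=> Lg; apply/L2_aeP => k.
have E : to_orthants C (fun y => orthantVinv g y 0 0) (sign_of k) = Ui (fun t => g t k 0).
  by apply/funext => t; rewrite WE to_orthantsK// sign_ofK.
by have := UK ((L2funP g).1 Lg k); apply: filterS => x; rewrite mxE E.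
Qed.

(** A test for equality with [orthantVinv G] on each orthant separately. It yields the inverse
    property, the linearity and, later, the factorization of the Hausdorff operator. *)
Lemma orthantVinv_ae G (f : 'cV[R]_n -> R[i]) :
  L2fun G -> measurable_fun setT f ->
  (forall sg, \forall t \ae leb, to_orthants C f sg t = Ui (fun t => G t (sign_index sg) 0) t) ->
  \forall x \ae leb, f x = orthantVinv G x 0 0.
Proof.
move=> LG mf fE.
have mW : measurable_fun setT (of_orthants C (fun sg => Ui (fun t => G t (sign_index sg) 0))).
  by apply: measurable_of_orthants => sg; case: (LUi sg LG).
have := @ae_eq_orthantsP R n C oC f _ mf mW; set h := of_orthants _ _.
move=> H; have : \forall x \ae leb, f x = h x.
  apply: H => sg; apply: filterS (fE sg) => t ->.
  by rewrite to_orthantsK.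
by apply: filterS => x ->; rewrite mxE.
Qed.

Let WV f : L2fun f -> orthantVinv (orthantV f) = f %[ae leb].
Proof.
move=> Lf; apply/L2_aeP => k; rewrite ord1; have Lf1 := L1 Lf.
have : \forall x \ae leb, f x 0 0 = orthantVinv (orthantV f) x 0 0.
  apply: orthantVinv_ae; [exact: LV|by case: Lf1|].
  move=> sg; rewrite VE sign_indexK.
  by have := UiK (sqint_to_orthants oC sg Lf1); apply: filterS => t ->.
by apply: filterS => x ->.
Qed.

Let Vsq f : L2fun f -> L2sq (orthantV f) = L2sq f.
Proof.
move=> Lf; rewrite !L2sq_nrm2//; last exact: LV.
congr (_%:E); rewrite big_ord1 (nrm2_to_orthants oC (L1 Lf)) -sum_sign_of.
apply: eq_bigr => k _; rewrite VE; have [h _ _] := isoU.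
by apply: (h _ _).2; exact/sqint_to_orthants/L1.
Qed.

Let Wsq G : L2fun G -> L2sq (orthantVinv G) = L2sq G.
Proof.
by move=> LG; rewrite -Vsq; [apply: L2sq_ae => //; [exact/LV/LW|exact: VW]|exact: LW].
Qed.

Lemma unitary_orthantV : unitary_operator orthantV orthantVinv.
Proof.
have [U1 U2 U3] := isoU; have [Ui1 Ui2 Ui3] := isoUi.
split=> //.
- split=> //.
  + move=> f g Lf Lg /L2_aeP/(_ 0) fg; apply/L2_aeP => k.
    have := U3 _ _ (sqint_to_orthants oC (sign_of k) (L1 Lf)) (sqint_to_orthants oC (sign_of k) (L1 Lg))
       (ae_eq_to_orthants oC (sign_of k) (L1 Lf) (L1 Lg) fg).
    by apply: filterS => x; rewrite !mxE.
  + move=> c f g Lf Lg; apply/L2_aeP => k.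
    have := U2 c _ _ (sqint_to_orthants oC (sign_of k) (L1 Lf)) (sqint_to_orthants oC (sign_of k) (L1 Lg)).
    apply: filterS => x; rewrite !mxE => <-; congr (U _ x); apply/funext => t.
    by rewrite -to_orthantsD /to_orthants; congr (_ * _); rewrite !mxE.
  + by exists 1 => f Lf; rewrite mul1e Vsq.
- split=> //.
  + move=> f g Lf Lg /L2_aeP fg.
    have : \forall x \ae leb, orthantVinv f x 0 0 = orthantVinv g x 0 0.
      apply: orthantVinv_ae => //; first by case: (L1 (LW Lf)).
      move=> sg; have := Ui3 _ _ ((L2funP f).1 Lf (sign_index sg)) ((L2funP g).1 Lg (sign_index sg)) (fg _).
      by apply: filterS => t <-; rewrite WE to_orthantsK.
    by move=> H; apply/L2_aeP => k; rewrite ord1.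
  + move=> c f g Lf Lg.
    have L := L2fun_lin c (LW Lf) (LW Lg).
    have : \forall x \ae leb, (fun x => c *: orthantVinv f x + orthantVinv g x) x 0 0 =
       orthantVinv (fun x => c *: f x + g x) x 0 0.
      apply: orthantVinv_ae; [exact: L2fun_lin|by case: (L1 L)|].
      move=> sg.
      have := Ui2 c _ _ ((L2funP f).1 Lf (sign_index sg)) ((L2funP g).1 Lg (sign_index sg)).
      apply: filterS => t e.
      transitivity (Ui (fun t => c * f t (sign_index sg) 0 + g t (sign_index sg) 0) t).
        rewrite e; transitivity (to_orthants C (fun x => c * orthantVinv f x 0 0 + orthantVinv g x 0 0) sg t).
          by rewrite /to_orthants !mxE.
        by rewrite to_orthantsD !WE !to_orthantsK.
      by congr (Ui _ t); apply/funext => s; rewrite !mxE.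
    move=> H; apply/L2_aeP => k; rewrite ord1.
    by apply: filterS H => x <-.
  + by exists 1 => f Lf; rewrite mul1e Wsq.
- move=> f g Lf Lg; rewrite !L2dotE//; [|exact: LV|exact: LV].
  rewrite big_ord1 -(dot_to_orthants oC (L1 Lf) (L1 Lg)) -sum_sign_of.
  apply: eq_bigr => k _; rewrite !VE.
  by apply: (dot_isometry _ _ U1 U2); exact/sqint_to_orthants/L1.
Qed.

End orthant_unitary.

(** * Hausdorff operators *)

Section ae_integral.
Context {d} {T : measurableType d} {R : realType}.
Variable mu : {measure set T -> \bar R}.

Import HBNNSimple.

(** The integral of a nonnegative function is a supremum over the simple functions below it, which
    is monotone for arbitrary functions. *)
Lemma ge0_le_integral_nonmeasurable (f g : T -> \bar R) :
  (forall x, 0 <= f x)%E -> (forall x, f x <= g x)%E ->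
  (\int[mu]_x f x <= \int[mu]_x g x)%E.
Proof.
move=> f0 fg; have g0 x : (0 <= g x)%E by exact: le_trans (f0 x) (fg x).
rewrite !ge0_integralTE//; apply: le_ereal_sup => _ [h hf <-]; exists h => // x.
exact: le_trans (hf x) (fg x).
Qed.

(* [f] need not be measurable: it is sandwiched between modifications of [g]
   on a measurable null set. *)
Lemma ge0_ae_eq_integral_nonmeasurable (f g : T -> \bar R) : measurable_fun setT g ->
  (forall x, 0 <= f x)%E -> (forall x, 0 <= g x)%E -> (\forall x \ae mu, f x = g x) ->
  (\int[mu]_x f x = \int[mu]_x g x)%E.
Proof.
move=> mg f0 g0 [N [mN N0 subN]].
have fg x : ~ N x -> f x = g x.
  by move=> nN; apply: contrapT => h; apply: nN; apply: subN.
pose mod (c : \bar R) x := if x \in N then c else g x.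
have mmod c : measurable_fun setT (mod c).
  apply: measurable_fun_ifT => //.
  apply: (measurable_fun_bool true); rewrite setTI; move: mN; congr measurable.
  by apply/seteqP; split => x /=; [exact: mem_set|exact: set_mem].
have modE c : (0 <= c)%E -> (\int[mu]_x mod c x = \int[mu]_x g x)%E.
  move=> c0; apply: ge0_ae_eq_integral => //.
    by move=> x _; rewrite /mod; case: ifP.
  exists N; split => // x /= H; apply: contrapT => nN; apply: H => _; by rewrite /mod memNset.
apply/eqP; rewrite eq_le; apply/andP; split.
  rewrite -(modE +oo%E)//; apply: ge0_le_integral_nonmeasurable => // x.
  rewrite /mod; case: ifPn => [_|/negP nN]; first exact: leey.
  by rewrite fg// => h; apply: nN; rewrite inE.
rewrite -(modE 0%E)//; apply: ge0_le_integral_nonmeasurable => x.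
  by rewrite /mod; case: ifP.
rewrite /mod; case: ifPn => [_|/negP nN]; first exact: f0.
by rewrite fg// => h; apply: nN; rewrite inE.
Qed.

Lemma ae_eq_integral_nonmeasurable (f g : T -> \bar R) : measurable_fun setT g ->
  (\forall x \ae mu, f x = g x) -> (\int[mu]_x f x = \int[mu]_x g x)%E.
Proof.
move=> mg fg; rewrite integralE [RHS]integralE; congr (_ - _)%E.
  apply: ge0_ae_eq_integral_nonmeasurable => //; first exact: measurable_funepos.
  by apply: filterS fg => x e; rewrite !funeposE e.
apply: ge0_ae_eq_integral_nonmeasurable => //; first exact: measurable_funeneg.
by apply: filterS fg => x e; rewrite !funenegE e.
Qed.

Lemma ae_eq_cintegral_nonmeasurable (f g : T -> R[i]) : measurable_fun setT g ->
  (\forall x \ae mu, f x = g x) -> cintegral mu f = cintegral mu g.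
Proof.
move=> /measurable_complexP[mR mI] fg; rewrite /cintegral; congr Complex; congr fine.
  by apply: ae_eq_integral_nonmeasurable; [exact/measurable_EFinP|apply: filterS fg => x ->].
by apply: ae_eq_integral_nonmeasurable; [exact/measurable_EFinP|apply: filterS fg => x ->].
Qed.

Lemma ae_eq_normc (f g : T -> R[i]) : measurable_fun setT g ->
  (\forall x \ae mu, f x = g x) ->
  (\int[mu]_x (normc (f x))%:E = \int[mu]_x (normc (g x))%:E)%E.
Proof.
move=> mg fg; apply: ge0_ae_eq_integral_nonmeasurable.
- by apply/measurable_EFinP; exact: measurable_normc.
- by move=> x; rewrite lee_fin normc_ge0.
- by move=> x; rewrite lee_fin normc_ge0.
- by apply: filterS fg => x ->.
Qed.

End ae_integral.

(** * Restriction of the measure to the support of an integrable function *)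

Section support_measure.
Context {d} {T : measurableType d} {R : realType}.
Variables (mu : {measure set T -> \bar R}) (h : T -> R[i]).
Hypothesis Ih : cinteg mu h.

Definition supp : set T := [set u | h u != 0].

Let mh := cinteg_measurable Ih.

Lemma normc_gt0 (z : R[i]) : (0 < normc z) = (z != 0).
Proof.
rewrite lt_def normc_ge0 andbT; congr negb; apply/eqP/eqP => [/ComplexField.Normc.eq0_normc//|->].
by rewrite ComplexField.Normc.normc0.
Qed.

Lemma measurable_supp : measurable supp.
Proof.
have := measurable_normc mh measurableT (measurable_itv `]0, +oo[).
rewrite setTI; congr measurable; apply/seteqP; split => u /=;
  by rewrite in_itv /= andbT normc_gt0.
Qed.

Let msupp : measurable_fun setT (\1_supp : T -> R).
Proof. by apply: measurable_indic; exact: measurable_supp. Qed.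

Let supp0 x : 0 <= (\1_supp x : R). Proof. by []. Qed.

(** Integrals of functions that vanish with [h] are unchanged, while the measure becomes
    sigma-finite, as Fubini requires. *)
Definition supp_measure_fun : set T -> \bar R :=
  wpush_measure mu msupp supp0 (@measurable_id _ T setT).

HB.instance Definition _ := Measure.copy supp_measure_fun
  (wpush_measure mu msupp supp0 (@measurable_id _ T setT)).

Lemma ge0_integral_supp_measure (f : T -> \bar R) : measurable_fun setT f ->
  (forall x, 0 <= f x)%E -> (forall x, ~ supp x -> f x = 0%E) ->
  (\int[supp_measure_fun]_x f x = \int[mu]_x f x)%E.
Proof.
move=> mf f0 fS; rewrite ge0_integral_wpush//; apply: eq_integral => x _ /=.
rewrite indicE; have [/set_mem xS|/negP xS] := boolP (x \in supp); first by rewrite mule1.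
by rewrite fS ?mul0e// => h'; apply: xS; rewrite inE.
Qed.

(** By Markov's inequality [|h| > 1 / k.+1] holds on a set of measure at most [k.+1] times the
    integral of [|h|]; these sets exhaust the support, and the complement of the support has
    restricted measure 0. *)
Let supp_sigma_finite : sigma_finite setT supp_measure_fun.
Proof.
pose E k := [set u | k.+1%:R^-1 < normc (h u)].
have mE k : measurable (E k).
  have := measurable_normc mh measurableT (measurable_itv `]k.+1%:R^-1, +oo[).
  by rewrite setTI; congr measurable; apply/seteqP; split => u /=; rewrite in_itv /= andbT.
exists (fun k => E k `|` ~` supp).
  apply/esym/seteqP; split => // u _.
  have [hu|hu] := pselect (supp u); last by exists 0%N => //; right.
  move: (hu); rewrite /supp /= -normc_gt0 => n0.
  exists (Num.bound (normc (h u))^-1) => //; left; rewrite /E /=.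
  rewrite invf_plt ?posrE ?ltr0n//; apply: (lt_le_trans (archi_boundP _)).
    by rewrite invr_ge0 normc_ge0.
  by rewrite ler_nat.
move=> k; have mS := measurable_supp; split; first by apply: measurableU => //; exact: measurableC.
have mES : measurable (E k `|` ~` supp) by apply: measurableU => //; exact: measurableC.
rewrite /supp_measure_fun /= /wpush preimage_id integral_indic//.
have -> : supp `&` (E k `|` ~` supp) = E k.
  apply/seteqP; split => [u [Su [//|]]|u Eu]; first by [].
  split; last by left.
  by rewrite /supp /= -normc_gt0; apply: le_lt_trans Eu; rewrite invr_ge0.
have k0 : 0 < k.+1%:R :> R by rewrite ltr0n.
apply: (@le_lt_trans _ _ (\int[mu]_u (k.+1%:R%:E * (normc (h u))%:E))%E).
  have -> : mu (E k) = (\int[mu]_u (\1_(E k) u)%:E)%E by rewrite integral_indic// setIT.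
  apply: ge0_le_integral => //.
  - by apply/measurable_EFinP; exact: measurable_indic.
  - apply: emeasurable_funM => //; apply/measurable_EFinP.
    exact: measurable_normc.
  - move=> u _; rewrite -EFinM lee_fin indicE.
    have [/set_mem Eu|_] := boolP (u \in E k); last by rewrite mulr_ge0 ?normc_ge0// ltW.
    by rewrite -ler_pdivrMl// mulr1 ltW.
rewrite ge0_integralZl_EFin//.
- have := cinteg_normc_lty Ih; rewrite -ge0_fin_numE; last first.
    by apply: integral_ge0 => u _; rewrite lee_fin normc_ge0.
  by move=> /fineK <-; rewrite -EFinM ltry.
- by move=> u _; rewrite lee_fin normc_ge0.
- by apply/measurable_EFinP; exact: measurable_normc.
Qed.

HB.instance Definition _ :=
  Measure_isSigmaFinite.Build _ _ _ supp_measure_fun supp_sigma_finite.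

Definition supp_measure : {sigma_finite_measure set T -> \bar R} := supp_measure_fun.

Lemma integral_supp_measure (f : T -> \bar R) : measurable_fun setT f ->
  (forall x, ~ supp x -> f x = 0%E) ->
  (\int[supp_measure]_x f x = \int[mu]_x f x)%E.
Proof.
move=> mf fS; rewrite [LHS]integralE [RHS]integralE; congr (_ - _)%E.
  apply: ge0_integral_supp_measure; [exact: measurable_funepos|by []|].
  by move=> x /fS; rewrite funeposE => ->; rewrite maxxx.
apply: ge0_integral_supp_measure; [exact: measurable_funeneg|by []|].
by move=> x /fS; rewrite funenegE => ->; rewrite oppe0 maxxx.
Qed.

Lemma cintegral_supp_measure (f : T -> R[i]) : measurable_fun setT f ->
  (forall x, ~ supp x -> f x = 0) -> cintegral supp_measure f = cintegral mu f.
Proof.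
move=> /measurable_complexP[mR mI] f0; rewrite /cintegral; congr Complex; congr fine.
  by apply: integral_supp_measure; [exact/measurable_EFinP|move=> x /f0 ->].
by apply: integral_supp_measure; [exact/measurable_EFinP|move=> x /f0 ->].
Qed.

Lemma cinteg_supp_measure : cinteg supp_measure h.
Proof.
apply: cinteg_normc => //; rewrite integral_supp_measure.
- exact: cinteg_normc_lty.
- by apply/measurable_EFinP; exact: measurable_normc.
- by move=> x /negP; rewrite negbK => /eqP ->; rewrite ComplexField.Normc.normc0.
Qed.

End support_measure.

(** * Positive definite matrices in the diagonalizing basis *)

Section posdef_diag.
Context {R : realType} {n : nat}.
Variable C : 'M[R]_n.
Hypothesis oC : orthogonal_mx C.

Lemma orthogonal_unitmx : C \in unitmx.
Proof. by have [] := mulmx1_unit oC. Qed.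

Lemma invmx_orthogonal : invmx C = C^T.
Proof. by rewrite -[RHS]mulmx1 -(mulmxV orthogonal_unitmx) mulmxA oC mul1mx. Qed.

Lemma mulmx_orthogonal_tr : C *m C^T = 1%:M.
Proof. by rewrite -invmx_orthogonal mulmxV// orthogonal_unitmx. Qed.

Definition expD (b y : 'cV[R]_n) : 'cV[R]_n := \col_i (expR (b i 0) * y i 0).

(** Reading off diagonal entries makes this a measurable function of an arbitrary matrix; it
    consists of the logarithms of the eigenvalues when [M] is positive definite and diagonalized by
    [C]. *)
Definition lnD (M : 'M[R]_n) : 'cV[R]_n := \col_j ln ((C^T *m M *m C) j j).

Lemma expD_expV sg (b t : 'cV[R]_n) : expD b (expV sg t) = expV sg (t + b).
Proof. by apply/colP => i; rewrite !mxE expRD mulrCA [expR (b i 0) * _]mulrC. Qed.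

Lemma measurable_lnD : measurable_fun setT lnD.
Proof.
apply: measurable_cVP => j; under eq_fun do rewrite mxE.
apply: (measurableT_comp (@measurable_ln R)).
rewrite (_ : (fun s => _) = fun M : 'M[R]_n => \sum_k (\sum_l C l j * M l k) * C k j).
  apply: measurable_sum => k; apply: measurable_funM => //.
  apply: measurable_sum => l; apply: measurable_funM => //.
  exact: measurable_entry.
apply/funext => M; rewrite mxE; apply: eq_bigr => k _; rewrite mxE; congr (_ * _).
by apply: eq_bigr => l _; rewrite mxE.
Qed.

Lemma measurable_expD {d} {S : measurableType d} (b y : S -> 'cV[R]_n) :
  measurable_fun setT b -> measurable_fun setT y ->
  measurable_fun setT (fun s => expD (b s) (y s)).
Proof.
move=> mb my; apply: measurable_cVP => i; under eq_fun do rewrite mxE.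
apply: measurable_funM; last exact: measurable_funV_entry.
by apply: (measurableT_comp (@measurable_expR R)); exact: measurable_funV_entry.
Qed.

Variable A : 'M[R]_n.
Hypothesis pA : posdef A.
Hypothesis dA : is_diag_mx (invmx C *m A *m C).

Let E := C^T *m A *m C.

Let Ediag i j : i != j -> E i j = 0.
Proof. by move=> ij; move: dA; rewrite invmx_orthogonal => /is_diag_mxP; apply. Qed.

Let E_gt0 j : 0 < E j j.
Proof.
have [_ /(_ (C *m delta_mx j 0))] := pA.
rewrite (_ : (_ *m A *m _) 0 0 = E j j); last first.
  rewrite trmx_mul trmx_delta -!mulmxA (mulmxA C^T) (mulmxA (C^T *m A)) -/E -rowE.
  by rewrite -colE !mxE.
apply; apply/eqP => /(congr1 (mulmx C^T)).
rewrite mulmxA oC mul1mx mulmx0 => /matrixP/(_ j 0); rewrite !mxE !eqxx => /eqP.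
by rewrite oner_eq0.
Qed.

Let AE : A = C *m E *m C^T.
Proof. by rewrite /E !mulmxA mulmx_orthogonal_tr mul1mx -mulmxA mulmx_orthogonal_tr mulmx1. Qed.

Lemma posdef_mulmxE x : A *m x = C *m expD (lnD A) (C^T *m x).
Proof.
have -> : A *m x = C *m (E *m (C^T *m x)) by rewrite {1}AE !mulmxA.
congr (_ *m _); apply/colP => i.
rewrite mxE (bigD1 i)//= big1 ?addr0 => [|j ji]; last by rewrite Ediag ?mul0r// eq_sym.
rewrite [in RHS]mxE [lnD _ _ _]mxE -/E lnK//.
by rewrite posrE; exact: E_gt0.
Qed.

Lemma posdef_detE : \det A = expR (sumV (lnD A)).
Proof.
have -> : \det A = \det E.
  by rewrite /E !det_mulmx mulrAC -mulrA mulrA -det_mulmx oC det1 mul1r.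
have -> : E = diag_mx (\row_j E j j).
  apply/matrixP => i j; rewrite [diag_mx _ _ _]mxE [(\row_j _) _ _]mxE.
  by have [->|ij] := eqVneq i j; rewrite ?mulr1n// mulr0n Ediag.
rewrite det_diag /sumV expR_sum; apply: eq_bigr => j _.
rewrite [(\row_j _) _ _]mxE [lnD _ _ _]mxE -/E lnK//.
by rewrite posrE; exact: E_gt0.
Qed.

Lemma posdef_det_powR : \det A `^ (- 2^-1) = expR (- (sumV (lnD A) / 2)).
Proof. by rewrite posdef_detE /powR gt_eqF ?expR_gt0// expRK mulNr mulrC. Qed.

End posdef_diag.

Lemma cpow_eigenvals {R : realType} n (C A : 'M[R]_n) (s : 'cV[R]_n) : orthogonal_mx C ->
  cpow (eigenvals C A) (\col_j (- ('i%C * (s j 0)%:C%C))) = cis (- dotV (lnD C A) s).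
Proof.
move=> oC; rewrite /cpow /dotV -sumrN.
elim/big_rec2: _ => [|j x y _ ->]; first by rewrite cis0.
rewrite cisD; congr (_ * _); rewrite /cexp !mxE invmx_orthogonal//; simpc.
by rewrite /= expR0 !mul1r /cis (mulrC (s j 0)).
Qed.

(** * The Hausdorff operator as an average of translations *)

Section hausdorff_core.
Context {R : realType} {n : nat} {d} {Omega : measurableType d}.
Variable mu : {measure set Omega -> \bar R}.
Local Notation leb := (@lebesgue_cV R n).
Variables (D : set Omega) (A g : Omega -> 'M[R]_n) (C : 'M[R]_n).
Hypothesis mg : measurable_fun setT g.
Hypothesis Ag : A = g %[ae mu in D].
Hypothesis A_posdef : forall u, D u -> posdef (A u).
Hypothesis dC : diagonalizes mu D A C.
Variables U Ui : ('cV[R]_n -> R[i]) -> 'cV[R]_n -> R[i].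
Hypothesis isoU : isometric_map leb leb U.
Hypothesis isoUi : isometric_map leb leb Ui.
Hypothesis UiK : forall f, sqint leb f -> \forall x \ae leb, Ui (U f) x = f x.
Hypothesis UK : forall f, sqint leb f -> \forall x \ae leb, U (Ui f) x = f x.
Hypothesis Utrans : forall c F, sqint leb F ->
  \forall s \ae leb, U (fun t => F (t + c)) s = cis (- dotV c s) * U F s.
Variable Phi : Omega -> R[i].
Hypothesis PhiD : \forall u \ae mu, Phi u != 0 -> D u.
Variable h : Omega -> R[i].
Hypothesis Ih : cinteg mu h.
Hypothesis hE : \forall u \ae mu, (\det (A u) `^ (- 2^-1))%:C%C * Phi u = h u.

Let oC : orthogonal_mx C := dC.1.
Let b u : 'cV[R]_n := lnD C (g u).
Let nu := supp_measure Ih.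
Let phi := trans_symbol nu h b.

Let mh := cinteg_measurable Ih.

Let mb : measurable_fun setT b.
Proof. exact: (measurableT_comp (measurable_lnD C) mg). Qed.

(** A measurable version of the integrand, jointly in [x] and [u], with [h] and [g] in place of
    [Phi] and [A]. The factor [e^(sum b / 2)] undoes the [(det A)^(-1/2)] contained in [h]. *)
Let kernel (f : 'cV[R]_n -> R[i]) (x : 'cV[R]_n) (u : Omega) : R[i] :=
  h u * ((expR (sumV (b u) / 2))%:C%C * f (C *m expD (b u) (C^T *m x))).

(** The exceptional null set depends neither on [f] and [x] nor on [s]. Where [Phi] vanishes, so
    does [h] and both identities are trivial; elsewhere [u] lies in [D], and [A u] equals [g u] and
    is diagonalized by [C]. *)
Let goodP : \forall u \ae mu,
  (forall f x, Phi u * f (A u *m x) = kernel f x u) /\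
  forall s : 'cV[R]_n, Phi u * (\det (A u) `^ (- 2^-1))%:C%C *
    cpow (eigenvals C (A u)) (\col_j (- ('i%C * (s j 0)%:C%C))) = h u * cis (- dotV (b u) s).
Proof.
have [_ dC2] := dC.
have H : \forall u \ae mu, (Phi u != 0 -> D u) /\ (D u -> A u = g u).
  by apply: filterS2 PhiD Ag.
apply: filterS3 H hE dC2 => u [H1 H2] H3 H4.
have [P0|P0] := eqVneq (Phi u) 0.
  have h0 : h u = 0 by rewrite -H3 P0 mulr0.
  by split=> [f x|s]; rewrite /kernel P0 h0 !mul0r.
have Du := H1 P0; have pA := A_posdef Du; have dA := H4 Du.
have bE : b u = lnD C (A u) by rewrite /b -(H2 Du).
have pE := posdef_det_powR oC pA dA; split=> [f x|s].
  rewrite (posdef_mulmxE oC pA dA) /kernel -H3 pE bE mulrA; congr (_ * _).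
  rewrite mulrAC mulrC -rmorphM -expRD addNr expR0 mulr1.
  by [].
by rewrite cpow_eigenvals// -H3 bE mulrC [in RHS](mulrC _ (Phi u)) mulrC.
Qed.

Let mkernel (f : 'cV[R]_n -> R[i]) : measurable_fun setT f ->
  measurable_fun setT (fun z : 'cV[R]_n * Omega => kernel f z.1 z.2).
Proof.
move=> mf.
have mb2 : measurable_fun setT (fun z : 'cV[R]_n * Omega => b z.2).
  exact: (measurableT_comp mb measurable_snd).
apply: measurable_funcM; first exact: (measurableT_comp mh measurable_snd).
apply: measurable_funcM.
  apply: measurable_real_complex; apply: (measurableT_comp (@measurable_expR R)).
  by apply: measurable_funM => //; exact: measurable_sumV.
apply: (measurableT_comp mf); apply: measurable_funV_mulmx.
apply: measurable_expD => //; apply: measurable_funV_mulmx.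
exact: measurable_fst.
Qed.

Let mkernelx f x : measurable_fun setT f -> measurable_fun setT (kernel f x).
Proof. by move=> mf; have := measurableT_comp (mkernel mf) (pair1_measurable x). Qed.

Let kernel0 f x u : ~ supp h u -> kernel f x u = 0.
Proof. by move=> /negP; rewrite negbK => /eqP h0; rewrite /kernel h0 mul0r. Qed.

Let L1 (f : 'cV[R]_n -> 'cV[R[i]]_1) : L2fun f -> sqint leb (fun y => f y 0 0).
Proof. by move=> /L2funP/(_ 0). Qed.

Let hausdorffE (f : 'cV[R]_n -> 'cV[R[i]]_1) x : L2fun f ->
  hausdorff mu Phi A f x 0 0 = cintegral nu (kernel (fun y => f y 0 0) x).
Proof.
move=> Lf; have mf : measurable_fun setT (fun y => f y 0 0) by case: (L1 Lf).
rewrite mxE cintegral_supp_measure//; [|exact: mkernelx|by move=> u; exact: kernel0].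
apply: ae_eq_cintegral_nonmeasurable; first exact: mkernelx.
by apply: filterS goodP => u [H _]; exact: (H (fun y => f y 0 0)).
Qed.

Lemma symbol_trans : symbol mu C Phi A = phi.
Proof.
apply/funext => s; rewrite /phi /trans_symbol.
have ms : measurable_fun setT (fun u => h u * cis (- dotV (b u) s)).
  apply: measurable_funcM => //; apply: measurable_cis; apply: measurable_funN.
  by apply: measurable_dotV => //; exact: measurable_cst.
rewrite cintegral_supp_measure//; last first.
  by move=> u /negP; rewrite negbK => /eqP ->; rewrite mul0r.
apply: ae_eq_cintegral_nonmeasurable => //.
by apply: filterS goodP => u [_ H].
Qed.

Let Inu := cinteg_supp_measure Ih.

Let kernel_expV f (sg : {ffun 'I_n -> bool}) t u : kernel f (C *m expV sg t) u =
  (expR (- (sumV t / 2)))%:C%C * (h u * to_orthants C f sg (t + b u)).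
Proof.
rewrite /kernel /to_orthants mulmxA oC mul1mx expD_expV [in RHS]mulrCA; congr (_ * _).
rewrite mulrA -rmorphM -expRD; congr ((expR _)%:C%C * _).
have -> : sumV (t + b u) = sumV t + sumV (b u).
  by rewrite /sumV -big_split; apply: eq_bigr => i _; rewrite mxE.
by field.
Qed.

Let hausdorff_orthants f (sg : {ffun 'I_n -> bool}) : L2fun f -> \forall t \ae leb,
  to_orthants C (fun x => hausdorff mu Phi A f x 0 0) sg t =
  trans_avg nu h b (to_orthants C (fun y => f y 0 0) sg) t.
Proof.
move=> Lf; have := trans_avg_ae Inu mb (sqint_to_orthants oC sg (L1 Lf)).
apply: filterS => t [It _].
rewrite /to_orthants hausdorffE// (_ : kernel _ _ = fun u => (expR (- (sumV t / 2)))%:C%C *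
   (h u * to_orthants C (fun y => f y 0 0) sg (t + b u))); last first.
  by apply/funext => u; exact: kernel_expV.
by rewrite cintegralZ// mulrA -rmorphM -expRD subrr expR0 mul1r.
Qed.

Let mhausdorff f : L2fun f -> measurable_fun setT (fun x => hausdorff mu Phi A f x 0 0).
Proof.
move=> Lf; under eq_fun do rewrite hausdorffE//.
have mf : measurable_fun setT (fun y => f y 0 0) by case: (L1 Lf).
exact: (measurable_cintegral_section nu (mkernel mf)).
Qed.

Lemma L2fun_hausdorff f : L2fun f -> L2fun (hausdorff mu Phi A f).
Proof.
move=> Lf; apply/L2funP => k; rewrite ord1; apply: (sqint_orthantsP oC (mhausdorff Lf)) => sg.
have := sqint_trans_avg Inu mb (sqint_to_orthants oC sg (L1 Lf)).
move=> /sqint_ae; apply; first by apply: measurable_to_orthants; exact: mhausdorff.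
by have := hausdorff_orthants sg Lf; apply: filterS => t ->.
Qed.

Lemma cintegrable_hausdorff f : L2fun f -> \forall x \ae leb,
  cintegrable mu (hausdorff_integrand Phi A f x).
Proof.
move=> Lf; have Lf1 := L1 Lf; have [mf _] := Lf1.
pose p x := (\int[nu]_u (normc (kernel (fun y => f y 0 0) x u))%:E)%E.
have mk := (measurable_EFinP _ _).2 (measurable_normc (mkernel mf)).
have mp : measurable_fun setT p.
  by apply: (@measurable_fun_fubini_tonelli_F _ _ _ _ _ nu _ mk) => z; rewrite lee_fin normc_ge0.
(* [B] is measurable because [p] is a Tonelli section integral, so it can be tested in each orthant
   by [ae_orthants], where [trans_avg_ae] gives absolute convergence. *)
pose B := [set x | p x = +oo%E].
have mB : measurable B.
  by have := mp measurableT _ (emeasurable_set1 +oo%E); rewrite setTI.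
have : \forall x \ae leb, ~ B x.
  apply: (ae_orthants oC mB) => sg.
  have := trans_avg_ae Inu mb (sqint_to_orthants oC sg Lf1).
  apply: filterS => t [It _]; rewrite /B /= /p => E.
  have := cinteg_normc_lty (cintegZ (expR (- (sumV t / 2)))%:C%C It).
  under eq_integral do rewrite -kernel_expV.
  by rewrite E ltxx.
apply: filterS => x nB; rewrite /hausdorff_integrand.
have E : \forall u \ae mu, Phi u * f (A u *m x) 0 0 = kernel (fun y => f y 0 0) x u.
  by apply: filterS goodP => u [H _]; exact: (H (fun y => f y 0 0)).
have mkx := mkernelx x mf.
split.
  exists (kernel (fun y => f y 0 0) x) => //.
  by apply: filterS E => u e _.
rewrite (ae_eq_normc mkx E) -(integral_supp_measure Ih); last 2 first.
- by apply/measurable_EFinP; exact: measurable_normc.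
- by move=> u /kernel0 ->; rewrite ComplexField.Normc.normc0.
by rewrite ltey; apply/eqP.
Qed.

Lemma hausdorff_unitary_mul f : L2fun f ->
  hausdorff mu Phi A f =
  orthantVinv C Ui (mul_operator phi (orthantV C U f)) %[ae leb].
Proof.
move=> Lf; have Lf1 := L1 Lf.
have UV := unitary_orthantV oC isoU isoUi UiK UK.
have [[LV _ _ _] _ _ _ _] := UV.
have mphi := measurable_trans_symbol Inu mb.
have [Lphi _ _ _] := @bounded_mul_operator R n (2 ^ n) phi _ mphi (trans_symbol_bounded Inu mb).
apply/L2_aeP => k; rewrite ord1.
apply: (orthantVinv_ae oC isoUi (Lphi _ (LV _ Lf)) (mhausdorff Lf)) => sg.
have LFs := sqint_to_orthants oC sg Lf1.
have := trans_avgE Inu mb isoU Utrans isoUi UiK LFs.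
apply: filterS2 (hausdorff_orthants sg Lf) => t -> ->.
by congr (Ui _ t); apply/funext => s; rewrite !mxE sign_indexK.
Qed.

Lemma normal_hausdorff : normal_operator (hausdorff mu Phi A) /\
  @bounded_operator R n (2 ^ n) (2 ^ n) (mul_operator phi).
Proof.
have mphi := measurable_trans_symbol Inu mb.
have bphi := trans_symbol_bounded Inu mb.
split; last exact: bounded_mul_operator mphi bphi.
apply: (normal_operator_unitary_mul (unitary_orthantV oC isoU isoUi UiK UK) mphi bphi).
- exact: L2fun_hausdorff.
- exact: hausdorff_unitary_mul.
Qed.

End hausdorff_core.

Theorem theorem1 (R : realType) (n : nat) (Omega : ptopologicalType)
    (mu : {measure set (borel Omega) -> \bar R})
    (Omega_sigma_compact : sigma_compact Omega)
    (Omega_locally_compact : locally_compact [set: Omega])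
    (mu_regular : regular_borel mu)
    (D : set (borel Omega)) (A : borel Omega -> 'M[R]_n)
    (A_measurable : ae_measurable mu D A)
    (A_posdef : forall u, D u -> posdef (A u))
    (A_comm : forall u v, D u -> D v -> comm_mx (A u) (A v)) :
  (exists C : 'M[R]_n, diagonalizes mu D A C) /\
  forall C : 'M[R]_n, diagonalizes mu D A C ->
  exists (V : ('cV[R]_n -> 'cV[R[i]]_1) -> ('cV[R]_n -> 'cV[R[i]]_(2 ^ n)))
         (Vinv : ('cV[R]_n -> 'cV[R[i]]_(2 ^ n)) -> ('cV[R]_n -> 'cV[R[i]]_1)),
    unitary_operator V Vinv /\
    forall Phi : borel Omega -> R[i],
      locally_cintegrable mu Phi ->
      (\forall u \ae mu, Phi u != 0 -> D u) ->
      cintegrable mu (fun u => (\det (A u) `^ (- 2^-1))%:C%C * Phi u) ->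
      [/\ forall f, L2fun f -> \forall x \ae lebesgue_cV n,
            cintegrable mu (hausdorff_integrand Phi A f x),
          normal_operator (hausdorff mu Phi A),
          @bounded_operator _ _ (2 ^ n) _ (mul_operator (symbol mu C Phi A))
        & forall f, L2fun f ->
            hausdorff mu Phi A f =
              Vinv (mul_operator (symbol mu C Phi A) (V f))
            %[ae lebesgue_cV n]].
Proof.
split.
  have [|_ _ [u Du <-] [v Dv <-]|C oC CF] := @symmetric_codiagonalizable R n [set A u | u in D].
  - by move=> _ [u Du <-]; case: (A_posdef u Du).
  - exact: A_comm.
  exists C; split=> //; apply: aeW => u Du.
  by rewrite invmx_orthogonal//; apply: CF; exists u.
(* [U] is obtained from [n] alone and [orthantV] adds only [C], so the unitary map is fixed before
   any kernel is introduced. *)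
move=> C dC; have [U [Ui [isoU isoUi UiK UK Utrans]]] := @fourier_exists R n.
exists (orthantV C U), (orthantVinv C Ui).
split; first exact: (unitary_orthantV dC.1 isoU isoUi UiK UK).
move=> Phi _ PhiD [[h mh hE] hoo]; have [g mg Ag] := A_measurable.
have hE' : \forall u \ae mu, (\det (A u) `^ (- 2^-1))%:C%C * Phi u = h u.
  by apply: filterS hE => u; apply.
(* The integrability hypothesis concerns a function that may fail to be measurable; [ae_eq_normc]
   transfers the finite integral to its measurable representative [h]. *)
have Ih : cinteg mu h by apply: cinteg_normc => //; rewrite -(ae_eq_normc mh hE').
have [normalH bphi] := normal_hausdorff mg Ag A_posdef dC isoU isoUi UiK UK Utrans PhiD Ih hE'.
rewrite (symbol_trans mg Ag A_posdef dC PhiD Ih hE'); split=> // f Lf.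
- exact: (cintegrable_hausdorff mg Ag A_posdef dC PhiD Ih hE').
- exact: (hausdorff_unitary_mul mg Ag A_posdef dC isoU isoUi UiK UK Utrans PhiD Ih hE').
Qed.
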